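(* Let $m_1,m_2>0$, $d\ge 2$, and let $(X_1(t),X_2(t))$ be a circular or elliptic (eccentricity $e\in[0,1)$) Keplerian periodic motion of two primaries of masses $m_1,m_2$ in $\mathbb{R}^d$. Then for each $i\in\{1,2\}$ the restricted three-body problem $$\ddot q=-m_1\frac{q-X_1(t)}{|q-X_1(t)|^3}-m_2\frac{q-X_2(t)}{|q-X_2(t)|^3},\qquad q\in\mathbb{R}^d,$$ has infinitely many generalized periodic solutions accumulating the primary $X_i$.
   Context: The primaries satisfy the two-body problem $\ddot X_1=m_2\frac{X_2-X_1}{|X_2-X_1|^3}$, $\ddot X_2=m_1\frac{X_1-X_2}{|X_1-X_2|^3}$, with $X_1(t)\ne X_2(t)$ for all $t$, each moving periodically (with common period) on a circular or elliptic Keplerian orbit of eccentricity $e\in[0,1)$ in a fixed reference frame. A generalized solution near the primary $X_i$ is a continuous function $q:\mathbb{R}\to\mathbb{R}^d$, never meeting the other primary, such that the set $\mathcal{Z}=\{t: q(t)=X_i(t)\}$ of collision instants is discrete, $q$ satisfies the equation on $\mathbb{R}\setminus\mathcal{Z}$, and for every $t_0\in\mathcal{Z}$ the limits as $t\to t_0$ of $$\frac{q(t)-X_i(t)}{|q(t)-X_i(t)|}\qquad\text{and}\qquad \tfrac12|\dot q(t)-\dot X_i(t)|^2-\frac{m_i}{|q(t)-X_i(t)|}$$ exist (i.e. double collisions with the primary are regularized). It is a generalized periodic solution if it is a periodic function of $t$. The set $\mathcal Z$ may be empty. ''Infinitely many generalized periodic solutions accumulating the primary $X_i$'' means: there is an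 infinite sequence of pairwise distinct generalized periodic solutions $q_n$ with $\sup_t|q_n(t)-X_i(t)|\to0$ as $n\to\infty$. *)

(* Defs.v *)
From mathcomp Require Import all_boot all_order all_algebra.
From mathcomp Require Import all_classical all_reals all_analysis.
Set Implicit Arguments.
Unset Strict Implicit.
Unset Printing Implicit Defensive.
Import Order.TTheory GRing.Theory Num.Theory.
Import numFieldNormedType.Exports.
Local Open Scope ring_scope.
Local Open Scope classical_set_scope.

(* The norm `|x| of the normed module 'rV[R]_d is the sup norm; |x| in the
   equations of motion is the Euclidean one.  Limits, continuity and
   derivatives do not depend on this choice. *)
Definition edot (R : realType) (d : nat) (x y : 'rV[R]_d) : R :=
  \sum_(k < d) x 0 k * y 0 k.

Definition enorm (R : realType) (d : nat) (x : 'rV[R]_d) : R :=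
  Num.sqrt (edot x x).

(* q is twice differentiable at t with second derivative a.  Since derive1 is
   a total function, differentiability of q around t has to be required. *)
Definition has_accel (R : realType) (d : nat)
    (q : R -> 'rV[R]_d) (t : R) (a : 'rV[R]_d) : Prop :=
  (\forall s \near t, derivable q s 1) /\ is_derive t 1 (derive1 q) a.

(* Acceleration at x due to a mass m at y (gravitational constant 1). *)
Definition gravity (R : realType) (d : nat) (m : R) (y x : 'rV[R]_d) :
    'rV[R]_d :=
  - (m / enorm (x - y) ^+ 3) *: (x - y).

(* Ellipse with focus c, semi-major axis a and eccentricity e, in the plane
   c + span(u, v), u pointing to the periapsis; s is the eccentric anomaly. *)
Definition ellipse (R : realType) (d : nat) (e a : R) (c u v : 'rV[R]_d) :
    set 'rV[R]_d :=
  range (fun s : R => c + (a * (cos s - e)) *: u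
                        + (a * Num.sqrt (1 - e ^+ 2) * sin s) *: v).

Definition kepler_orbit (R : realType) (d : nat) (e : R) (c : 'rV[R]_d)
    (x : R -> 'rV[R]_d) : Prop :=
  exists (a : R) (u v : 'rV[R]_d),
    [/\ 0 < a, edot u u = 1, edot v v = 1, edot u v = 0
      & range x = ellipse e a c u v].

(* The two primaries are indexed by 'I_2 = {0, 1}.  The common focus c of the
   two orbits is fixed. *)
Definition keplerian_motion (R : realType) (d : nat) (m : 'I_2 -> R) (e : R)
    (X : 'I_2 -> R -> 'rV[R]_d) : Prop :=
  [/\ forall (i j : 'I_2) t, i != j -> X i t != X j t,
      forall (i j : 'I_2) t, i != j ->
        has_accel (X i) t (gravity (m j) (X j t) (X i t)),
      exists2 T : R, 0 < T & forall i, periodic (X i) T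
    & exists c : 'rV[R]_d, forall i, kepler_orbit e c (X i)].

Definition collisions (R : realType) (d : nat) (x q : R -> 'rV[R]_d) : set R :=
  [set t | q t = x t].

Definition generalized_solution (R : realType) (d : nat) (m : 'I_2 -> R)
    (X : 'I_2 -> R -> 'rV[R]_d) (i : 'I_2) (q : R -> 'rV[R]_d) : Prop :=
  let Z := collisions (X i) q in
  [/\ continuous q,
      forall (j : 'I_2) t, j != i -> q t != X j t,
      isolated Z = Z,
      forall t, ~ Z t ->
        has_accel q t (\sum_(j < 2) gravity (m j) (X j t) (q t))
    & forall t0, Z t0 ->
        cvg ((enorm (q t - X i t))^-1 *: (q t - X i t) @[t --> t0^']) /\
        cvg (2^-1 * enorm (derive1 q t - derive1 (X i) t) ^+ 2
               - m i / enorm (q t - X i t) @[t --> t0^'])].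

Definition generalized_periodic_solution (R : realType) (d : nat)
    (m : 'I_2 -> R) (X : 'I_2 -> R -> 'rV[R]_d) (i : 'I_2)
    (q : R -> 'rV[R]_d) : Prop :=
  generalized_solution m X i q /\ exists2 T : R, 0 < T & periodic q T.

Definition infinitely_many_accumulating (R : realType) (d : nat)
    (m : 'I_2 -> R) (X : 'I_2 -> R -> 'rV[R]_d) (i : 'I_2) : Prop :=
  exists q : nat -> R -> 'rV[R]_d,
    [/\ injective q,
        forall n, generalized_periodic_solution m X i (q n)
      & ereal_sup (range (fun t : R => (enorm (q n t - X i t))%:E))
          @[n --> \oo] --> 0%E].

(* Main.v *)
(* For z = q - X_i the equation only involves the relative motion D = X_j - X_i,
   a periodic Kepler motion, which after a translation of time is planar and
   symmetric with respect to its axis under time reversal.  In that plane there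
   are almost circular periodic orbits z of small radius, hence without
   collisions.  Writing eta ^ 2 for the scale of the radius, the osculating
   elements obey a system in which the angular momentum and the eccentricity
   vector move at rate eta ^ 3 and the longitude at rate eta ^ -3.  An orbit that
   starts orthogonally to the axis of symmetry and meets it again orthogonally
   after half a period of the primaries is periodic; these are two equations in
   two unknowns, the initial angular momentum and eccentricity.  As the initial
   angular momentum varies, the longitude after half a period passes a multiple
   of pi, and first order averaging (the apsidal precession of lunar theory) shows that the transversal
   component of the eccentricity vector after half a period has the sign of the
   initial eccentricity, so the Poincare-Miranda theorem gives a solution for
   every small eta. *)
Require Import Defs.
From mathcomp Require Import all_boot all_order all_algebra.
From mathcomp Require Import all_classical all_reals all_analysis.
From mathcomp Require Import ring lra.
Set Implicit Arguments.
Unset Strict Implicit.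
Unset Printing Implicit Defensive.
Import Order.TTheory GRing.Theory Num.Theory.
Import numFieldNormedType.Exports.
Local Open Scope ring_scope.
Local Open Scope classical_set_scope.

(** * Real derivatives *)

Section RealDerivatives.
Variable R : realType.
Implicit Types (f g : R -> R) (t a b : R).

(** The obstacle is the degeneracy of the Kepler problem: without the tide every ellipse stays
    fixed, so the eccentricity vector has no frequency of its own, and circular orbits cannot be
    continued by a nondegenerate implicit function argument. Only the slow apsidal precession helps,
    and it is hidden under oscillating terms. The component [k2] is therefore corrected by an
    explicit function of time and longitude, which is small because the longitude is fast. What is
    left of the rate is a mean, with a part of definite sign proportional to 1 / rho ^ 3 and an
    indefinite quadrupole part proportional to (d1 ^ 2 - d2 ^ 2) / rho ^ 5. The latter integrates to
    zero over half a period of the primaries, whatever their eccentricity, because their relative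
    motion is a Kepler ellipse. The errors are quadratic in the initial eccentricity and in eta:
    that eccentricity is fixed first, and eta is chosen small afterwards. Only signs on the boundary
    of a rectangle of initial data are needed, never derivatives of the flow. *)

Definition drv f t a : Prop := is_derive t 1 f a.

Lemma drv_eq f t a b : drv f t a -> a = b -> drv f t b.
Proof. by move=> h <-. Qed.

Lemma drv_ext f g t a : (forall s, f s = g s) -> drv f t a -> drv g t a.
Proof. by move=> /funext ->. Qed.

Lemma drv_cst c t : drv (fun=> c) t 0.
Proof. exact: is_derive_cst. Qed.

Lemma drv_id t : drv (fun s => s) t 1.
Proof. exact: is_derive_id. Qed.

Lemma drvD f g t a b : drv f t a -> drv g t b -> drv (fun s => f s + g s) t (a + b).
Proof. by move=> hf hg; exact: is_deriveD. Qed.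

Lemma drvB f g t a b : drv f t a -> drv g t b -> drv (fun s => f s - g s) t (a - b).
Proof. by move=> hf hg; exact: is_deriveB. Qed.

Lemma drvN f t a : drv f t a -> drv (fun s => - f s) t (- a).
Proof. by move=> hf; exact: is_deriveN. Qed.

Lemma drvM f g t a b : drv f t a -> drv g t b ->
  drv (fun s => f s * g s) t (a * g t + f t * b).
Proof.
move=> hf hg; have := @is_deriveM _ _ f g t 1 a b hf hg.
by move/drv_eq; apply; rewrite /GRing.scale/= [g t * a]mulrC addrC.
Qed.

Lemma drvV f t a : f t != 0 -> drv f t a -> drv (fun s => (f s)^-1) t (- (a / f t ^+ 2)).
Proof.
move=> f0 [hf hd]; split; first exact: derivableV.
by rewrite deriveV// hd /GRing.scale/= mulNr [_^-1 * a]mulrC.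
Qed.

Lemma drv_comp f g t a b : drv g t b -> drv f (g t) a -> drv (fun s => f (g s)) t (a * b).
Proof.
move=> hg hf; apply: drv_eq; first exact: (is_derive1_comp hf hg).
by rewrite mulrC.
Qed.

Lemma drvX f t a n : drv f t a -> drv (fun s => f s ^+ n) t (n%:R * f t ^+ n.-1 * a).
Proof.
move=> hf; elim: n => [|n IH].
  by rewrite !mul0r; under [X in drv X]funext do rewrite expr0; exact: drv_cst.
under [X in drv X]funext do rewrite exprS.
apply: drv_eq; first exact: drvM hf IH.
case: n {IH} => [|n] /=; first by ring.
by rewrite !exprS -(natr1 n.+1); ring.
Qed.

Lemma drv_cos f t a : drv f t a -> drv (fun s => cos (f s)) t (- sin (f t) * a).
Proof. by move=> hf; apply: (@drv_comp cos f) => //; exact: is_derive_cos. Qed.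

Lemma drv_sin f t a : drv f t a -> drv (fun s => sin (f s)) t (cos (f t) * a).
Proof. by move=> hf; apply: (@drv_comp sin f) => //; exact: is_derive_sin. Qed.

Lemma drv_expR f t a : drv f t a -> drv (fun s => expR (f s)) t (expR (f t) * a).
Proof. by move=> hf; apply: (@drv_comp expR f) => //; exact: is_derive_expR. Qed.

Lemma drv_sqrt f t a : 0 < f t -> drv f t a ->
  drv (fun s => Num.sqrt (f s)) t (a / (2 * Num.sqrt (f t))).
Proof.
move=> f0 hf; have h : drv Num.sqrt (f t) (2 * Num.sqrt (f t))^-1.
  exact: is_derive1_sqrt.
by rewrite mulrC; exact: drv_comp hf h.
Qed.

Lemma drv_cont f t a : drv f t a -> {for t, continuous f}.
Proof. by move=> [hf _]; apply/differentiable_continuous/derivable1_diffP. Qed.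

Lemma drv_unique f t a b : drv f t a -> drv f t b -> a = b.
Proof. by move=> [_ <-] [_ <-]. Qed.

Lemma drv_shift f t a c : drv f (t + c) a -> drv (fun s => f (s + c)) t a.
Proof.
move=> h; apply: drv_eq.
  apply: (@drv_comp f (fun s => s + c)); last exact: h.
  exact: drvD (drv_id t) (drv_cst c t).
by rewrite addr0 mulr1.
Qed.

Lemma drv_refl f t a c : drv f (c - t) a -> drv (fun s => f (c - s)) t (- a).
Proof.
move=> h; apply: drv_eq.
  apply: (@drv_comp f (fun s => c - s)); last exact: h.
  exact: drvB (drv_cst c t) (drv_id t).
by rewrite sub0r mulrN1.
Qed.

Lemma drv_opp f t a : drv f (- t) a -> drv (fun s => f (- s)) t (- a).
Proof.
move=> h; apply: drv_eq.
  apply: (@drv_comp f (fun s => - s)); last exact: h.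
  exact: drvN (drv_id t).
by rewrite mulrN1.
Qed.

(** Inequalities are integrated throughout by this comparison form of the mean value theorem;
    integrals occur only in the construction of primitives. *)
Lemma drv_le f g f' g' a b : a <= b ->
  (forall t, a <= t <= b -> drv f t (f' t)) ->
  (forall t, a <= t <= b -> drv g t (g' t)) ->
  (forall t, a <= t <= b -> f' t <= g' t) ->
  f b - f a <= g b - g a.
Proof.
move=> ab hf hg hl.
have [||c cab e] := @MVT_segment R (fun t => g t - f t) (fun t => g' t - f' t) a b ab.
- move=> x; rewrite in_itv/= => /andP[/ltW ax /ltW xb].
  by apply: drvB; [apply: hg|apply: hf]; rewrite ax xb.
- apply: continuous_in_subspaceT => x; rewrite inE/= in_itv/= => xab.
  by apply: (@drv_cont _ _ (g' x - f' x)); apply: drvB; [apply: hg|apply: hf].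
move: cab; rewrite in_itv/= => cab.
have : 0 <= (g' c - f' c) * (b - a).
  by apply: mulr_ge0; rewrite subr_ge0//; exact: hl.
by rewrite -e; lra.
Qed.

Lemma drv_absle f f' B a b : a <= b ->
  (forall t, a <= t <= b -> drv f t (f' t)) ->
  (forall t, a <= t <= b -> `|f' t| <= B) ->
  `|f b - f a| <= B * (b - a).
Proof.
move=> ab hf hB.
have hl c : forall t, a <= t <= b -> drv (fun s => s * c) t c.
  move=> t _; apply: drv_eq; first exact: drvM (drv_id t) (drv_cst c t).
  by rewrite mul1r mulr0 addr0.
rewrite ler_norml; apply/andP; split.
  have := @drv_le (fun s => s * (- B)) f _ _ a b ab (hl _) hf.
  have -> : b * - B - a * - B = - (B * (b - a)) by ring.
  by apply => t /hB; rewrite ler_norml => /andP[].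
have := @drv_le f (fun s => s * B) _ _ a b ab hf (hl _).
have -> : b * B - a * B = B * (b - a) by ring.
by apply => t /hB; rewrite ler_norml => /andP[].
Qed.

Lemma drv0_cst f : (forall t, drv f t 0) -> forall s t, f s = f t.
Proof.
move=> h s t; wlog st : s t / s <= t => [W|].
  by have [/W//|/ltW/W ->] := leP s t.
have H : `|f t - f s| <= 0 * (t - s).
  by apply: drv_absle st (fun u _ => h u) _ => u _; rewrite normr0.
by move: H; rewrite mul0r normr_le0 subr_eq0 => /eqP.
Qed.

(** With the integrating factor exp (- K t) the function becomes nonincreasing for t >= 0. Negative
    times follow by reversing time, which is why the hypothesis bounds the absolute value of u'. *)
Lemma gronwall (u u' : R -> R) K : (forall t, drv u t (u' t)) ->
  (forall t, `|u' t| <= K * u t) ->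
  forall t, u t <= u 0 * expR (K * `|t|).
Proof.
move=> hu hK.
have key (v v' : R -> R) : (forall t, drv v t (v' t)) -> (forall t, v' t <= K * v t) ->
    forall t, 0 <= t -> v t <= v 0 * expR (K * t).
  move=> hv hvK t t0.
  have hd s : drv (fun s => v s * expR (- (K * s))) s ((v' s - K * v s) * expR (- (K * s))).
    apply: drv_eq; first apply: drvM (hv s) (drv_expR (drvN (drvM (drv_cst K s) (drv_id s)))).
    by rewrite /=; ring.
  have := @drv_le _ (fun=> 0) _ (fun=> 0) 0 t t0 (fun s _ => hd s) (fun s _ => drv_cst 0 s).
  rewrite /= mulr0 oppr0 expR0 mulr1 addr0 => /(_ _) H.
  have {}H : v t * expR (- (K * t)) <= v 0.
    rewrite -subr_le0; apply: H => s _.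
    by rewrite pmulr_lle0 ?expR_gt0// subr_le0.
  by rewrite expRN ler_pdivrMr ?expR_gt0 in H.
move=> t; have [t0|t0] := leP 0 t.
  rewrite ger0_norm//; apply: (key u u') => // s.
  exact: le_trans (ler_norm _) (hK s).
have /= := key (fun s => u (- s)) (fun s => - u' (- s)) _ _ (- t).
rewrite opprK oppr0 ltr0_norm//; apply; last by lra.
  by move=> s; apply: drv_opp.
by move=> s; apply: le_trans (hK (- s)); rewrite -normrN ler_norm.
Qed.

(** Integrals from a fixed left end give primitives on bounded intervals. These are glued: two of
    them differ by a constant where both are valid, and subtracting the value at 0 removes it. *)
Lemma primitive f : continuous f -> exists2 F, F 0 = 0 & forall t, drv F t (f t).
Proof.
move=> cf.
pose P (n : nat) F := forall t, `|t| < n.+1%:R -> drv F t (f t).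
have ex n : exists F, P n F.
  pose u : R := n.+2%:R.
  exists (fun x => \int[lebesgue_measure]_(t in `[- u, x]) f t)%R => t.
  rewrite ltr_norml => /andP[t1 t2].
  have uE : u = n.+1%:R + 1 by rewrite /u -natr1.
  have [] := @continuous_FTC1_closed R f (- u) t u.
  - by rewrite uE; lra.
  - apply: continuous_compact_integrable; first exact: segment_compact.
    exact: continuous_subspaceT.
  - by rewrite uE; lra.
  - exact: cf.
  by move=> h1 h2; split; [exact: h1|rewrite -h2 derive1E].
have [F hF] := choice ex.
have P0 n t : `|t| < n.+1%:R -> F n t - F n 0 = F (Num.truncn `|t|) t - F (Num.truncn `|t|) 0.
  move=> tn.
  set k := Num.truncn _.
  have tk : `|t| < k.+1%:R by rewrite /k truncnS_gt.
  have hd x : `|x| <= `|t| -> drv (fun s => F n s - F k s) x 0.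
    move=> xt; rewrite -(subrr (f x)); apply: drvB; apply: hF; exact: le_lt_trans xt _.
  have : `|(F n t - F k t) - (F n 0 - F k 0)| <= 0.
    have [t0|/ltW t0] := leP 0 t.
      rewrite -[leRHS](mul0r (t - 0)); apply: (@drv_absle (fun s => F n s - F k s) (fun=> 0) 0 _ _ t0) => s /andP[s0 st].
        by apply: hd; rewrite !ger0_norm// (le_trans s0).
      by rewrite normr0.
    rewrite distrC -[leRHS](mul0r (0 - t)); apply: (@drv_absle (fun s => F n s - F k s) (fun=> 0) 0 _ _ t0) => s /andP[s0 st].
      by apply: hd; rewrite !ler0_norm// ?lerN2// (le_trans s0).
    by rewrite normr0.
  by rewrite normr_le0 => /eqP; lra.
(* The index may jump near a given t, but by [P0] the function agrees there with one fixed [F n]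
   minus its value at 0. *)
exists (fun t => F (Num.truncn `|t|) t - F (Num.truncn `|t|) 0); first by rewrite normr0 subrr.
move=> t.
pose n := Num.truncn `|t|.
have tn : `|t| < n.+1%:R by rewrite /n truncnS_gt.
have : drv (fun s => F n s - F n 0) t (f t).
  by rewrite -[f t]subr0; apply: drvB; [exact: hF|exact: drv_cst].
apply: near_eq_is_derive.
near=> s; apply: P0.
near: s; apply: (@cvgr_lt _ _ _ _ (fun s : R => `|s|) `|t|) => //.
exact: norm_continuous.
Unshelve. all: end_near. Qed.

End RealDerivatives.

(** * Ordinary differential equations *)

Section Picard.
Variable R : realType.

Lemma primitive_ex2 (f : R -> R) : continuous f ->
  exists F, F 0 = 0 /\ forall t, drv F t (f t).
Proof. by move=> /primitive[F ? ?]; exists F. Qed.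

(** In the norm weighted by exp (- K |t|), integration from 0 gains a factor 1 / K. This makes the
    Picard operator a contraction on the whole line at once. *)
Lemma drv_expR_bound (G G' : R -> R) C K : 0 < K -> G 0 = 0 ->
  (forall t, drv G t (G' t)) -> (forall t, `|G' t| <= C * expR (K * `|t|)) ->
  forall t, `|G t| <= C / K * expR (K * `|t|).
Proof.
move=> K0 G0 hG hC.
have C0 : 0 <= C.
  by have := le_trans (normr_ge0 _) (hC 0); rewrite normr0 mulr0 expR0 mulr1.
have CK0 : 0 <= C / K by rewrite divr_ge0// ltW.
have key (F F' : R -> R) : F 0 = 0 -> (forall t, drv F t (F' t)) ->
    (forall t, `|F' t| <= C * expR (K * `|t|)) ->
    forall t, 0 <= t -> F t <= C / K * expR (K * t).
  move=> F0 hF hF' t t0.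
  have hg s : drv (fun s => C / K * expR (K * s)) s (C * expR (K * s)).
    apply: drv_eq; first apply: drvM (drv_cst _ s) (drv_expR (drvM (drv_cst K s) (drv_id s))).
    by rewrite /=; field; rewrite gt_eqF.
  have := @drv_le _ _ _ _ _ 0 t t0 (fun s _ => hF s) (fun s _ => hg s).
  rewrite F0 mulr0 expR0 => H.
  have : F t - 0 <= C / K * expR (K * t) - C / K * 1.
    apply: H => s /andP[s0 _]; rewrite -{2}(ger0_norm s0).
    exact: le_trans (ler_norm _) (hF' s).
  by lra.
have pm t : 0 <= t -> `|G t| <= C / K * expR (K * t) /\ `|G (- t)| <= C / K * expR (K * t).
  move=> t0; split; rewrite ler_norml -lerNl; apply/andP; split.
  - apply: (key (fun s => - G s) (fun s => - G' s)) => //; first by rewrite G0 oppr0.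
      by move=> s; exact: drvN.
    by move=> s; rewrite normrN.
  - exact: (key G G').
  - apply: (key (fun s => - G (- s)) (fun s => - - G' (- s))) => //.
    + by rewrite !oppr0 G0 oppr0.
    + by move=> s; apply: drvN; exact: drv_opp.
    + by move=> s; rewrite !normrN -(normrN s).
  - apply: (key (fun s => G (- s)) (fun s => - G' (- s))) => //.
    + by rewrite oppr0 G0.
    + by move=> s; exact: drv_opp.
    + by move=> s; rewrite !normrN -(normrN s).
move=> t; have [t0|/ltW t0] := leP 0 t; first by rewrite (ger0_norm t0); have [] := pm t t0.
by rewrite (ler0_norm t0); have [|_] := pm (- t); rewrite ?oppr_ge0// opprK.
Qed.

(** The numbers a k - 2 c / 2 ^ k and a k + 2 c / 2 ^ k are the ends of nested intervals, and the
    limit is the supremum of the left ends. *)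
Lemma geometric_limit (a : nat -> R) c : (forall k, `|a k.+1 - a k| <= c / 2 ^+ k) ->
  exists l, forall k, `|a k - l| <= 2 * c / 2 ^+ k.
Proof.
move=> h.
pose b k := a k - 2 * c / 2 ^+ k; pose d k := a k + 2 * c / 2 ^+ k.
have half k : 2 * c / 2 ^+ k.+1 = c / 2 ^+ k.
  by rewrite exprS; field; rewrite expf_neq0.
have c0 k : 0 <= c / 2 ^+ k by exact: le_trans (normr_ge0 _) (h k).
have two k : 2 * c / 2 ^+ k = 2 * (c / 2 ^+ k) by rewrite mulrA.
have bm k j : b k <= b (k + j)%N.
  elim: j => [|j IH]; first by rewrite addn0.
  apply: le_trans IH _; rewrite /b addnS half two.
  by have := h (k + j)%N; rewrite ler_norml => /andP[]; lra.
have dm k j : d (k + j)%N <= d k.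
  elim: j => [|j IH]; first by rewrite addn0.
  apply: le_trans IH; rewrite /d addnS half two.
  by have := h (k + j)%N; rewrite ler_norml => /andP[]; lra.
have bd j k : b j <= d k.
  apply: le_trans (bm j k) _; apply: le_trans (dm k j).
  by rewrite [(k + j)%N]addnC /b /d two; have := c0 (j + k)%N; lra.
exists (sup (range b)) => k.
have h1 : b k <= sup (range b).
  apply: ub_le_sup; last by exists k.
  by exists (d 0%N) => _ [j _ <-].
have h2 : sup (range b) <= d k.
  apply: ge_sup; first by exists (b 0%N), 0%N.
  by move=> _ [j _ <-].
by move: h1 h2; rewrite /b /d ler_norml => h1 h2; apply/andP; split; lra.
Qed.

Lemma lipschitz_continuous (f : R -> R) B :
  (forall s t, `|f t - f s| <= B * `|t - s|) -> continuous f.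
Proof.
move=> h t; apply/cvgrPdist_le => e e0.
have B0 : 0 <= B.
  have := h 0 1; rewrite subr0 normr1 mulr1; exact: le_trans (normr_ge0 _).
near=> s; apply: le_trans (h s t) _.
have : `|t - s| <= e / (B + 1).
  near: s; apply: cvgr_dist_le; last by rewrite divr_gt0//; lra.
  exact: cvg_id.
rewrite ler_pdivlMr; last by lra.
by have := normr_ge0 (t - s); nra.
Unshelve. all: end_near. Qed.

Variables (n : nat) (f : R -> ('I_n -> R) -> 'I_n -> R) (B L : R).
Hypothesis f_bounded : forall t x i, `|f t x i| <= B.
Hypothesis f_lipschitz : forall t x y i,
  `|f t x i - f t y i| <= L * \sum_(j < n) `|x j - y j|.
Hypothesis f_continuous : forall x : R -> 'I_n -> R,
  (forall i, continuous (x ^~ i)) -> forall i, continuous (fun t => f t (x t) i).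

Theorem picard_existence (x0 : 'I_n -> R) : exists x : R -> 'I_n -> R,
  x 0 = x0 /\ forall t i, drv (x ^~ i) t (f t (x t) i).
Proof.
(* The Lipschitz constant |L| n divided by this weight is below 1 / 2, so each iteration halves the
   weighted distance. *)
pose K : R := 2 * (`|L| * n%:R + 1).
have Ln0 : 0 <= `|L| * n%:R by rewrite mulr_ge0.
have K0 : 0 < K by rewrite /K; lra.
pose X := {x : R -> 'I_n -> R | forall i, continuous (x ^~ i)}.
have step (x : X) : exists y : X, sval y 0 = x0 /\ forall t i, drv (sval y ^~ i) t (f t (sval x t) i).
  have [F hF] := choice (fun i => primitive_ex2 (@f_continuous _ (svalP x) i)).
  have cF i : continuous (fun t => x0 i + F i t).
    move=> t; apply: (@drv_cont _ _ _ (0 + f t (sval x t) i)).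
    by apply: drvD; [exact: drv_cst|exact: (hF i).2].
  exists (exist _ (fun t i => x0 i + F i t) cF); split => [|t i] /=.
    by apply/funext => i; rewrite (hF i).1 addr0.
  by rewrite -[f _ _ _]add0r; apply: drvD; [exact: drv_cst|exact: (hF i).2].
have [S hS] := choice step.
have c0 : forall i : 'I_n, continuous ((fun _ : R => x0) ^~ i) by move=> i t; exact: cvg_cst.
pose x k := sval (iter k S (exist _ (fun=> x0) c0)).
have x0E k : x k 0 = x0 by case: k => [//|k]; exact: (hS _).1.
have hx k t i : drv (x k.+1 ^~ i) t (f t (x k t) i) by exact: (hS _).2.
have sumb t (y z : 'I_n -> R) c : (forall i, `|y i - z i| <= c) ->
    forall i, `|f t y i - f t z i| <= K / 2 * c.
  move=> h i; have c_ge0 : 0 <= c by exact: le_trans (normr_ge0 _) (h i).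
  apply: le_trans (f_lipschitz t y z i) _.
  apply: (@le_trans _ _ (`|L| * (n%:R * c))).
    apply: (@le_trans _ _ (`|L| * \sum_(j < n) `|y j - z j|)).
      by rewrite ler_wpM2r ?sumr_ge0// ler_norm.
    rewrite ler_wpM2l// mulr_natl -[X in _ <= _ *+ X]card_ord -sumr_const.
    by apply: ler_sum => j _; exact: h.
  by rewrite /K; nra.
pose c := `|B| / K.
have c_ge0 : 0 <= c by rewrite divr_ge0// ltW.
have dx k t i : `|x k.+1 t i - x k t i| <= c / 2 ^+ k * expR (K * `|t|).
  elim: k t i => [|k IH] t i.
    rewrite expr0 divr1.
    have -> : x 0%N t i = x0 i by [].
    apply: (@drv_expR_bound (fun t => x 1%N t i - x0 i) (fun t => f t (x 0%N t) i) `|B|) => //.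
    - by rewrite x0E subrr.
    - move=> s; rewrite -[f _ _ _]subr0; apply: drvB; [exact: hx|exact: drv_cst].
    - move=> s; apply: le_trans (f_bounded _ _ _) _.
      have : 1 <= expR (K * `|s|) by rewrite -expR0 ler_expR mulr_ge0// ltW.
      by have := ler_norm B; have := normr_ge0 B; nra.
  have -> : c / 2 ^+ k.+1 = (K / 2 * (c / 2 ^+ k)) / K.
    by rewrite exprS; field; rewrite gt_eqF//= expf_neq0.
  apply: (@drv_expR_bound (fun t => x k.+2 t i - x k.+1 t i)
    (fun t => f t (x k.+1 t) i - f t (x k t) i)) => //.
  - by rewrite !x0E subrr.
  - by move=> s; apply: drvB; exact: hx.
  - by move=> s; rewrite -mulrA; apply: sumb => j; exact: IH.
have lim t i : exists l, forall k, `|x k t i - l| <= 2 * (c * expR (K * `|t|)) / 2 ^+ k.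
  apply: geometric_limit => k; apply: le_trans (dx k t i) _.
  by rewrite mulrAC.
pose y t i := sval (cid (lim t i)).
have hy k t i : `|x k t i - y t i| <= 2 * (c * expR (K * `|t|)) / 2 ^+ k.
  exact: (svalP (cid (lim t i)) k).
have small (a b : R) : 0 <= b -> (forall k, `|a| <= b / 2 ^+ k) -> a = 0.
  move=> b0 h; apply/eqP; rewrite -normr_le0; apply/ler_addgt0Pr => e e0.
  have [k hk] : exists k, b / e < 2 ^+ k.
    exists (Num.truncn (b / e)).+1; apply: lt_le_trans (truncnS_gt _) _.
    by rewrite -natrX ler_nat ltnW// ltn_expl.
  apply: le_trans (h k) _; rewrite add0r ler_pdivrMr ?exprn_gt0//.
  by rewrite mulrC -ler_pdivrMr// ltW.
(* All iterates share the Lipschitz constant |B|, which passes to the limit; continuity of y allows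
   integrating f along y. *)
have cy i : continuous (y ^~ i).
  have xl k s t : `|x k t i - x k s i| <= `|B| * `|t - s|.
    case: k => [|k]; first by rewrite subrr normr0 mulr_ge0.
    wlog st : s t / s <= t => [W|].
      by have [/W//|/ltW/W] := leP s t; rewrite distrC [`|s - t|]distrC.
    rewrite (ger0_norm (_ : 0 <= t - s)) ?subr_ge0//.
    apply: drv_absle st (fun u _ => hx k u i) _ => u _.
    exact: le_trans (f_bounded _ _ _) (ler_norm _).
  apply: (@lipschitz_continuous _ `|B|) => s t.
  apply/ler_addgt0Pr => e e0.
  pose b := 2 * (c * expR (K * `|t|)) + 2 * (c * expR (K * `|s|)).
  have [k hk] : exists k, b / e < 2 ^+ k.
    exists (Num.truncn (b / e)).+1; apply: lt_le_trans (truncnS_gt _) _.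
    by rewrite -natrX ler_nat ltnW// ltn_expl.
  have {}hk : b / 2 ^+ k <= e.
    by rewrite ler_pdivrMr ?exprn_gt0// mulrC -ler_pdivrMr// ltW.
  have := hy k t i; have := hy k s i; have := xl k s t; move: hk.
  rewrite /b mulrDl => hk h1 h2 h3.
  have -> : y t i - y s i = (x k t i - x k s i) + (x k s i - y s i) - (x k t i - y t i) by ring.
  apply: le_trans (ler_normB _ _) _; apply: le_trans (lerD (ler_normD _ _) (lexx _)) _.
  by lra.
exists y; split.
  apply/funext => i; apply/eqP; rewrite -subr_eq0; apply/eqP.
  apply: (@small _ (2 * (c * expR (K * `|0|)))).
    by rewrite mulr_ge0// mulr_ge0 ?expR_ge0.
  by move=> k; rewrite distrC -(congr1 (@^~ i) (x0E k)); exact: hy.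
move=> t i.
have [F F0 hF] := primitive (@f_continuous _ cy i).
(* Both sides are close to the iterate of index k + 1, with an error that tends to 0 as k grows. *)
suff yE s : y s i = x0 i + F s.
  rewrite (funext yE : y ^~ i = _) -[f _ _ _]add0r; apply: drvD; [exact: drv_cst|exact: hF].
apply/eqP; rewrite -subr_eq0; apply/eqP.
pose b := c * expR (K * `|s|).
have b0 : 0 <= b by rewrite mulr_ge0 ?expR_ge0.
apply: (@small _ (2 * b)); first by rewrite mulr_ge0.
move=> k.
have h1 := hy k.+1 s i.
have h2 : `|x k.+1 s i - (x0 i + F s)| <= (K / 2 * (2 * c / 2 ^+ k)) / K * expR (K * `|s|).
  apply: (@drv_expR_bound (fun t => x k.+1 t i - (x0 i + F t))
    (fun t => f t (x k t) i - (0 + f t (y t) i))) => //.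
  - by rewrite x0E F0 addr0 subrr.
  - by move=> u; apply: drvB (hx k u i) (drvD (drv_cst _ _) (hF u)).
  - move=> u; rewrite add0r -mulrA; apply: sumb => j.
    by apply: le_trans (hy k u j) _; rewrite le_eqVlt; apply/orP; left; apply/eqP; ring.
have -> : y s i - (x0 i + F s) = (x k.+1 s i - (x0 i + F s)) - (x k.+1 s i - y s i) by ring.
apply: le_trans (ler_normB _ _) _; apply: le_trans (lerD h2 h1) _.
have -> : 2 * (c * expR (K * `|s|)) / 2 ^+ k.+1 = b / 2 ^+ k.
  by rewrite exprS /b; field; rewrite expf_neq0.
have -> : K / 2 * (2 * c / 2 ^+ k) / K * expR (K * `|s|) = b / 2 ^+ k.
  by rewrite /b; field; rewrite ?expf_neq0 ?gt_eqF.
by rewrite -mulrDl -mulr2n mulr_natl.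
Qed.

Lemma drv_sum (I : Type) (r : seq I) (F : I -> R -> R) (F' : I -> R) t :
  (forall i, drv (F i) t (F' i)) ->
  drv (fun s => \sum_(i <- r) F i s) t (\sum_(i <- r) F' i).
Proof.
move=> h; elim: r => [|i r IH].
  by rewrite big_nil; apply: drv_ext (drv_cst 0 t) => s; rewrite big_nil.
rewrite big_cons; apply: drv_ext (drvD (h i) IH) => s.
by rewrite big_cons.
Qed.

(** This is Gronwall for the sum of squares, which is differentiable, unlike the sum of absolute
    values in the Lipschitz condition. *)
Theorem ode_dependence (x y : R -> 'I_n -> R) :
  (forall t i, drv (x ^~ i) t (f t (x t) i)) ->
  (forall t i, drv (y ^~ i) t (f t (y t) i)) ->
  forall t, \sum_(i < n) (x t i - y t i) ^+ 2 <=
    \sum_(i < n) (x 0 i - y 0 i) ^+ 2 * expR (4 * `|L| * n%:R * `|t|).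
Proof.
move=> hx hy t; rewrite -mulr_suml.
pose d t i := x t i - y t i.
apply: (@gronwall _ (fun t => \sum_(i < n) d t i ^+ 2)
  (fun t => \sum_(i < n) 2 * d t i * (f t (x t) i - f t (y t) i))) => {}t.
  apply: drv_sum => i.
  by apply: drv_eq; first exact: drvX 2 (drvB (hx t i) (hy t i)).
apply: le_trans (ler_norm_sum _ _ _) _.
apply: (@le_trans _ _ (\sum_(i < n) \sum_(j < n) `|L| * (d t i ^+ 2 + d t j ^+ 2))).
  apply: ler_sum => i _; rewrite -mulr_sumr !normrM ger0_norm//.
  apply: (@le_trans _ _ (2 * `|d t i| * (`|L| * \sum_(j < n) `|d t j|))).
    rewrite ler_wpM2l ?mulr_ge0//; apply: le_trans (f_lipschitz _ _ _ _) _.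
    by rewrite ler_wpM2r ?sumr_ge0// ler_norm.
  rewrite mulrCA ler_wpM2l// mulr_sumr; apply: ler_sum => j _.
  rewrite -(real_normK (num_real (d t i))) -(real_normK (num_real (d t j))).
  by have := sqr_ge0 (`|d t i| - `|d t j|); nra.
pose s := \sum_(i < n) d t i ^+ 2; rewrite -/s.
have s0 : 0 <= s by apply: sumr_ge0 => i _; exact: sqr_ge0.
have -> : \sum_(i < n) \sum_(j < n) `|L| * (d t i ^+ 2 + d t j ^+ 2) = 2 * `|L| * n%:R * s.
  transitivity (\sum_(i < n) `|L| * (n%:R * d t i ^+ 2 + s)).
    apply: eq_bigr => i _; rewrite -mulr_sumr big_split/= sumr_const card_ord.
    by rewrite mulr_natl.
  rewrite -mulr_sumr big_split/= sumr_const card_ord -mulr_sumr -/s -[s *+ n]mulr_natl.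
  by ring.
have : 0 <= `|L| * n%:R * s by rewrite !mulr_ge0.
by lra.
Qed.

Corollary ode_uniqueness (x y : R -> 'I_n -> R) :
  (forall t i, drv (x ^~ i) t (f t (x t) i)) ->
  (forall t i, drv (y ^~ i) t (f t (y t) i)) ->
  x 0 = y 0 -> x = y.
Proof.
move=> hx hy xy0; apply/funext => t; apply/funext => i.
have := ode_dependence hx hy t.
rewrite xy0 [leRHS]big1 => [|j _]; last by rewrite subrr expr0n mul0r.
have hs j : 0 <= (x t j - y t j) ^+ 2 by exact: sqr_ge0.
rewrite (bigD1 i)//= => h.
have h2 : 0 <= \sum_(j < n | j != i) (x t j - y t j) ^+ 2 by exact: sumr_ge0.
have h1 : (x t i - y t i) ^+ 2 = 0 by have := hs i; lra.
by move/eqP: h1; rewrite sqrf_eq0 subr_eq0 => /eqP.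
Qed.

End Picard.

(** * The Poincare-Miranda theorem *)

Section PoincareMiranda.

(* Sperner parity argument: [e] marks the grid edges that leave [p] false
   and along which [q] changes.  A cell without the three labels has an even
   number of marked sides, whereas an odd number of marked edges lies on the
   boundary of the grid, all of them on the right side. *)
Lemma sperner_grid (N : nat) (p q : nat -> nat -> bool) :
  (forall j, p 0%N j) -> (forall j, ~~ p N j) ->
  (forall i, q i 0%N) -> (forall i, ~~ q i N) ->
  exists i j, [/\ (i < N)%N, (j < N)%N &
    let corner a := (a == (i, j)) || (a == (i.+1, j)) ||
                    (a == (i, j.+1)) || (a == (i.+1, j.+1)) in
    [/\ exists2 a, corner a & p a.1 a.2,
        exists2 a, corner a & ~~ p a.1 a.2 && q a.1 a.2 &
        exists2 a, corner a & ~~ p a.1 a.2 && ~~ q a.1 a.2]].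
Proof.
move=> p0 pN q0 qN.
pose e (a b : nat * nat) := [&& ~~ p a.1 a.2, ~~ p b.1 b.2 & q a.1 a.2 (+) q b.1 b.2].
pose h i j := e (i, j) (i.+1, j); pose v i j := e (i, j) (i, j.+1).
pose cell i j := h i j (+) h i j.+1 (+) v i j (+) v i.+1 j.
have [[i [j [iN jN cij]]]|none] := pselect (exists i j, [/\ (i < N)%N, (j < N)%N & cell i j]).
  exists i, j; split => //.
  move: cij; rewrite /cell /h /v /e /=.
  have c1 : (i, j) == (i, j) by [].
  have c2 : (i.+1, j) == (i.+1, j) by [].
  have c3 : (i, j.+1) == (i, j.+1) by [].
  have c4 : (i.+1, j.+1) == (i.+1, j.+1) by [].
  move=> H; split.
  - case P1 : (p i j) H; first by exists (i, j); rewrite ?eqxx.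
    case P2 : (p i.+1 j); first by exists (i.+1, j); rewrite ?eqxx ?orbT.
    case P3 : (p i j.+1); first by exists (i, j.+1); rewrite ?eqxx ?orbT.
    case P4 : (p i.+1 j.+1); first by exists (i.+1, j.+1); rewrite ?eqxx ?orbT.
    by case: (q i j); case: (q i.+1 j); case: (q i j.+1); case: (q i.+1 j.+1).
  - case P1 : (~~ p i j && q i j); first by exists (i, j); rewrite ?eqxx.
    case P2 : (~~ p i.+1 j && q i.+1 j); first by exists (i.+1, j); rewrite ?eqxx ?orbT.
    case P3 : (~~ p i j.+1 && q i j.+1); first by exists (i, j.+1); rewrite ?eqxx ?orbT.
    case P4 : (~~ p i.+1 j.+1 && q i.+1 j.+1).
      by exists (i.+1, j.+1); rewrite ?eqxx ?orbT.
    move: H P1 P2 P3 P4.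
    by case: (p i j); case: (p i.+1 j); case: (p i j.+1); case: (p i.+1 j.+1);
      case: (q i j); case: (q i.+1 j); case: (q i j.+1); case: (q i.+1 j.+1).
  - case P1 : (~~ p i j && ~~ q i j); first by exists (i, j); rewrite ?eqxx.
    case P2 : (~~ p i.+1 j && ~~ q i.+1 j); first by exists (i.+1, j); rewrite ?eqxx ?orbT.
    case P3 : (~~ p i j.+1 && ~~ q i j.+1); first by exists (i, j.+1); rewrite ?eqxx ?orbT.
    case P4 : (~~ p i.+1 j.+1 && ~~ q i.+1 j.+1).
      by exists (i.+1, j.+1); rewrite ?eqxx ?orbT.
    move: H P1 P2 P3 P4.
    by case: (p i j); case: (p i.+1 j); case: (p i j.+1); case: (p i.+1 j.+1);
      case: (q i j); case: (q i.+1 j); case: (q i j.+1); case: (q i.+1 j.+1).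
exfalso.
pose V i := \big[addb/false]_(j < N) v i j.
have step i : (i < N)%N -> V i.+1 = V i.
  move=> iN.
  have H n : (n <= N)%N -> \big[addb/false]_(j < n) v i.+1 j =
      \big[addb/false]_(j < n) v i j (+) (h i 0%N (+) h i n).
    elim: n => [|n IH] nN; first by rewrite !big_ord0; case: (h i 0%N).
    rewrite !big_ord_recr/= IH; last exact: ltnW.
    have : ~~ cell i n by apply/negP => c; apply: none; exists i, n.
    rewrite /cell; case: (h i 0%N); case: (h i n); case: (h i n.+1);
    case: (v i n); case: (v i.+1 n); by case: (\big[addb/false]_(j < n) v i j).
  rewrite /V H// /h /e /= !q0 (negbTE (qN i)) (negbTE (qN i.+1)) /=.
  by rewrite !andbF !addbF.
have V0 i : (i <= N)%N -> V i = false.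
  elim: i => [_|i IH iN]; last by rewrite step// IH// ltnW.
  by rewrite /V big1// => j _; rewrite /v /e /= p0.
have VN n : \big[addb/false]_(j < n) v N j = q N 0%N (+) q N n.
  elim: n => [|n IH]; first by rewrite big_ord0 addbb.
  rewrite big_ord_recr/= IH /v /e /= !pN /=.
  by case: (q N 0%N); case: (q N n); case: (q N n.+1).
by have := V0 N (leqnn N); rewrite /V VN q0 (negbTE (qN N)).
Qed.

Variable R : realType.

(** Suppose |F| + |G| has a positive minimum m on the rectangle, and take a grid so fine that F and
    G vary by less than m / 4 in a cell. In the cell given by [sperner_grid], consider the corner
    with F >= 0 > G: a neighbour with F < 0 makes F small there, a neighbour with G >= 0 makes G
    small, so |F| + |G| < m. *)
Lemma poincare_miranda (F G : R -> R -> R) (a b c d K : R) : a < b -> c < d ->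
  (forall x y x' y', a <= x <= b -> a <= x' <= b -> c <= y <= d -> c <= y' <= d ->
     `|F x y - F x' y'| <= K * (`|x - x'| + `|y - y'|) /\
     `|G x y - G x' y'| <= K * (`|x - x'| + `|y - y'|)) ->
  (forall y, c <= y <= d -> F a y < 0 /\ 0 < F b y) ->
  (forall x, a <= x <= b -> G x c < 0 /\ 0 < G x d) ->
  exists x y, [/\ a <= x <= b, c <= y <= d, F x y = 0 & G x y = 0].
Proof.
move=> ab cd hK hF hG.
have K0 : 0 <= K.
  have := hK a c b c; rewrite !lexx (ltW ab) (ltW cd) => /(_ isT isT isT isT)[+ _].
  rewrite subrr normr0 addr0 => h.
  have := le_trans (normr_ge0 _) h.
  by rewrite pmulr_lge0// normr_gt0 subr_eq0 lt_eqF.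
pose A := `[a, b]%classic `*` `[c, d]%classic.
pose f (u : R * R) := `|F u.1 u.2| + `|G u.1 u.2|.
have inA u : A u -> a <= u.1 <= b /\ c <= u.2 <= d.
  by move=> [] /=; rewrite !in_itv.
have cf : {within A, continuous f}.
  apply/subspace_continuousP => u Au.
  apply/cvgrPdist_le => e e0.
  have k0 : 0 < e / (4 * K + 1) by rewrite divr_gt0//; lra.
  near=> w.
  have Aw : A w by near: w; exact: withinT.
  have [u1 u2] := inA u Au; have [w1 w2] := inA w Aw.
  have [hF' hG'] := hK _ _ _ _ u1 w1 u2 w2.
  have d1 : `|u.1 - w.1| <= e / (4 * K + 1).
    near: w; apply: (@cvg_within _ (nbhs u)).
    by apply: (@cvgr_dist_le _ _ _ (nbhs u) _ fst u.1) => //; exact: cvg_fst.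
  have d2 : `|u.2 - w.2| <= e / (4 * K + 1).
    near: w; apply: (@cvg_within _ (nbhs u)).
    by apply: (@cvgr_dist_le _ _ _ (nbhs u) _ snd u.2) => //; exact: cvg_snd.
  have K1 : 0 < 4 * K + 1 by clear - K0; lra.
  move: d1 d2; rewrite !ler_pdivlMr//.
  move=> d1 d2; rewrite /f.
  have -> : `|F u.1 u.2| + `|G u.1 u.2| - (`|F w.1 w.2| + `|G w.1 w.2|) =
    (`|F u.1 u.2| - `|F w.1 w.2|) + (`|G u.1 u.2| - `|G w.1 w.2|) by ring.
  apply: le_trans (ler_normD _ _) _.
  have := ler_dist_dist (F u.1 u.2) (F w.1 w.2).
  have := ler_dist_dist (G u.1 u.2) (G w.1 w.2).
  by have := normr_ge0 (u.1 - w.1); have := normr_ge0 (u.2 - w.2); nra.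
have [||[x y] xyA hmin] := @compact_EVT_min _ _ f A _ _ cf.
- by exists (a, c); split; rewrite /= in_itv/= lexx ltW.
- by apply: compact_setX; exact: segment_compact.
rewrite inE in xyA; have [/= x1 y1] := inA _ xyA.
exists x, y; suff : f (x, y) <= 0.
  rewrite /f /= => h.
  have hF0 := normr_ge0 (F x y); have hG0 := normr_ge0 (G x y).
  by split => //; apply/eqP; rewrite -normr_le0; lra.
rewrite leNgt; apply/negP => m0.
set m := f (x, y) in m0 hmin.
pose w := (b - a) + (d - c).
have w0 : 0 < w by rewrite /w; lra.
have [N N0 hN] : exists2 N : nat, (0 < N)%N & 4 * K * w / m < N%:R.
  by exists (Num.truncn (4 * K * w / m)).+1 => //; exact: truncnS_gt.
have NR : 0 < N%:R :> R by rewrite ltr0n.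
pose X (i : nat) := a + (b - a) * (i%:R / N%:R).
pose Y (j : nat) := c + (d - c) * (j%:R / N%:R).
have frac i : (i <= N)%N -> 0 <= (i%:R / N%:R : R) <= 1.
  by move=> iN; rewrite divr_ge0//= ler_pdivrMr// mul1r ler_nat.
have XA i : (i <= N)%N -> a <= X i <= b.
  by move=> iN; have /andP[f0 f1] := frac i iN; apply/andP; split; rewrite /X; nra.
have YA i : (i <= N)%N -> c <= Y i <= d.
  by move=> iN; have /andP[f0 f1] := frac i iN; apply/andP; split; rewrite /Y; nra.
have X0 : X 0%N = a by rewrite /X mul0r mulr0 addr0.
have Y0 : Y 0%N = c by rewrite /Y mul0r mulr0 addr0.
have XN : X N = b by rewrite /X divff ?gt_eqF// mulr1; ring.
have YN : Y N = d by rewrite /Y divff ?gt_eqF// mulr1; ring.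
(* The boundary conditions of [sperner_grid] concern all indices, so those beyond N are sent back to
   N. *)
pose cl i := minn i N.
have clN i : (cl i <= N)%N by rewrite geq_minr.
pose p i j := F (X (cl i)) (Y (cl j)) < 0.
pose q i j := G (X (cl i)) (Y (cl j)) < 0.
have cl0 : cl 0%N = 0%N by rewrite /cl min0n.
have clNN : cl N = N by rewrite /cl minnn.
have [|||| i [j [iN jN /= [[u cu pu] [s cs ps] [t ct pt]]]]] := @sperner_grid N p q.
- by move=> j; rewrite /p cl0 X0; exact: (proj1 (hF _ (YA _ (clN _)))).
- by move=> j; rewrite /p clNN XN -leNgt ltW//; exact: (proj2 (hF _ (YA _ (clN _)))).
- by move=> j; rewrite /q cl0 Y0; exact: (proj1 (hG _ (XA _ (clN _)))).
- by move=> j; rewrite /q clNN YN -leNgt ltW//; exact: (proj2 (hG _ (XA _ (clN _)))).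
pose corner v := (v == (i, j)) || (v == (i.+1, j)) || (v == (i, j.+1)) || (v == (i.+1, j.+1)).
have clE v : corner v -> cl v.1 = v.1 /\ cl v.2 = v.2.
  by move=> /orP[/orP[/orP[]|]|] /eqP-> /=; rewrite /cl; split; apply/minn_idPl => //; exact: ltnW.
have dist v v' : corner v -> corner v' ->
    `|X v.1 - X v'.1| <= (b - a) / N%:R /\ `|Y v.2 - Y v'.2| <= (d - c) / N%:R.
  have dX k : X k.+1 - X k = (b - a) / N%:R by rewrite /X -natr1; field; rewrite gt_eqF.
  have dY k : Y k.+1 - Y k = (d - c) / N%:R by rewrite /Y -natr1; field; rewrite gt_eqF.
  have e1 : 0 <= (b - a) / N%:R by rewrite divr_ge0//; lra.
  have e2 : 0 <= (d - c) / N%:R by rewrite divr_ge0//; lra.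
  have bX : `|X i.+1 - X i| <= (b - a) / N%:R by rewrite dX ger0_norm.
  have bY : `|Y j.+1 - Y j| <= (d - c) / N%:R by rewrite dY ger0_norm.
  have bX' : `|X i - X i.+1| <= (b - a) / N%:R by rewrite distrC.
  have bY' : `|Y j - Y j.+1| <= (d - c) / N%:R by rewrite distrC.
  by move=> /orP[/orP[/orP[]|]|] /eqP-> /orP[/orP[/orP[]|]|] /eqP-> /=;
    rewrite ?subrr ?normr0.
have small v v' : corner v -> corner v' ->
    `|F (X v.1) (Y v.2) - F (X v'.1) (Y v'.2)| <= K * (w / N%:R) /\
    `|G (X v.1) (Y v.2) - G (X v'.1) (Y v'.2)| <= K * (w / N%:R).
  move=> cv cv'; have [dx dy] := dist v v' cv cv'.
  have [e1 e2] := clE v cv; have [e1' e2'] := clE v' cv'.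
  have aX k : cl k = k -> a <= X k <= b by move=> <-; exact: XA.
  have aY k : cl k = k -> c <= Y k <= d by move=> <-; exact: YA.
  have [hF1 hG1] := hK _ _ _ _ (aX _ e1) (aX _ e1') (aY _ e2) (aY _ e2').
  have le : K * (`|X v.1 - X v'.1| + `|Y v.2 - Y v'.2|) <= K * (w / N%:R).
    by rewrite ler_wpM2l// /w mulrDl lerD.
  by split; [exact: le_trans hF1 le|exact: le_trans hG1 le].
have [us1 us2] := small u s cu cs; have [st1 st2] := small s t cs ct.
have [su1 su2] := clE s cs; have [tu1 tu2] := clE t ct; have [uu1 uu2] := clE u cu.
move: pu ps pt; rewrite /p /q su1 su2 tu1 tu2 uu1 uu2 -!leNgt.
move=> pu /andP[ps qs] /andP[pt qt].
have := hmin (X s.1, Y s.2); rewrite inE /A /f /= => /(_ _) H.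
have {}H : m <= `|F (X s.1) (Y s.2)| + `|G (X s.1) (Y s.2)|.
  by apply: H; split; rewrite /= in_itv/=; [rewrite -su1; exact: XA|rewrite -su2; exact: YA].
have hw : 4 * (K * (w / N%:R)) < m.
  by move: hN; rewrite ltr_pdivrMr// !mulrA ltr_pdivrMr// mulrC [m * _]mulrC.
move: H; rewrite (ger0_norm ps) (ltr0_norm qs).
clear - us1 us2 st1 st2 hw pu qs pt qt ps.
by move: us1 us2 st1 st2; rewrite !ler_norml => /andP[? ?] /andP[? ?] /andP[? ?] /andP[? ?]; lra.
Unshelve. all: end_near. Qed.

End PoincareMiranda.

(** * Bounded Lipschitz functions *)

Section BoundedLipschitz.
Variables (R : realType) (I P : Type) (A : I -> P -> Prop) (dist : P -> P -> R).
Hypothesis dist_ge0 : forall x y, 0 <= dist x y.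
Implicit Types f g : I -> P -> R.

(** One constant serves as bound and as Lipschitz constant, uniformly in the parameter i, which is
    the time in the applications. The class is closed under products, and under inverses and roots
    away from 0, so estimates of vector fields follow the shape of their formulas. *)
Definition blip f : Prop := exists2 M : R, 0 <= M & forall i x y, A i x -> A i y ->
  `|f i x| <= M /\ `|f i x - f i y| <= M * dist x y.

Lemma blip_cst (g : I -> R) (M : R) : (forall i, `|g i| <= M) -> blip (fun i _ => g i).
Proof.
move=> h; exists `|M| => // i x y _ _.
by rewrite subrr normr0 mulr_ge0//; split => //; exact: le_trans (h i) (ler_norm _).
Qed.

Lemma blip_coord (g : P -> R) (phi : R -> R) (M : R) : (forall x y, `|g x - g y| <= dist x y) ->
  (forall u v, `|phi u| <= M /\ `|phi u - phi v| <= `|u - v|) ->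
  blip (fun _ x => phi (g x)).
Proof.
move=> hg hphi; exists (`|M| + 1) => [|i x y _ _]; first by rewrite addr_ge0.
have [h1 h2] := hphi (g x) (g y); split.
  by apply: le_trans h1 _; have := ler_norm M; lra.
apply: le_trans h2 (le_trans (hg x y) _).
by have := dist_ge0 x y; have := normr_ge0 M; nra.
Qed.

Lemma blipD f g : blip f -> blip g -> blip (fun i x => f i x + g i x).
Proof.
move=> [M M0 hf] [N N0 hg]; exists (M + N) => [|i x y ax ay]; first by rewrite addr_ge0.
have [f1 f2] := hf i x y ax ay; have [g1 g2] := hg i x y ax ay; split.
  exact: le_trans (ler_normD _ _) (lerD f1 g1).
rewrite opprD addrACA mulrDl; exact: le_trans (ler_normD _ _) (lerD f2 g2).
Qed.

Lemma blipN f : blip f -> blip (fun i x => - f i x).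
Proof.
move=> [M M0 hf]; exists M => // i x y ax ay; have [f1 f2] := hf i x y ax ay.
by rewrite -opprD !normrN.
Qed.

Lemma blipB f g : blip f -> blip g -> blip (fun i x => f i x - g i x).
Proof. by move=> hf hg; apply: blipD => //; exact: blipN. Qed.

Lemma blipM f g : blip f -> blip g -> blip (fun i x => f i x * g i x).
Proof.
move=> [M M0 hf] [N N0 hg]; exists (2 * (M * N)) => [|i x y ax ay].
  by rewrite !mulr_ge0.
have [f1 f2] := hf i x y ax ay; have [g1 g2] := hg i x y ax ay.
have [g1' _] := hg i y x ay ax.
have MN0 : 0 <= M * N by rewrite mulr_ge0.
split.
  rewrite normrM; apply: (@le_trans _ _ (M * N)); last by lra.
  exact: ler_pM.
have -> : f i x * g i x - f i y * g i y =
  f i x * (g i x - g i y) + (f i x - f i y) * g i y by ring.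
apply: le_trans (ler_normD _ _) _; rewrite !normrM.
have -> : 2 * (M * N) * dist x y = M * (N * dist x y) + M * dist x y * N by ring.
by apply: lerD; exact: ler_pM.
Qed.

Lemma blipX f n : blip f -> blip (fun i x => f i x ^+ n).
Proof.
move=> hf; elim: n => [|n IH].
  by exists 1 => // i x y _ _; rewrite expr0 normr1 subrr normr0 mul1r.
have [M M0 h] := blipM hf IH; exists M => // i x y ax ay.
by rewrite !exprS; exact: h.
Qed.

Lemma blipV f (c : R) : 0 < c -> (forall i x, A i x -> c <= f i x) -> blip f ->
  blip (fun i x => (f i x)^-1).
Proof.
move=> c0 fc [M M0 hf]; have c0' : 0 <= c^-1 by rewrite invr_ge0 ltW.
exists (c^-1 + M * c^-1 ^+ 2) => [|i x y ax ay].
  by rewrite addr_ge0// mulr_ge0// exprn_ge0.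
have [f1 f2] := hf i x y ax ay.
have fx := fc i x ax; have fy := fc i y ay.
have fx0 : 0 < f i x by lra. have fy0 : 0 < f i y by lra.
have ix : (f i x)^-1 <= c^-1 by rewrite lef_pV2.
have iy : (f i y)^-1 <= c^-1 by rewrite lef_pV2.
have ix0 : 0 <= (f i x)^-1 by rewrite invr_ge0 ltW.
have iy0 : 0 <= (f i y)^-1 by rewrite invr_ge0 ltW.
have K0 : 0 <= M * c^-1 ^+ 2 by rewrite mulr_ge0// exprn_ge0.
split; first by rewrite ger0_norm//; lra.
have -> : (f i x)^-1 - (f i y)^-1 = - ((f i x - f i y) * ((f i x)^-1 * (f i y)^-1)).
  by field; rewrite !gt_eqF.
rewrite normrN normrM (ger0_norm (mulr_ge0 ix0 iy0)).
apply: (@le_trans _ _ ((M * dist x y) * (c^-1 * c^-1))).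
  by apply: ler_pM => //; [exact: mulr_ge0|exact: ler_pM].
by rewrite -expr2 mulrAC mulrDl lerDr mulr_ge0.
Qed.

Lemma blip_sqrt f (c : R) : 0 < c -> (forall i x, A i x -> c <= f i x) -> blip f ->
  blip (fun i x => Num.sqrt (f i x)).
Proof.
move=> c0 fc [M M0 hf].
have s0 : 0 < Num.sqrt c by rewrite sqrtr_gt0.
have k0 : 0 <= M / Num.sqrt c by rewrite divr_ge0// ltW.
exists (M + 1 + M / Num.sqrt c) => [|i x y ax ay]; first by rewrite !addr_ge0.
have [f1 f2] := hf i x y ax ay.
have fx := fc i x ax; have fy := fc i y ay.
have sx : Num.sqrt c <= Num.sqrt (f i x) by rewrite ler_sqrt//; lra.
have sy : Num.sqrt c <= Num.sqrt (f i y) by rewrite ler_sqrt//; lra.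
have ex : Num.sqrt (f i x) ^+ 2 = f i x by rewrite sqr_sqrtr//; lra.
have ey : Num.sqrt (f i y) ^+ 2 = f i y by rewrite sqr_sqrtr//; lra.
set u := Num.sqrt (f i x) in sx ex *; set v := Num.sqrt (f i y) in sy ey *.
split.
  rewrite ger0_norm; last by lra.
  have : u ^+ 2 <= M by rewrite ex; exact: le_trans (ler_norm _) f1.
  by have := sqr_ge0 (u - 1); nra.
have : `|u - v| * (u + v) <= M * dist x y.
  rewrite -[u + v]ger0_norm; last by lra.
  by rewrite -normrM -subr_sqr ex ey.
move=> h.
have h2 : `|u - v| * Num.sqrt c <= M * dist x y.
  apply: le_trans h; rewrite ler_wpM2l//; lra.
have h3 : `|u - v| <= M / Num.sqrt c * dist x y.
  by rewrite mulrAC ler_pdivlMr.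
apply: le_trans h3 _; rewrite ler_wpM2r//; lra.
Qed.

End BoundedLipschitz.

(** * Clamping to an interval, and other 1-Lipschitz functions *)

Section Clamp.
Variable R : realType.

Definition clamp (a b x : R) : R := Num.min b (Num.max a x).

Lemma clampE (a b x : R) : clamp a b x =
  if a <= x then (if b <= x then b else x) else (if b <= a then b else a).
Proof. by rewrite /clamp minEle maxEle; case: (leP a x). Qed.

Lemma clamp_itv (a b x : R) : a <= b -> a <= clamp a b x <= b.
Proof.
move=> ab; rewrite /clamp; case: (lerP a x) => h; case: (lerP b _) => h' //;
by rewrite ?lexx ?ab ?h ?ltW.
Qed.

Lemma clamp_id (a b x : R) : a <= x <= b -> clamp a b x = x.
Proof. by rewrite /clamp => /andP[/max_idPr-> /min_idPr]. Qed.

Lemma clamp_lip (a b x y : R) : `|clamp a b x - clamp a b y| <= `|x - y|.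
Proof.
wlog xy : x y / y <= x => [W|].
  by have [/W//|/ltW/W] := leP y x; rewrite distrC [`|y - x|]distrC.
rewrite [leRHS]ger0_norm ?subr_ge0// !clampE ler_norml.
by case: (leP a x) => ?; case: (leP a y) => ?; case: (leP b x) => ?; case: (leP b y) => ?;
  case: (leP b a) => ?; apply/andP; split; lra.
Qed.

Lemma cos_lip (x y : R) : `|cos x - cos y| <= `|x - y|.
Proof.
wlog xy : x y / y <= x => [W|].
  by have [/W//|/ltW/W] := leP y x; rewrite distrC [`|y - x|]distrC.
rewrite [leRHS]ger0_norm ?subr_ge0// -[leRHS]mul1r.
apply: (@drv_absle _ cos (fun s => - sin s)) => // t _; first exact: is_derive_cos.
by rewrite normrN ler_norml sin_geN1 sin_le1.
Qed.

Lemma sin_lip (x y : R) : `|sin x - sin y| <= `|x - y|.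
Proof.
wlog xy : x y / y <= x => [W|].
  by have [/W//|/ltW/W] := leP y x; rewrite distrC [`|y - x|]distrC.
rewrite [leRHS]ger0_norm ?subr_ge0// -[leRHS]mul1r.
apply: (@drv_absle _ sin cos) => // t _; first exact: is_derive_sin.
by rewrite ler_norml cos_geN1 cos_le1.
Qed.

End Clamp.

(** * Arithmetic of continuous real functions *)

Section Continuity.
Variable R : realType.
Implicit Types f g : R -> R.

Lemma cont_cst (c : R) : continuous (fun _ : R => c).
Proof. by move=> t; exact: cvg_cst. Qed.

Lemma contD f g : continuous f -> continuous g -> continuous (fun t => f t + g t).
Proof. by move=> hf hg t; apply: continuousD; [exact: hf|exact: hg]. Qed.

Lemma contN f : continuous f -> continuous (fun t => - f t).
Proof. by move=> hf t; apply: continuousN; exact: hf. Qed.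

Lemma contM f g : continuous f -> continuous g -> continuous (fun t => f t * g t).
Proof. by move=> hf hg t; apply: continuousM; [exact: hf|exact: hg]. Qed.

Lemma contX f n : continuous f -> continuous (fun t => f t ^+ n).
Proof.
move=> hf; elim: n => [|n IH].
  by under [X in continuous X]funext do rewrite expr0; exact: cont_cst.
by under [X in continuous X]funext do rewrite exprS; exact: contM.
Qed.

Lemma contV f : (forall t, f t != 0) -> continuous f -> continuous (fun t => (f t)^-1).
Proof. by move=> h hf t; apply: continuousV; [exact: h|exact: hf]. Qed.

Lemma cont_comp f g : continuous f -> continuous g -> continuous (fun t => f (g t)).
Proof. by move=> hf hg t; apply: (@continuous_comp _ _ _ g f); [exact: hg|exact: hf]. Qed.

Lemma cont_clamp (a b : R) : continuous (clamp a b).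
Proof.
apply: (@lipschitz_continuous _ _ 1) => s t; rewrite mul1r; exact: clamp_lip.
Qed.

End Continuity.

(** * Planar Kepler motion *)

Section PeriodicFunctions.
Variable R : realType.

Lemma periodic_drv (f f' : R -> R) T : periodic f T -> (forall t, drv f t (f' t)) ->
  periodic f' T.
Proof.
move=> pf hf t; apply: (@drv_unique _ f t); last exact: hf.
by apply: drv_ext (drv_shift (hf (t + T))) => s; rewrite pf.
Qed.

Lemma periodic_translate (A : Type) (f : R -> A) (T t : R) : 0 < T ->
  (forall s, f (s + T) = f s) -> exists2 s, 0 <= s <= T & f s = f t.
Proof.
move=> T0 pf.
have up n s : f (s + n%:R * T) = f s.
  elim: n s => [|n IH] s; first by rewrite mul0r addr0.
  by rewrite -natr1 mulrDl mul1r addrA pf.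
have nonneg s : 0 <= s -> exists2 s', 0 <= s' <= T & f s' = f s.
  move=> s0; have /andP[h1 h2] := truncn_itv (divr_ge0 s0 (ltW T0)).
  set n := Num.truncn _ in h1 h2.
  exists (s - n%:R * T); last by rewrite -(up n) subrK.
  move: h1 h2; rewrite ler_pdivlMr// ltr_pdivrMr// -natr1 mulrDl mul1r.
  by move=> h1 h2; apply/andP; split; lra.
have [t0|t0] := leP 0 t; first exact: nonneg.
pose n := (Num.truncn (- t / T)).+1.
have [|s hs hfs] := nonneg (t + n%:R * T); last by exists s; rewrite // hfs up.
have : - t / T < n%:R by exact: truncnS_gt.
by rewrite ltr_pdivrMr//; lra.
Qed.

Lemma periodic_min (f : R -> R) T : 0 < T -> periodic f T -> continuous f ->
  exists t0, forall t, f t0 <= f t.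
Proof.
move=> T0 pf cf; have [t0 _ h] := EVT_min (ltW T0) (continuous_subspaceT cf).
exists t0 => t; have [s sT <-] := periodic_translate t T0 pf.
by apply: h; rewrite in_itv.
Qed.

Lemma periodic_bounded (f : R -> R) T : 0 < T -> periodic f T -> continuous f ->
  exists B, forall t, `|f t| <= B.
Proof.
move=> T0 pf cf.
have [a ha] := periodic_min T0 pf cf.
have [b hb] : exists b, forall t, - f b <= - f t.
  by apply: (@periodic_min (fun t => - f t) T) => //; [move=> t; rewrite pf|exact: contN].
exists (`|f a| + `|f b|) => t.
have := ha t; have := hb t; have := ler_norm (f b); have := ler_norm (- f a); rewrite normrN => hfa.
have := normr_ge0 (f a); have := normr_ge0 (f b).
by rewrite ler_norml => *; apply/andP; split; lra.
Qed.

End PeriodicFunctions.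

Definition rho (R : realType) (d1 d2 : R -> R) (t : R) : R :=
  Num.sqrt (d1 t ^+ 2 + d2 t ^+ 2).

Section PlanarKepler.
Variables (R : realType) (M T : R) (d1 d2 v1 v2 : R -> R).
Hypotheses (M0 : 0 < M) (T0 : 0 < T).
Local Notation rho := (rho d1 d2).
Hypothesis d_neq0 : forall t, 0 < d1 t ^+ 2 + d2 t ^+ 2.
Hypothesis d1D : forall t, drv d1 t (v1 t).
Hypothesis d2D : forall t, drv d2 t (v2 t).
Hypothesis v1D : forall t, drv v1 t (- M * (d1 t / rho t ^+ 3)).
Hypothesis v2D : forall t, drv v2 t (- M * (d2 t / rho t ^+ 3)).
Hypothesis d1T : periodic d1 T.
Hypothesis d2T : periodic d2 T.
Hypotheses (d20 : d2 0 = 0) (v10 : v1 0 = 0) (v20 : v2 0 != 0).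

Let rho_gt0 t : 0 < rho t. Proof. by rewrite /rho sqrtr_gt0. Qed.
Let rho_sqr t : rho t ^+ 2 = d1 t ^+ 2 + d2 t ^+ 2.
Proof. by rewrite /rho sqr_sqrtr// ltW. Qed.

Lemma kepler_bounds : exists r0 B : R, 0 < r0 /\ forall t,
  [/\ r0 <= rho t <= B, `|d1 t| <= B, `|d2 t| <= B, `|v1 t| <= B & `|v2 t| <= B].
Proof.
have c1 : continuous d1 by move=> t; exact: drv_cont (d1D t).
have c2 : continuous d2 by move=> t; exact: drv_cont (d2D t).
have c3 : continuous v1 by move=> t; exact: drv_cont (v1D t).
have c4 : continuous v2 by move=> t; exact: drv_cont (v2D t).
have cr : continuous rho.
  apply: (@cont_comp _ Num.sqrt); first exact: sqrt_continuous.
  by apply: contD; exact: contX.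
have rT : periodic rho T by move=> t; rewrite /rho d1T d2T.
have [B1 h1] := periodic_bounded T0 d1T c1.
have [B2 h2] := periodic_bounded T0 d2T c2.
have [B3 h3] := periodic_bounded T0 (periodic_drv d1T d1D) c3.
have [B4 h4] := periodic_bounded T0 (periodic_drv d2T d2D) c4.
have [B5 h5] := periodic_bounded T0 rT cr.
have [t0 ht0] := periodic_min T0 rT cr.
have g1 := le_trans (normr_ge0 _) (h1 0). have g2 := le_trans (normr_ge0 _) (h2 0).
have g3 := le_trans (normr_ge0 _) (h3 0). have g4 := le_trans (normr_ge0 _) (h4 0).
have g5 := le_trans (normr_ge0 _) (h5 0).
exists (rho t0), (B1 + B2 + B3 + B4 + B5); split => // t.
have := h1 t; have := h2 t; have := h3 t; have := h4 t.
have := le_trans (ler_norm _) (h5 t).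
by move=> *; split; rewrite ?ht0/=; lra.
Qed.

(** The motion reflected in the first axis and reversed in time solves the same equation with the
    same data at 0, since these are those of an apse. Uniqueness is obtained from Gronwall applied
    to the squared phase space distance of the two motions. *)
Lemma kepler_reflection t : d1 (- t) = d1 t /\ d2 (- t) = - d2 t.
Proof.
have [r0 [B [r00 hB]]] := kepler_bounds.
(* The Kepler force is Lipschitz only away from the centre; by [kepler_bounds] both motions stay in
   this region. *)
pose A (_ : unit) (z : R * R) := [/\ `|z.1| <= B, `|z.2| <= B & r0 ^+ 2 <= z.1 ^+ 2 + z.2 ^+ 2].
pose dist (z w : R * R) := `|z.1 - w.1| + `|z.2 - w.2|.
have dist0 z w : 0 <= dist z w by rewrite addr_ge0.
have B0 : 0 <= B by have [_ h _ _ _] := hB 0; exact: le_trans h.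
have b1 : blip A dist (fun _ z => z.1).
  exists (B + 1) => [|_ z w [z1 _ _] _]; first by lra.
  split; first by lra.
  by have := dist0 z w; have := normr_ge0 (z.2 - w.2); rewrite /dist; nra.
have b2 : blip A dist (fun _ z => z.2).
  exists (B + 1) => [|_ z w [_ z2 _] _]; first by lra.
  split; first by lra.
  by have := dist0 z w; have := normr_ge0 (z.1 - w.1); rewrite /dist; nra.
have b3 : blip A dist (fun _ z => (Num.sqrt (z.1 ^+ 2 + z.2 ^+ 2) ^+ 3)^-1).
  apply: (@blipV _ _ _ A dist dist0 _ (r0 ^+ 3)).
  - by rewrite exprn_gt0.
  - move=> _ z [_ _ z3]; apply: lerXn2r; rewrite ?nnegrE ?sqrtr_ge0//; first exact: ltW.
    by rewrite -[leLHS]gtr0_norm// -sqrtr_sqr ler_wsqrtr.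
  apply: (blipX dist0); apply: (@blip_sqrt _ _ _ A dist dist0 (fun _ z => z.1 ^+ 2 + z.2 ^+ 2) (r0 ^+ 2)).
  - by rewrite exprn_gt0.
  - by move=> _ z [].
  by apply: blipD; exact: (blipX dist0).
have [K1 K10 hK1] := blipM b1 b3.
have [K2 K20 hK2] := blipM b2 b3.
pose K := K1 + K2.
pose u t := (d1 t - d1 (- t)) ^+ 2 + (d2 t + d2 (- t)) ^+ 2
  + (v1 t + v1 (- t)) ^+ 2 + (v2 t - v2 (- t)) ^+ 2.
pose X1 t := d1 t - d1 (- t). pose X2 t := d2 t + d2 (- t).
pose Y1 t := v1 t + v1 (- t). pose Y2 t := v2 t - v2 (- t).
pose G1 t := d1 t / rho t ^+ 3 - d1 (- t) / rho (- t) ^+ 3.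
pose G2 t := d2 t / rho t ^+ 3 + d2 (- t) / rho (- t) ^+ 3.
have hu s : drv u s (2 * (X1 s * Y1 s + X2 s * Y2 s - M * (Y1 s * G1 s + Y2 s * G2 s))).
  have D1 := drvB (d1D s) (drv_opp (d1D (- s))).
  have D2 := drvD (d2D s) (drv_opp (d2D (- s))).
  have D3 := drvD (v1D s) (drv_opp (v1D (- s))).
  have D4 := drvB (v2D s) (drv_opp (v2D (- s))).
  apply: drv_eq; first exact: drvD (drvD (drvD (drvX 2 D1) (drvX 2 D2)) (drvX 2 D3)) (drvX 2 D4).
  by rewrite /X1 /X2 /Y1 /Y2 /G1 /G2 /=; ring.
have bu s : `|2 * (X1 s * Y1 s + X2 s * Y2 s - M * (Y1 s * G1 s + Y2 s * G2 s))| <=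
    (1 + 2 * M * K) * u s.
  have az : A tt (d1 s, d2 s).
    have [/andP[h1 _] h2 h3 _ _] := hB s; split => //=.
    by rewrite -rho_sqr; apply: lerXn2r => //; rewrite nnegrE ltW.
  have aw : A tt (d1 (- s), - d2 (- s)).
    have [/andP[h1 _] h2 h3 _ _] := hB (- s); split => //=; first by rewrite normrN.
    by rewrite sqrrN -rho_sqr; apply: lerXn2r => //; rewrite nnegrE ltW.
  have [_] := hK1 tt _ _ az aw; have [_] := hK2 tt _ _ az aw.
  rewrite /dist /= sqrrN opprK mulNr opprK -/(rho s) -/(rho (- s)) -/(G1 s) -/(G2 s).
  rewrite -/(X1 s) -/(X2 s) => g2 g1.
  have k1 : `|G1 s| <= K * (`|X1 s| + `|X2 s|).
    by apply: le_trans g1 _; rewrite ler_wpM2r ?addr_ge0// /K; lra.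
  have k2 : `|G2 s| <= K * (`|X1 s| + `|X2 s|).
    by apply: le_trans g2 _; rewrite ler_wpM2r ?addr_ge0// /K; lra.
  have uE : u s = `|X1 s| ^+ 2 + `|X2 s| ^+ 2 + `|Y1 s| ^+ 2 + `|Y2 s| ^+ 2.
    by rewrite !real_normK ?num_real.
  rewrite uE normrM ger0_norm//.
  have e1 : `|X1 s * Y1 s + X2 s * Y2 s - M * (Y1 s * G1 s + Y2 s * G2 s)| <=
     `|X1 s| * `|Y1 s| + `|X2 s| * `|Y2 s| + M * (`|Y1 s| * `|G1 s| + `|Y2 s| * `|G2 s|).
    apply: le_trans (ler_normB _ _) (lerD _ _).
      by apply: le_trans (ler_normD _ _) _; rewrite !normrM.
    rewrite normrM (gtr0_norm M0) ler_wpM2l ?(ltW M0)//.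
    by apply: le_trans (ler_normD _ _) _; rewrite !normrM.
  have K0 : 0 <= K by rewrite addr_ge0.
  have MK0 : 0 <= M * K by rewrite mulr_ge0// ltW.
  move: e1 k1 k2; have := normr_ge0 (X1 s); have := normr_ge0 (X2 s).
  have := normr_ge0 (Y1 s); have := normr_ge0 (Y2 s).
  move: `|X1 s| `|X2 s| `|Y1 s| `|Y2 s| `|G1 s| `|G2 s| => x1 x2 y1 y2 g1' g2'.
  move=> y20 y10 x20 x10 e1 k1 k2; apply: le_trans (ler_wpM2l _ e1) _; first by [].
  have m1 : y1 * g1' <= y1 * (K * (x1 + x2)) by rewrite ler_wpM2l.
  have m2 : y2 * g2' <= y2 * (K * (x1 + x2)) by rewrite ler_wpM2l.
  have m3 : M * (y1 * g1' + y2 * g2') <= M * K * ((y1 + y2) * (x1 + x2)).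
    rewrite -mulrA ler_wpM2l ?(ltW M0)//; lra.
  have m4 : (y1 + y2) * (x1 + x2) <= x1 ^+ 2 + x2 ^+ 2 + y1 ^+ 2 + y2 ^+ 2.
    have := sqr_ge0 (y1 - x1); have := sqr_ge0 (y1 - x2).
    by have := sqr_ge0 (y2 - x1); have := sqr_ge0 (y2 - x2); nra.
  have m5 : M * K * ((y1 + y2) * (x1 + x2)) <= M * K * (x1 ^+ 2 + x2 ^+ 2 + y1 ^+ 2 + y2 ^+ 2).
    by rewrite ler_wpM2l.
  have m6 := sqr_ge0 (x1 - y1). have m7 := sqr_ge0 (x2 - y2).
  by lra.
have := gronwall hu bu t.
have -> : u 0 = 0 by rewrite /u oppr0 d20 v10; ring.
rewrite mul0r /u => h.
have q1 := sqr_ge0 (d1 t - d1 (- t)). have q2 := sqr_ge0 (d2 t + d2 (- t)).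
have q3 := sqr_ge0 (v1 t + v1 (- t)). have q4 := sqr_ge0 (v2 t - v2 (- t)).
have /eqP : (d1 t - d1 (- t)) ^+ 2 = 0 by lra.
have /eqP : (d2 t + d2 (- t)) ^+ 2 = 0 by lra.
by rewrite !sqrf_eq0 => /eqP ? /eqP ?; split; lra.
Qed.

(* With [nu] the true anomaly, [nu' = l / rho ^ 2] and the conic equation
   [rho (1 + e0 cos nu) = l ^ 2 / M] turn the integrand [cos (2 nu) / rho ^ 3]
   into a trigonometric polynomial in [nu] that only contains sines. *)
Lemma kepler_quadrupole_primitive : exists Gam : R -> R,
  [/\ forall t, drv Gam t ((d1 t ^+ 2 - d2 t ^+ 2) / rho t ^+ 5),
      Gam 0 = 0 & Gam (T / 2) = 0].
Proof.
have rn t : rho t != 0 by rewrite gt_eqF.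
have rhoD t : drv rho t ((d1 t * v1 t + d2 t * v2 t) / rho t).
  apply: drv_eq; first exact: (@drv_sqrt _ (fun t => d1 t ^+ 2 + d2 t ^+ 2) t _ (d_neq0 t) (drvD (drvX 2 (d1D t)) (drvX 2 (d2D t)))).
  by rewrite -/(rho t) /=; field; rewrite rn.
pose l := d1 0 * v2 0 - d2 0 * v1 0.
have lE t : d1 t * v2 t - d2 t * v1 t = l.
  apply: (@drv0_cst _ (fun t => d1 t * v2 t - d2 t * v1 t)) => s.
  apply: drv_eq; first exact: drvB (drvM (d1D s) (v2D s)) (drvM (d2D s) (v1D s)).
  by rewrite /=; ring.
have l0 : l != 0.
  rewrite /l d20 mul0r subr0 mulf_neq0//.
  by apply/eqP => e; have := d_neq0 0; rewrite d20 e !expr0n addr0 ltxx.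
have Mn : M != 0 by rewrite gt_eqF.
have r3 t : rho t ^+ 3 = (d1 t ^+ 2 + d2 t ^+ 2) * rho t by rewrite exprSr rho_sqr.
(* With [l] the angular momentum, this is the first component of the conserved eccentricity
   (Laplace-Runge-Lenz) vector. *)
pose e0 := l * v2 0 / M - d1 0 / rho 0.
have cosD t : drv (fun t => d1 t / rho t) t (- d2 t * l / rho t ^+ 3).
  apply: drv_eq; first exact: drvM (d1D t) (drvV (rn t) (rhoD t)).
  rewrite -(lE t) /=.
  transitivity ((v1 t * rho t ^+ 2 - d1 t * (d1 t * v1 t + d2 t * v2 t)) / rho t ^+ 3).
    by field; rewrite rn.
  by rewrite rho_sqr; congr (_ / _); ring.
have sinD t : drv (fun t => d2 t / rho t) t (d1 t * l / rho t ^+ 3).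
  apply: drv_eq; first exact: drvM (d2D t) (drvV (rn t) (rhoD t)).
  rewrite -(lE t) /=.
  transitivity ((v2 t * rho t ^+ 2 - d2 t * (d1 t * v1 t + d2 t * v2 t)) / rho t ^+ 3).
    by field; rewrite rn.
  by rewrite rho_sqr; congr (_ / _); ring.
have e0E t : l * v2 t / M - d1 t / rho t = e0.
  apply: (@drv0_cst _ (fun t => l * v2 t / M - d1 t / rho t)) => s.
  apply: drv_eq.
    exact: drvB (drvM (drvM (drv_cst l s) (v2D s)) (drv_cst M^-1 s)) (cosD s).
  by rewrite /=; field; rewrite Mn rn.
(* Up to sign, the second component of that vector: it vanishes because the motion starts at an apse
   on the first axis. *)
have e0E2 t : l * v1 t / M + d2 t / rho t = 0.
  have -> : 0 = l * v1 0 / M + d2 0 / rho 0 by rewrite v10 d20; ring.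
  apply: (@drv0_cst _ (fun t => l * v1 t / M + d2 t / rho t)) => s.
  apply: drv_eq.
    exact: drvD (drvM (drvM (drv_cst l s) (v1D s)) (drv_cst M^-1 s)) (sinD s).
  by rewrite /=; field; rewrite Mn rn.
have conic t : rho t + e0 * d1 t = l ^+ 2 / M.
  have -> : l ^+ 2 / M = d1 t * (l * v2 t / M) - d2 t * (l * v1 t / M).
    by rewrite expr2 -{2}(lE t); field.
  have -> : l * v2 t / M = e0 + d1 t / rho t by rewrite -(e0E t); ring.
  have -> : l * v1 t / M = - (d2 t / rho t) by have := e0E2 t; lra.
  transitivity (rho t ^+ 2 / rho t + e0 * d1 t); first by field.
  by rewrite rho_sqr; field.
pose a t := d1 t / rho t. pose b t := d2 t / rho t.
pose Gam t := M / l ^+ 3 * (a t * b t + e0 * (b t - 2 / 3 * b t ^+ 3)).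
exists Gam; split.
- move=> t; apply: drv_eq.
    apply: drvM (drv_cst _ t) (drvD (drvM (cosD t) (sinD t)) (drvM (drv_cst e0 t)
      (drvB (sinD t) (drvM (drv_cst (2 / 3) t) (drvX 3 (sinD t)))))).
  rewrite /= /a /b.
  transitivity (M / l ^+ 2 * (d1 t ^+ 2 - d2 t ^+ 2) / rho t ^+ 5 * (rho t + e0 * d1 t)
     + M / l ^+ 2 * e0 * d1 t * (rho t ^+ 2 - (d1 t ^+ 2 + d2 t ^+ 2)) / rho t ^+ 5).
    by field; rewrite rn l0.
  by rewrite conic rho_sqr; field; rewrite rn l0 Mn.
- by rewrite /Gam /b d20; ring.
(* Every term of [Gam] has the sine [b] as a factor, and an odd function of period T vanishes at T /
   2. *)
have d2h : d2 (T / 2) = 0.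
  have := d2T (- (T / 2)); have [_ ->] := kepler_reflection (T / 2).
  have -> : - (T / 2) + T = T / 2 by lra.
  by move=> h; lra.
by rewrite /Gam /b d2h; ring.
Qed.

End PlanarKepler.

(** * The tidal force *)

Section Approximation.
Variables (R : realType) (I : Type) (A : I -> Prop) (e : I -> R).
Hypothesis e_ge0 : forall i, 0 <= e i.
Implicit Types f g : I -> R.

Definition bounded_on f := exists K : R, forall i, A i -> `|f i| <= K.

(** This is f = g + O(e), uniformly on A. With the closure properties below, an asymptotic expansion
    is proved term by term along its formula. *)
Definition close_on f g := exists K : R, forall i, A i -> `|f i - g i| <= K * e i.

Lemma bounded_onD f g : bounded_on f -> bounded_on g -> bounded_on (fun i => f i + g i).
Proof.
move=> [K hf] [L hg]; exists (K + L) => i ai.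
exact: le_trans (ler_normD _ _) (lerD (hf i ai) (hg i ai)).
Qed.

Lemma bounded_onN f : bounded_on f -> bounded_on (fun i => - f i).
Proof. by move=> [K hf]; exists K => i ai; rewrite normrN; exact: hf. Qed.

Lemma bounded_onM f g : bounded_on f -> bounded_on g -> bounded_on (fun i => f i * g i).
Proof.
move=> [K hf] [L hg]; exists (K * L) => i ai.
by rewrite normrM; apply: ler_pM => //; [exact: hf|exact: hg].
Qed.

Lemma bounded_onX f n : bounded_on f -> bounded_on (fun i => f i ^+ n).
Proof.
by move=> [K hf]; exists (K ^+ n) => i ai; rewrite normrX lerXn2r ?nnegrE ?hf// (le_trans _ (hf i ai)).
Qed.

Lemma bounded_onV f (c : R) : 0 < c -> (forall i, A i -> c <= f i) -> bounded_on (fun i => (f i)^-1).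
Proof.
move=> c0 hc; exists c^-1 => i ai; have h := hc i ai.
by rewrite ger0_norm ?lef_pV2 ?invr_ge0 ?posrE// ?(lt_le_trans c0 h)// ltW// (lt_le_trans c0).
Qed.

Lemma close_on_refl f : close_on f f.
Proof. by exists 0 => i _; rewrite subrr normr0 mul0r. Qed.

Lemma close_on_trans f g h : close_on f g -> close_on g h -> close_on f h.
Proof.
move=> [K hf] [L hg]; exists (K + L) => i ai.
rewrite -(subrKA (g i)) mulrDl; exact: le_trans (ler_normD _ _) (lerD (hf i ai) (hg i ai)).
Qed.

Lemma close_onD f f' g g' : close_on f f' -> close_on g g' ->
  close_on (fun i => f i + g i) (fun i => f' i + g' i).
Proof.
move=> [K hf] [L hg]; exists (K + L) => i ai.
rewrite opprD addrACA mulrDl; exact: le_trans (ler_normD _ _) (lerD (hf i ai) (hg i ai)).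
Qed.

Lemma close_onN f f' : close_on f f' -> close_on (fun i => - f i) (fun i => - f' i).
Proof. by move=> [K hf]; exists K => i ai; rewrite -opprD normrN; exact: hf. Qed.

Lemma close_onB f f' g g' : close_on f f' -> close_on g g' ->
  close_on (fun i => f i - g i) (fun i => f' i - g' i).
Proof. by move=> hf hg; apply: close_onD => //; exact: close_onN. Qed.

Lemma close_onM f f' g g' : close_on f f' -> close_on g g' ->
  bounded_on f' -> bounded_on g ->
  close_on (fun i => f i * g i) (fun i => f' i * g' i).
Proof.
move=> [K hf] [L hg] [M bf] [N bg]; exists (K * N + M * L) => i ai.
have -> : f i * g i - f' i * g' i = (f i - f' i) * g i + f' i * (g i - g' i) by ring.
apply: le_trans (ler_normD _ _) _; rewrite !normrM mulrDl.
rewrite -[K * N * e i]mulrAC -[M * L * e i]mulrA.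
apply: lerD; apply: ler_pM => //; [exact: hf|exact: bg|exact: bf|exact: hg].
Qed.

Lemma close_onV f f' (c : R) : 0 < c -> (forall i, A i -> c <= f i /\ c <= f' i) ->
  close_on f f' -> close_on (fun i => (f i)^-1) (fun i => (f' i)^-1).
Proof.
move=> c0 hc [K hf]; exists (K * (c^-1 * c^-1)) => i ai; have [h h'] := hc i ai.
have p : 0 < f i by exact: lt_le_trans h. have p' : 0 < f' i by exact: lt_le_trans h'.
have -> : (f i)^-1 - (f' i)^-1 = - ((f i - f' i) * ((f i)^-1 * (f' i)^-1)).
  by field; rewrite !gt_eqF.
rewrite normrN normrM mulrAC; apply: ler_pM => //; first exact: hf.
rewrite ger0_norm; last by rewrite mulr_ge0// invr_ge0 ltW.
by apply: ler_pM; rewrite ?invr_ge0 ?lef_pV2 ?posrE// ltW.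
Qed.

Lemma bounded_on_close f g : bounded_on e -> close_on f g -> bounded_on g -> bounded_on f.
Proof.
move=> [E he] [K hK] [L hL]; exists (`|K| * E + L) => i ai.
rewrite -[f i](subrK (g i)); apply: le_trans (ler_normD _ _) (lerD _ (hL i ai)).
apply: le_trans (hK i ai) _; apply: (@le_trans _ _ (`|K| * e i)).
  by rewrite ler_wpM2r// ler_norm.
by rewrite ler_wpM2l// (le_trans (ler_norm _) (he i ai)).
Qed.

Lemma close_on_small f g h : bounded_on h -> (forall i, A i -> `|f i - g i| <= `|h i| * e i) ->
  close_on f g.
Proof.
move=> [K hK] hfg; exists K => i ai; apply: le_trans (hfg i ai) _.
by rewrite ler_wpM2r// hK.
Qed.

End Approximation.

(** * Linearisation of the tidal force with a quadratic remainder *)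

Section TidalForce.
Variable R : realType.

(** Here the perturbing body is at distance 1. The inverse cube of the distance X is expanded in w =
    1 - X ^ 2, and the remainder is explicit. The bounds on the three terms add up to 3 / 2 + 27 / 8
    + 15, just below 20. *)
Lemma tidal_taylor_unit (a b x y t X : R) : a ^+ 2 + b ^+ 2 = 1 -> x ^+ 2 + y ^+ 2 = t ^+ 2 ->
  0 <= t <= 4^-1 -> 0 < X -> X ^+ 2 = (x - a) ^+ 2 + (y - b) ^+ 2 ->
  `|(x - a) / X ^+ 3 + a - (x - 3 * a * (a * x + b * y))| <= 20 * t ^+ 2.
Proof.
move=> ab xy /andP[t0 t4] X0 hX.
pose w := 2 * (a * x + b * y) - t ^+ 2.
have Xw : X ^+ 2 = 1 - w by rewrite hX /w; lra.
have cs : (a * x + b * y) ^+ 2 <= t ^+ 2.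
  have -> : t ^+ 2 = (a * x + b * y) ^+ 2 + (a * y - b * x) ^+ 2.
    by transitivity ((a ^+ 2 + b ^+ 2) * (x ^+ 2 + y ^+ 2)); [rewrite ab xy mul1r|ring].
  by rewrite lerDl sqr_ge0.
have /andP[cs1 cs2] : - t <= a * x + b * y <= t.
  by rewrite -ler_norml -[leRHS](ger0_norm t0) -ler_sqr ?nnegrE// !real_normK ?num_real.
have X1 : 1 - t <= X.
  by rewrite -ler_sqr ?nnegrE ?(ltW X0)//; [rewrite Xw /w; lra|lra].
have X2 : X <= 1 + t.
  by rewrite -ler_sqr ?nnegrE ?(ltW X0)//; [rewrite Xw /w; lra|lra].
pose Y := X^-1.
have Y0 : 0 < Y by rewrite invr_gt0.
have Y1 : Y <= 4 / 3.
  have -> : 4 / 3 = (3 / 4 : R)^-1 by field.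
  by rewrite lef_pV2 ?posrE//; lra.
(* The exact remainder of X ^ -3 after the first-order term in w; its factor (X - 1) ^ 2 shows that
   it is of order t ^ 2. *)
pose u := (X - 1) ^+ 2 * (3 / 2 + 3 * Y + 2 * Y ^+ 2 + Y ^+ 3).
have Xn : X != 0 by rewrite gt_eqF.
have uE : (X ^+ 3)^-1 = 1 + 3 / 2 * w + u.
  have -> : w = 1 - X ^+ 2 by rewrite Xw; ring.
  by rewrite /u /Y; field; rewrite Xn.
have u0 : 0 <= u.
  by rewrite mulr_ge0 ?sqr_ge0// !addr_ge0 ?mulr_ge0 ?exprn_ge0// ltW.
have u1 : u <= 12 * t ^+ 2.
  have h1 : (X - 1) ^+ 2 <= t ^+ 2.
    have := mulr_ge0 (_ : 0 <= t - (X - 1)) (_ : 0 <= t + (X - 1)).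
    by move=> /(_ ltac:(lra) ltac:(lra)); lra.
  have h2 : Y ^+ 2 <= 16 / 9 by nra.
  have h3 : Y ^+ 3 <= 64 / 27 by rewrite exprS; nra.
  have h4 : 0 <= (X - 1) ^+ 2 by exact: sqr_ge0.
  rewrite /u mulrC; apply: ler_pM => //; last by lra.
  by rewrite !addr_ge0 ?mulr_ge0 ?exprn_ge0// ltW.
clearbody u.
have -> : (x - a) / X ^+ 3 + a - (x - 3 * a * (a * x + b * y)) =
    3 / 2 * a * t ^+ 2 + 3 / 2 * x * w + (x - a) * u.
  by rewrite uE /w; field.
have a1 : `|a| <= 1.
  rewrite -ler_sqr ?nnegrE// real_normK ?num_real// expr1n -ab.
  by have := sqr_ge0 b; lra.
have x1 : `|x| <= t.
  rewrite -ler_sqr ?nnegrE// real_normK ?num_real// -xy.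
  by have := sqr_ge0 y; lra.
have w1 : `|w| <= 9 / 4 * t.
  by rewrite ler_norml /w; apply/andP; split; nra.
apply: le_trans (ler_normD _ _) _; apply: le_trans (lerD (ler_normD _ _) (lexx _)) _.
rewrite !normrM (ger0_norm (_ : 0 <= (3 : R)))// (ger0_norm (_ : 0 <= (2^-1 : R)))// (ger0_norm u0) (ger0_norm t0) -?expr2.
have k1 : `|x| * `|w| <= t * (9 / 4 * t) by apply: ler_pM.
have k2 : `|x - a| <= 5 / 4 by apply: le_trans (ler_normB _ _) _; lra.
have k3 : `|x - a| * u <= 5 / 4 * (12 * t ^+ 2) by apply: ler_pM.
have k4 : `|a| * t ^+ 2 <= 1 * t ^+ 2 by rewrite ler_wpM2r ?sqr_ge0.
have k5 : 0 <= t ^+ 2 by exact: sqr_ge0.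
rewrite -!mulrA; lra.
Qed.

(** Dividing lengths by r reduces to distance 1. The other component of the force is obtained by
    exchanging the coordinates. *)
Lemma tidal_taylor (a b x y r s : R) : 0 < r -> r ^+ 2 = a ^+ 2 + b ^+ 2 ->
  0 <= s -> 4 * s <= r -> x ^+ 2 + y ^+ 2 = s ^+ 2 ->
  `|(x - a) / Num.sqrt ((x - a) ^+ 2 + (y - b) ^+ 2) ^+ 3 + a / r ^+ 3
     - (x / r ^+ 3 - 3 * a * (a * x + b * y) / r ^+ 5)| <= 20 * s ^+ 2 / r ^+ 4.
Proof.
move=> r0 hr s0 sr xy; have rn : r != 0 by rewrite gt_eqF.
set S := Num.sqrt _.
have S2 : S ^+ 2 = (x - a) ^+ 2 + (y - b) ^+ 2.
  by rewrite sqr_sqrtr// addr_ge0// sqr_ge0.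
have Spos : 0 < S.
  have S0 : 0 <= S by exact: sqrtr_ge0.
  rewrite lt_neqAle S0 andbT; apply/eqP => e; move: S2; rewrite -e expr0n /= => h.
  have h1 := sqr_ge0 (x - a). have h2 := sqr_ge0 (y - b).
  have /eqP : (x - a) ^+ 2 = 0 by lra.
  have /eqP : (y - b) ^+ 2 = 0 by lra.
  rewrite !sqrf_eq0 !subr_eq0 => /eqP yb /eqP xa.
  have p1 : 0 < r ^+ 2 by rewrite exprn_gt0.
  have p2 : 0 <= (r - 4 * s) * (r + 4 * s) by apply: mulr_ge0; lra.
  by move: xy; rewrite xa yb -hr; lra.
have := @tidal_taylor_unit (a / r) (b / r) (x / r) (y / r) (s / r) (S / r).
rewrite !expr_div_n -!mulrDl -hr xy divff ?expf_neq0//.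
have -> : (x / r - a / r) ^+ 2 + (y / r - b / r) ^+ 2 = S ^+ 2 / r ^+ 2 by rewrite S2; field.
have h1 : 0 <= s / r <= 4^-1.
  by rewrite divr_ge0 ?(ltW r0)//= ler_pdivrMr//; lra.
have h2 : 0 < S / r by rewrite divr_gt0.
move=> /(_ erefl erefl h1 h2 erefl) H.
have -> : 20 * s ^+ 2 / r ^+ 4 = (20 * (s ^+ 2 / r ^+ 2)) * (r ^+ 2)^-1 by field.
have -> : (x - a) / S ^+ 3 + a / r ^+ 3 - (x / r ^+ 3 - 3 * a * (a * x + b * y) / r ^+ 5) =
  ((x / r - a / r) / (S ^+ 3 / r ^+ 3) + a / r
     - (x / r - 3 * (a / r) * (a / r * (x / r) + b / r * (y / r)))) * (r ^+ 2)^-1.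
  by field; rewrite rn gt_eqF.
rewrite normrM [X in _ * X <= _]ger0_norm ?invr_ge0 ?sqr_ge0//.
by rewrite ler_wpM2r// invr_ge0 sqr_ge0.
Qed.

End TidalForce.

(** * Osculating elements *)

Section OsculatingElements.
Variables (R : realType) (mu mj : R) (d1 d2 : R -> R).

Local Notation rho := (rho d1 d2).

(** The frame is attached to a primary that is itself accelerated by the other one; the second
    summand is this indirect term, which makes the force vanish at the origin. *)
Definition tide1 (t x y : R) : R :=
  - mj * ((x - d1 t) / Num.sqrt ((x - d1 t) ^+ 2 + (y - d2 t) ^+ 2) ^+ 3
          + d1 t / rho t ^+ 3).
Definition tide2 (t x y : R) : R :=
  - mj * ((y - d2 t) / Num.sqrt ((x - d1 t) ^+ 2 + (y - d2 t) ^+ 2) ^+ 3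
          + d2 t / rho t ^+ 3).

(* The osculating orbit has angular momentum [eta * H], eccentricity vector
   [(k1, k2)] and true longitude [th]; its radius is [eta ^+ 2 * oradius]. *)
Definition oradius (H k1 k2 th : R) : R :=
  H ^+ 2 * (mu * (1 + (k1 * cos th + k2 * sin th)))^-1.
(** The tide vanishes at the origin and the radius scales like eta ^ 2, so dividing by eta ^ 2
    leaves a quantity of order one. *)
Definition force1 (eta t H k1 k2 th : R) : R :=
  tide1 t (eta ^+ 2 * oradius H k1 k2 th * cos th)
          (eta ^+ 2 * oradius H k1 k2 th * sin th) * (eta ^+ 2)^-1.
Definition force2 (eta t H k1 k2 th : R) : R :=
  tide2 t (eta ^+ 2 * oradius H k1 k2 th * cos th)
          (eta ^+ 2 * oradius H k1 k2 th * sin th) * (eta ^+ 2)^-1.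
(** The rates are Gauss's variational equations with the powers of eta taken out: the torque for
    [H], and the derivative of the eccentricity vector for [k1] and [k2]. These elements are regular
    at circular orbits, unlike eccentricity and argument of the periapsis. As [th] is the polar
    angle, its rate is angular momentum over squared radius, with no perturbing term. *)
Definition rateH (eta t H k1 k2 th : R) : R :=
  oradius H k1 k2 th *
  (cos th * force2 eta t H k1 k2 th - sin th * force1 eta t H k1 k2 th).
Definition rate1 (eta t H k1 k2 th : R) : R :=
  (k1 + cos th) * rateH eta t H k1 k2 th * H^-1 + H * force2 eta t H k1 k2 th * mu^-1.
Definition rate2 (eta t H k1 k2 th : R) : R :=
  (k2 + sin th) * rateH eta t H k1 k2 th * H^-1 - H * force1 eta t H k1 k2 th * mu^-1.
Definition rateth (H k1 k2 th : R) : R :=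
  mu ^+ 2 * (1 + (k1 * cos th + k2 * sin th)) ^+ 2 * (H ^+ 3)^-1.

Definition clampH (x : R) : R := clamp 2^-1 4 x.
Definition clampK (x : R) : R := clamp (- 4^-1) 4^-1 x.

Definition i0 : 'I_4 := @Ordinal 4 0 isT.
Definition i1 : 'I_4 := @Ordinal 4 1 isT.
Definition i2 : 'I_4 := @Ordinal 4 2 isT.
Definition i3 : 'I_4 := @Ordinal 4 3 isT.

Lemma ord4P (P : 'I_4 -> Prop) : P i0 -> P i1 -> P i2 -> P i3 -> forall i, P i.
Proof.
move=> p0 p1 p2 p3 [[|[|[|[|n]]]] h] //.
- by rewrite (_ : Ordinal h = i0)//; exact: val_inj.
- by rewrite (_ : Ordinal h = i1)//; exact: val_inj.
- by rewrite (_ : Ordinal h = i2)//; exact: val_inj.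
- by rewrite (_ : Ordinal h = i3)//; exact: val_inj.
Qed.

Definition mk4 (a b c d : R) (i : 'I_4) : R :=
  match val i with 0%N => a | 1%N => b | 2%N => c | _ => d end.

(* The clamps make the field bounded and globally Lipschitz; they are inactive
   along the orbits that are constructed. *)
Definition field (eta t : R) (s : 'I_4 -> R) : 'I_4 -> R :=
  let H := clampH (s i0) in let k1 := clampK (s i1) in let k2 := clampK (s i2) in
  mk4 (eta ^+ 3 * rateH eta t H k1 k2 (s i3)) (eta ^+ 3 * rate1 eta t H k1 k2 (s i3))
      (eta ^+ 3 * rate2 eta t H k1 k2 (s i3)) ((eta ^+ 3)^-1 * rateth H k1 k2 (s i3)).

Variables (r0 B : R).
Hypotheses (mu0 : 0 < mu) (r00 : 0 < r0).
Hypothesis rhoB : forall t, r0 <= rho t <= B.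
Hypothesis d1B : forall t, `|d1 t| <= B.
Hypothesis d2B : forall t, `|d2 t| <= B.

Lemma rho_sqr t : rho t ^+ 2 = d1 t ^+ 2 + d2 t ^+ 2.
Proof. by rewrite sqr_sqrtr// addr_ge0// sqr_ge0. Qed.

Lemma rho_gt0 t : 0 < rho t.
Proof. by have /andP[h _] := rhoB t; exact: lt_le_trans h. Qed.

Definition bounded_elements (H k1 k2 : R) : Prop :=
  [/\ 2^-1 <= H <= 4, `|k1| <= 4^-1 & `|k2| <= 4^-1].

Lemma clamp_bounded (x y z : R) : bounded_elements (clampH x) (clampK y) (clampK z).
Proof.
split; first by apply: clamp_itv; lra.
  by rewrite ler_norml; apply: clamp_itv; lra.
by rewrite ler_norml; apply: clamp_itv; lra.
Qed.

Lemma abs_cos_le1 (x : R) : `|cos x| <= 1.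
Proof. by rewrite ler_norml cos_geN1 cos_le1. Qed.

Lemma abs_sin_le1 (x : R) : `|sin x| <= 1.
Proof. by rewrite ler_norml sin_geN1 sin_le1. Qed.

Lemma kcos_le (k1 k2 th : R) :
  `|k1 * cos th + k2 * sin th| <= `|k1| + `|k2|.
Proof.
apply: le_trans (ler_normD _ _) _; rewrite !normrM.
by apply: lerD; rewrite -[leRHS]mulr1 ler_wpM2l// ?abs_cos_le1 ?abs_sin_le1.
Qed.

Lemma denom_bounds (H k1 k2 th : R) : bounded_elements H k1 k2 ->
  2^-1 <= 1 + (k1 * cos th + k2 * sin th) <= 3 / 2.
Proof.
move=> [_ h1 h2]; have := kcos_le k1 k2 th; rewrite ler_norml => /andP[a b].
by apply/andP; split; lra.
Qed.

Lemma radius_bounds (H k1 k2 th : R) : bounded_elements H k1 k2 ->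
  0 < oradius H k1 k2 th <= 32 / mu.
Proof.
move=> hb; have /andP[h1 h2] := denom_bounds th hb; case: hb => /andP[h3 h4] _ _.
have g0 : 0 < mu * (1 + (k1 * cos th + k2 * sin th)) by apply: mulr_gt0 => //; lra.
rewrite /oradius; apply/andP; split; first by rewrite divr_gt0// exprn_gt0//; lra.
rewrite ler_pdivrMr// mulrA divfK ?gt_eqF//.
have : H ^+ 2 <= 16 by nra.
by lra.
Qed.

Lemma distance_lower_bound (t x y : R) : x ^+ 2 + y ^+ 2 <= (r0 / 4) ^+ 2 ->
  (r0 / 2) ^+ 2 <= (x - d1 t) ^+ 2 + (y - d2 t) ^+ 2.
Proof.
move=> h; have /andP[hr _] := rhoB t.
have : r0 ^+ 2 <= d1 t ^+ 2 + d2 t ^+ 2.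
  by rewrite -rho_sqr; apply: lerXn2r; rewrite ?nnegrE// ?ltW// rho_gt0.
have := sqr_ge0 (2 * x - d1 t); have := sqr_ge0 (2 * y - d2 t).
by have := sqr_ge0 r0; rewrite !expr_div_n in h *; nra.
Qed.

Section FixedScale.
Variable eta : R.
Hypothesis eta_small : eta ^+ 2 * (32 / mu) <= r0 / 4.

Lemma polar_small (H k1 k2 th : R) : bounded_elements H k1 k2 ->
  (eta ^+ 2 * oradius H k1 k2 th * cos th) ^+ 2 +
  (eta ^+ 2 * oradius H k1 k2 th * sin th) ^+ 2 <= (r0 / 4) ^+ 2.
Proof.
move=> hb.
have -> : (eta ^+ 2 * oradius H k1 k2 th * cos th) ^+ 2 +
    (eta ^+ 2 * oradius H k1 k2 th * sin th) ^+ 2 =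
    (eta ^+ 2 * oradius H k1 k2 th) ^+ 2 * (cos th ^+ 2 + sin th ^+ 2) by ring.
rewrite cos2Dsin2 mulr1.
have /andP[r1 r2] := radius_bounds th hb.
apply: lerXn2r; rewrite ?nnegrE.
- by rewrite mulr_ge0 ?sqr_ge0 ?ltW.
- by rewrite divr_ge0 ?ltW.
by apply: le_trans eta_small; rewrite ler_wpM2l ?sqr_ge0.
Qed.

Let dist (s s' : 'I_4 -> R) : R := \sum_(j < 4) `|s j - s' j|.
Let A (_ : R) (_ : 'I_4 -> R) := True.

Let dist_ge0 s s' : 0 <= dist s s'.
Proof. exact: sumr_ge0. Qed.

Let coord_dist j s s' : `|s j - s' j| <= dist s s'.
Proof. by rewrite /dist (bigD1 j)//= lerDl sumr_ge0. Qed.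

(** The constant depends on [eta], through eta ^ -3 among others. It serves existence, uniqueness
    and dependence on initial data at fixed scale; bounds uniform in eta are in [rates_bounded]. *)
Lemma field_blip : exists2 K : R, 0 <= K & forall t s s' i,
  `|field eta t s i| <= K /\ `|field eta t s i - field eta t s' i| <= K * dist s s'.
Proof.
have bH : blip A dist (fun _ s => clampH (s i0)).
  apply: (@blip_coord _ _ _ A dist dist_ge0 (fun s => s i0) clampH 4).
    exact: coord_dist.
  move=> u v; split; last exact: clamp_lip.
  have : 2^-1 <= clampH u <= 4 by apply: clamp_itv; lra.
  by rewrite ler_norml => /andP[h1 h2]; apply/andP; split; lra.
have bK j : blip A dist (fun _ s => clampK (s j)).
  apply: (@blip_coord _ _ _ A dist dist_ge0 (fun s => s j) clampK 4^-1).
    exact: coord_dist.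
  move=> u v; split; last exact: clamp_lip.
  by rewrite ler_norml; apply: clamp_itv; lra.
have bC : blip A dist (fun _ s => cos (s i3)).
  apply: (@blip_coord _ _ _ A dist dist_ge0 (fun s => s i3) cos 1); first exact: coord_dist.
  by move=> u v; split; [exact: abs_cos_le1|exact: cos_lip].
have bS : blip A dist (fun _ s => sin (s i3)).
  apply: (@blip_coord _ _ _ A dist dist_ge0 (fun s => s i3) sin 1); first exact: coord_dist.
  by move=> u v; split; [exact: abs_sin_le1|exact: sin_lip].
have bc c : blip A dist (fun _ _ => c).
  by apply: (@blip_cst _ _ _ A dist dist_ge0 (fun=> c) `|c|).
have b1 : blip A dist (fun t _ => d1 t) by exact: (@blip_cst _ _ _ A dist dist_ge0 d1 B).
have b2 : blip A dist (fun t _ => d2 t) by exact: (@blip_cst _ _ _ A dist dist_ge0 d2 B).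
have br : blip A dist (fun t _ => (rho t ^+ 3)^-1).
  apply: (@blip_cst _ _ _ A dist dist_ge0 (fun t => (rho t ^+ 3)^-1) (r0 ^+ 3)^-1) => t.
  have /andP[h _] := rhoB t.
  have rp : 0 < rho t ^+ 3 by rewrite exprn_gt0// rho_gt0.
  rewrite ger0_norm ?invr_ge0 ?(ltW rp)//.
  have : r0 ^+ 3 <= rho t ^+ 3.
    by apply: lerXn2r; rewrite ?nnegrE//; apply: ltW => //; exact: rho_gt0.
  by rewrite lef_pV2// posrE exprn_gt0.
have bg : blip A dist (fun _ s => 1 + (clampK (s i1) * cos (s i3) + clampK (s i2) * sin (s i3))).
  by apply: blipD; [exact: bc|apply: blipD; apply: blipM].
have bR : blip A dist (fun _ s => oradius (clampH (s i0)) (clampK (s i1)) (clampK (s i2)) (s i3)).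
  apply: blipM; first exact: blipX.
  apply: (@blipV _ _ _ A dist dist_ge0 _ (mu * 2^-1)).
  - by rewrite divr_gt0.
  - move=> _ s _; rewrite ler_wpM2l ?(ltW mu0)//.
    by have /andP[] := denom_bounds (s i3) (clamp_bounded (s i0) (s i1) (s i2)).
  - exact: blipM.
pose X (s : 'I_4 -> R) : R :=
  eta ^+ 2 * oradius (clampH (s i0)) (clampK (s i1)) (clampK (s i2)) (s i3) * cos (s i3).
pose Y (s : 'I_4 -> R) : R :=
  eta ^+ 2 * oradius (clampH (s i0)) (clampK (s i1)) (clampK (s i2)) (s i3) * sin (s i3).
have bX : blip A dist (fun _ s => X s) by apply: blipM => //; exact: blipM.
have bY : blip A dist (fun _ s => Y s) by apply: blipM => //; exact: blipM.
have bS2 : blip A dist (fun t s => (X s - d1 t) ^+ 2 + (Y s - d2 t) ^+ 2).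
  by apply: blipD; apply: (blipX dist_ge0); exact: blipB.
have low : forall (t : R) (s : 'I_4 -> R), (r0 / 2) ^+ 2 <= (X s - d1 t) ^+ 2 + (Y s - d2 t) ^+ 2.
  move=> t s.
  by apply: distance_lower_bound; apply: polar_small; exact: clamp_bounded.
have r2 : 0 < r0 / 2 by rewrite divr_gt0.
have bs : blip A dist
    (fun t s => (Num.sqrt ((X s - d1 t) ^+ 2 + (Y s - d2 t) ^+ 2) ^+ 3)^-1).
  apply: (@blipV _ _ _ A dist dist_ge0 _ ((r0 / 2) ^+ 3)).
  - by rewrite exprn_gt0.
  - move=> t s _; apply: lerXn2r; rewrite ?nnegrE ?sqrtr_ge0//; first exact: ltW.
    by rewrite -[leLHS]gtr0_norm// -sqrtr_sqr ler_wsqrtr.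
  apply: (blipX dist_ge0).
  apply: (@blip_sqrt _ _ _ A dist dist_ge0
    (fun t s => (X s - d1 t) ^+ 2 + (Y s - d2 t) ^+ 2) ((r0 / 2) ^+ 2)) => //.
  by rewrite exprn_gt0.
have bF1 : blip A dist (fun t s => force1 eta t (clampH (s i0)) (clampK (s i1)) (clampK (s i2)) (s i3)).
  apply: blipM; last exact: bc.
  apply: blipM; first exact: bc.
  by apply: blipD; apply: blipM => //; exact: blipB.
have bF2 : blip A dist (fun t s => force2 eta t (clampH (s i0)) (clampK (s i1)) (clampK (s i2)) (s i3)).
  apply: blipM; last exact: bc.
  apply: blipM; first exact: bc.
  by apply: blipD; apply: blipM => //; exact: blipB.
have bT : blip A dist (fun t s => rateH eta t (clampH (s i0)) (clampK (s i1)) (clampK (s i2)) (s i3)).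
  by apply: blipM => //; apply: blipB; exact: blipM.
have bHV : blip A dist (fun _ s => (clampH (s i0))^-1).
  apply: (@blipV _ _ _ A dist dist_ge0 _ 2^-1) => //.
  by move=> _ s _; have [/andP[]] := clamp_bounded (s i0) (s i1) (s i2).
have bH3 : blip A dist (fun _ s => (clampH (s i0) ^+ 3)^-1).
  apply: (@blipV _ _ _ A dist dist_ge0 _ (2^-1 ^+ 3)).
  - by rewrite exprn_gt0.
  - move=> _ s _; have [/andP[h _] _ _] := clamp_bounded (s i0) (s i1) (s i2).
    by apply: lerXn2r; rewrite ?nnegrE//; lra.
  exact: blipX.
have [K0 p0 h0] : blip A dist (fun t s => field eta t s i0).
  by apply: blipM => //; exact: bc.
have [K1 p1 h1] : blip A dist (fun t s => field eta t s i1).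
  apply: blipM; first exact: bc.
  apply: blipD; last by apply: blipM; [exact: blipM|exact: bc].
  by apply: blipM => //; apply: blipM => //; exact: blipD.
have [K2 p2 h2] : blip A dist (fun t s => field eta t s i2).
  apply: blipM; first exact: bc.
  apply: blipB; last by apply: blipM; [exact: blipM|exact: bc].
  by apply: blipM => //; apply: blipM => //; exact: blipD.
have [K3 p3 h3] : blip A dist (fun t s => field eta t s i3).
  apply: blipM; first exact: bc.
  apply: blipM => //; apply: blipM; first exact: bc.
  exact: (blipX dist_ge0).
exists (K0 + K1 + K2 + K3) => [|t s s']; first by rewrite !addr_ge0.
have grow K : 0 <= K <= K0 + K1 + K2 + K3 -> K * dist s s' <= (K0 + K1 + K2 + K3) * dist s s'.
  by move=> /andP[_ h]; rewrite ler_wpM2r.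
apply: ord4P.
- have [e1 e2] := h0 t s s' I I; split; first by lra.
  by apply: le_trans e2 (grow _ _); apply/andP; split; lra.
- have [e1 e2] := h1 t s s' I I; split; first by lra.
  by apply: le_trans e2 (grow _ _); apply/andP; split; lra.
- have [e1 e2] := h2 t s s' I I; split; first by lra.
  by apply: le_trans e2 (grow _ _); apply/andP; split; lra.
- have [e1 e2] := h3 t s s' I I; split; first by lra.
  by apply: le_trans e2 (grow _ _); apply/andP; split; lra.
Qed.

Hypotheses (d1C : continuous d1) (d2C : continuous d2).

Lemma field_continuous (x : R -> 'I_4 -> R) : (forall i, continuous (x ^~ i)) ->
  forall i, continuous (fun t => field eta t (x t) i).
Proof.
move=> cx.
have cH : continuous (fun t => clampH (x t i0)).
  exact: (@cont_comp _ clampH (x ^~ i0) (@cont_clamp _ _ _) (cx i0)).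
have cK j : continuous (fun t => clampK (x t j)).
  exact: (@cont_comp _ clampK (x ^~ j) (@cont_clamp _ _ _) (cx j)).
have cC : continuous (fun t => cos (x t i3)).
  exact: (@cont_comp _ cos (x ^~ i3) (@continuous_cos R) (cx i3)).
have cS : continuous (fun t => sin (x t i3)).
  exact: (@cont_comp _ sin (x ^~ i3) (@continuous_sin R) (cx i3)).
have cg : continuous (fun t => 1 + (clampK (x t i1) * cos (x t i3) + clampK (x t i2) * sin (x t i3))).
  by apply: contD; [exact: cont_cst|apply: contD; apply: contM].
have cR : continuous (fun t => oradius (clampH (x t i0)) (clampK (x t i1)) (clampK (x t i2)) (x t i3)).
  apply: contM; first exact: contX.
  apply: contV; last by apply: contM => //; exact: cont_cst.
  move=> t; rewrite mulf_neq0 ?gt_eqF//.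
  have /andP[h _] := denom_bounds (x t i3) (clamp_bounded (x t i0) (x t i1) (x t i2)).
  by lra.
pose X (s : 'I_4 -> R) : R :=
  eta ^+ 2 * oradius (clampH (s i0)) (clampK (s i1)) (clampK (s i2)) (s i3) * cos (s i3).
pose Y (s : 'I_4 -> R) : R :=
  eta ^+ 2 * oradius (clampH (s i0)) (clampK (s i1)) (clampK (s i2)) (s i3) * sin (s i3).
have cX : continuous (fun t => X (x t)) by apply: contM => //; apply: contM => //; exact: cont_cst.
have cY : continuous (fun t => Y (x t)) by apply: contM => //; apply: contM => //; exact: cont_cst.
have cB f g : continuous f -> continuous g -> continuous (fun t : R => f t - g t :> R).
  by move=> hf hg; apply: contD => //; exact: contN.
have cs : continuous (fun t => (Num.sqrt ((X (x t) - d1 t) ^+ 2 + (Y (x t) - d2 t) ^+ 2) ^+ 3)^-1).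
  apply: contV.
    move=> t; rewrite expf_neq0// gt_eqF// sqrtr_gt0.
    have : (r0 / 2) ^+ 2 <= (X (x t) - d1 t) ^+ 2 + (Y (x t) - d2 t) ^+ 2.
      by apply: distance_lower_bound; apply: polar_small; exact: clamp_bounded.
    by apply: lt_le_trans; rewrite exprn_gt0// divr_gt0.
  apply: contX; apply: (@cont_comp _ Num.sqrt); first exact: sqrt_continuous.
  by apply: contD; apply: contX; exact: cB.
have cr : continuous (fun t => (rho t ^+ 3)^-1).
  apply: contV; first by move=> t; rewrite expf_neq0// gt_eqF// rho_gt0.
  apply: contX; apply: (@cont_comp _ Num.sqrt); first exact: sqrt_continuous.
  by apply: contD; exact: contX.
have cF1 : continuous (fun t => force1 eta t (clampH (x t i0)) (clampK (x t i1)) (clampK (x t i2)) (x t i3)).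
  apply: contM; last exact: cont_cst.
  apply: contM; first exact: cont_cst.
  by apply: contD; apply: contM => //; exact: cB.
have cF2 : continuous (fun t => force2 eta t (clampH (x t i0)) (clampK (x t i1)) (clampK (x t i2)) (x t i3)).
  apply: contM; last exact: cont_cst.
  apply: contM; first exact: cont_cst.
  by apply: contD; apply: contM => //; exact: cB.
have cT : continuous (fun t => rateH eta t (clampH (x t i0)) (clampK (x t i1)) (clampK (x t i2)) (x t i3)).
  by apply: contM => //; apply: cB; exact: contM.
have cHV n : continuous (fun t => (clampH (x t i0) ^+ n)^-1).
  apply: contV; last exact: contX.
  move=> t; rewrite expf_neq0// gt_eqF//.
  by have [/andP[h _] _ _] := clamp_bounded (x t i0) (x t i1) (x t i2); lra.
apply: ord4P.
- by apply: contM => //; exact: cont_cst.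
- apply: contM; first exact: cont_cst.
  apply: contD; last by apply: contM; [exact: contM|exact: cont_cst].
  by apply: contM (cHV 1%N); apply: contM => //; exact: contD.
- apply: contM; first exact: cont_cst.
  apply: cB; last by apply: contM; [exact: contM|exact: cont_cst].
  by apply: contM (cHV 1%N); apply: contM => //; exact: contD.
- apply: contM; first exact: cont_cst.
  apply: contM (cHV 3%N); apply: contM; first exact: cont_cst.
  exact: contX.
Qed.

End FixedScale.
End OsculatingElements.

(** * Equations of motion in elements, and their reversibility *)

Section OrbitEquation.
Variables (R : realType) (mu mj : R) (d1 d2 : R -> R).
Local Notation rateH := (rateH mu mj d1 d2).
Local Notation rate1 := (rate1 mu mj d1 d2).
Local Notation rate2 := (rate2 mu mj d1 d2).
Local Notation oradius := (oradius mu).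

(* The variational equations of the elements: position and velocity keep
   their Keplerian expressions while the elements move. *)
Lemma osculating_motion (eta : R) (H k1 k2 th : R -> R) (t : R) :
  0 < mu -> 0 < eta ->
  let X s := eta ^+ 2 * oradius (H s) (k1 s) (k2 s) (th s) * cos (th s) in
  let Y s := eta ^+ 2 * oradius (H s) (k1 s) (k2 s) (th s) * sin (th s) in
  let U s := - (mu / (eta * H s)) * (k2 s + sin (th s)) in
  let V s := mu / (eta * H s) * (k1 s + cos (th s)) in
  0 < H t -> 0 < 1 + (k1 t * cos (th t) + k2 t * sin (th t)) ->
  drv H t (eta ^+ 3 * rateH eta t (H t) (k1 t) (k2 t) (th t)) ->
  drv k1 t (eta ^+ 3 * rate1 eta t (H t) (k1 t) (k2 t) (th t)) ->
  drv k2 t (eta ^+ 3 * rate2 eta t (H t) (k1 t) (k2 t) (th t)) ->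
  drv th t ((eta ^+ 3)^-1 * rateth mu (H t) (k1 t) (k2 t) (th t)) ->
  [/\ drv X t (U t), drv Y t (V t),
      drv U t (- (mu / Num.sqrt (X t ^+ 2 + Y t ^+ 2) ^+ 3) * X t + tide1 mj d1 d2 t (X t) (Y t)) &
      drv V t (- (mu / Num.sqrt (X t ^+ 2 + Y t ^+ 2) ^+ 3) * Y t + tide2 mj d1 d2 t (X t) (Y t))].
Proof.
move=> mu0 eta0 X Y U V H0 w0 hH hk1 hk2 hth.
pose C := cos (th t). pose S := sin (th t).
have CS : C ^+ 2 + S ^+ 2 = 1 by exact: cos2Dsin2.
pose w := 1 + (k1 t * C + k2 t * S).
have wn : w != 0 by rewrite gt_eqF.
have Hn : H t != 0 by rewrite gt_eqF.
have mn : mu != 0 by rewrite gt_eqF.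
have en : eta != 0 by rewrite gt_eqF.
set F1 := force1 mu mj d1 d2 eta t (H t) (k1 t) (k2 t) (th t).
set F2 := force2 mu mj d1 d2 eta t (H t) (k1 t) (k2 t) (th t).
pose r := H t ^+ 2 * (mu * w)^-1.
have rE : oradius (H t) (k1 t) (k2 t) (th t) = r by [].
pose q := rateH eta t (H t) (k1 t) (k2 t) (th t).
have qE : q = r * (C * F2 - S * F1) by [].
pose n := mu ^+ 2 * w ^+ 2 * (H t ^+ 3)^-1.
have hC : drv (fun s => cos (th s)) t (- S * ((eta ^+ 3)^-1 * n)) by exact: drv_cos.
have hS : drv (fun s => sin (th s)) t (C * ((eta ^+ 3)^-1 * n)) by exact: drv_sin.
(* The perturbing part collapses to 2 eta ^ 3 w q / H. This is exactly what cancels the contribution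
   of [H] in the derivative of the radius, so that [hr] has only the Keplerian term: the osculation
   condition. *)
have hw : drv (fun s => 1 + (k1 s * cos (th s) + k2 s * sin (th s))) t
    (2 * eta ^+ 3 * w * q / H t + (k2 t * C - k1 t * S) * ((eta ^+ 3)^-1 * n)).
  apply: drv_eq; first exact: drvD (drv_cst 1 t) (drvD (drvM hk1 hC) (drvM hk2 hS)).
  rewrite /rate1 /rate2 -/q -/F1 -/F2 -/C -/S /=.
  transitivity (eta ^+ 3 * ((k1 t * C + k2 t * S + (C ^+ 2 + S ^+ 2)) * q / H t
      + H t / mu * (C * F2 - S * F1)) + (k2 t * C - k1 t * S) * ((eta ^+ 3)^-1 * n)).
    by field; rewrite Hn mn en.
  rewrite CS; congr (_ + _).
  have -> : k1 t * C + k2 t * S + 1 = w by rewrite /w addrC.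
  by rewrite qE /r; field; rewrite Hn mn wn.
have hr : drv (fun s => oradius (H s) (k1 s) (k2 s) (th s)) t
    ((k1 t * S - k2 t * C) * mu / (eta ^+ 3 * H t)).
  have mw : (fun s => mu * (1 + (k1 s * cos (th s) + k2 s * sin (th s)))) t != 0.
    by rewrite mulf_neq0.
  have hr : drv (fun s => H s ^+ 2 * (mu * (1 + (k1 s * cos (th s) + k2 s * sin (th s))))^-1) t _ :=
    drvM (drvX 2 hH) (@drvV _ (fun s => mu * (1 + (k1 s * cos (th s) + k2 s * sin (th s)))) t _ mw
      (drvM (drv_cst mu t) hw)).
  apply: drv_eq hr _.
  by rewrite -/q -/C -/S -/w /n /=; field; rewrite Hn mn en wn.
have nrm : Num.sqrt (X t ^+ 2 + Y t ^+ 2) = eta ^+ 2 * r.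
  have -> : X t ^+ 2 + Y t ^+ 2 = (eta ^+ 2 * r) ^+ 2 * (C ^+ 2 + S ^+ 2).
    by rewrite /X /Y rE -/C -/S; ring.
  rewrite CS mulr1 sqrtr_sqr ger0_norm// mulr_ge0 ?sqr_ge0// divr_ge0 ?sqr_ge0//.
  by rewrite mulr_ge0 ?ltW.
have tide1E : tide1 mj d1 d2 t (X t) (Y t) = eta ^+ 2 * F1.
  by rewrite /F1 /force1 -/(X t) -/(Y t); field.
have tide2E : tide2 mj d1 d2 t (X t) (Y t) = eta ^+ 2 * F2.
  by rewrite /F2 /force2 -/(X t) -/(Y t); field.
have eH : (fun s => eta * H s) t != 0 by rewrite mulf_neq0.
split.
- apply: drv_eq; first exact: drvM (drvM (drv_cst (eta ^+ 2) t) hr) hC.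
  rewrite /= rE -/C -/S.
  transitivity (mu / (eta * H t) * (k1 t * S * C - k2 t * C ^+ 2 - S * w)).
    by rewrite /n /r; field; rewrite Hn mn en wn.
  rewrite /U -/S.
  transitivity (mu / (eta * H t) * (- (k2 t * (C ^+ 2 + S ^+ 2)) - S)); first by rewrite /w; ring.
  by rewrite CS; ring.
- apply: drv_eq; first exact: drvM (drvM (drv_cst (eta ^+ 2) t) hr) hS.
  rewrite /= rE -/C -/S.
  transitivity (mu / (eta * H t) * (k1 t * S ^+ 2 - k2 t * S * C + C * w)).
    by rewrite /n /r; field; rewrite Hn mn en wn.
  rewrite /V -/C.
  transitivity (mu / (eta * H t) * ((k1 t * (C ^+ 2 + S ^+ 2)) + C)); first by rewrite /w; ring.
  by rewrite CS mulr1.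
- rewrite nrm tide1E.
  apply: drv_eq.
    exact: drvM (drvN (drvM (drv_cst mu t) (@drvV _ (fun s => eta * H s) t _ eH (drvM (drv_cst eta t) hH)))) (drvD hk2 hS).
  rewrite /rate2 -/q -/F1 -/C -/S /= /X rE -/C /n /r.
  by field; rewrite Hn mn en wn.
- rewrite nrm tide2E.
  apply: drv_eq.
    exact: drvM (drvM (drv_cst mu t) (@drvV _ (fun s => eta * H s) t _ eH (drvM (drv_cst eta t) hH))) (drvD hk1 hC).
  rewrite /rate1 -/q -/F2 -/C -/S /= /Y rE -/S /n /r.
  by field; rewrite Hn mn en wn.
Qed.

Lemma force_reflect (eta t t' H k1 k2 th th' : R) :
  d1 t' = d1 t -> d2 t' = - d2 t -> cos th' = cos th -> sin th' = - sin th ->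
  [/\ force1 mu mj d1 d2 eta t' H k1 (- k2) th' = force1 mu mj d1 d2 eta t H k1 k2 th,
      force2 mu mj d1 d2 eta t' H k1 (- k2) th' = - force2 mu mj d1 d2 eta t H k1 k2 th &
      oradius H k1 (- k2) th' = oradius H k1 k2 th].
Proof.
move=> e1 e2 ec es.
have er : oradius H k1 (- k2) th' = oradius H k1 k2 th by rewrite /oradius ec es mulrNN.
have erho : rho d1 d2 t' = rho d1 d2 t by rewrite /rho e1 e2 sqrrN.
by split => //; rewrite /force1 /force2 /tide1 /tide2 erho er ec es e1 e2 mulrN -opprD sqrrN; ring.
Qed.

(** The clamping interval is symmetric so that the clamped field keeps the reversibility of the true
    one. *)
Lemma clampK_opp (x : R) : clampK (- x) = - clampK x.
Proof.
have ab : - 4^-1 <= (4^-1 : R) by lra.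
rewrite /clampK; have [h1|h1] := leP x (- 4^-1).
  rewrite /clamp (max_l h1) (min_r ab) opprK max_r; last by lra.
  by rewrite min_l//; lra.
have [h2|h2] := leP 4^-1 x.
  rewrite /clamp [Num.max _ x]max_r; last by lra.
  by rewrite (min_l h2) max_l ?min_r//; lra.
by rewrite !clamp_id//; apply/andP; split; lra.
Qed.

(** Reflection in the axis combined with time reversal: each changes the sign of the angular
    momentum, so [H] is kept. The constant c allows for the winding of the longitude, which is a
    real number and not an angle. *)
Definition reflect_elements (c : R) (s : 'I_4 -> R) : 'I_4 -> R :=
  mk4 (s i0) (s i1) (- s i2) (c - s i3).

Lemma field_reflect (eta c t t' : R) (s : 'I_4 -> R) :
  d1 t' = d1 t -> d2 t' = - d2 t ->
  cos (c - s i3) = cos (s i3) -> sin (c - s i3) = - sin (s i3) ->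
  field mu mj d1 d2 eta t' (reflect_elements c s) =
  mk4 (- field mu mj d1 d2 eta t s i0) (- field mu mj d1 d2 eta t s i1)
      (field mu mj d1 d2 eta t s i2) (field mu mj d1 d2 eta t s i3).
Proof.
move=> e1 e2 ec es; rewrite /field /reflect_elements /mk4 /= clampK_opp.
have [f1 f2 fr] := @force_reflect eta t t' (clampH (s i0)) (clampK (s i1)) (clampK (s i2))
  (s i3) (c - s i3) e1 e2 ec es.
by apply/funext => -[[|[|[|[|n]]]] h] //=;
  rewrite /rate1 /rate2 /rateth /rateH ?f1 ?f2 ?fr ?ec ?es; ring.
Qed.

End OrbitEquation.

(** * The flow of the clamped element equations *)

Section ElementFlow.
Variables (R : realType) (mu mj : R) (d1 d2 : R -> R) (T r0 B eta : R).
Hypotheses (mu0 : 0 < mu) (r00 : 0 < r0).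
Hypothesis rhoB : forall t, r0 <= rho d1 d2 t <= B.
Hypothesis d1B : forall t, `|d1 t| <= B.
Hypothesis d2B : forall t, `|d2 t| <= B.
Hypotheses (d1C : continuous d1) (d2C : continuous d2).
Hypothesis eta_small : eta ^+ 2 * (32 / mu) <= r0 / 4.

Local Notation field := (field mu mj d1 d2 eta).

Definition is_flow (x : R -> 'I_4 -> R) : Prop :=
  forall t i, drv (x ^~ i) t (field t (x t) i).

Lemma flow_exists (x0 : 'I_4 -> R) : exists x, x 0 = x0 /\ is_flow x.
Proof.
have [K K0 hK] := field_blip mj mu0 r00 rhoB d1B d2B eta_small.
apply: (@picard_existence R 4 field K K).
- by move=> t s i; have [] := hK t s s i.
- by move=> t s s' i; have [] := hK t s s' i.
- by move=> x cx i; exact: (field_continuous mu0 r00 rhoB eta_small d1C d2C cx).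
Qed.

Lemma flow_dependence : exists K : R, forall x y, is_flow x -> is_flow y -> forall t,
  \sum_(i < 4) (x t i - y t i) ^+ 2 <=
  \sum_(i < 4) (x 0 i - y 0 i) ^+ 2 * expR (K * `|t|).
Proof.
have [K K0 hK] := field_blip mj mu0 r00 rhoB d1B d2B eta_small.
exists (4 * `|K| * 4%:R) => x y hx hy t; apply: (ode_dependence _ hx hy).
by move=> u s s' i; have [] := hK u s s' i.
Qed.

Lemma flow_unique (x y : R -> 'I_4 -> R) (t0 : R) :
  is_flow x -> is_flow y -> x t0 = y t0 -> x = y.
Proof.
move=> hx hy xy.
have [K K0 hK] := field_blip mj mu0 r00 rhoB d1B d2B eta_small.
have e : (fun t => x (t + t0)) = (fun t => y (t + t0)).
  apply: (@ode_uniqueness R 4 (fun t => field (t + t0)) K).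
  - by move=> u s s' i; have [] := hK (u + t0) s s' i.
  - by move=> t i; exact: drv_shift (hx (t + t0) i).
  - by move=> t i; exact: drv_shift (hy (t + t0) i).
  - by rewrite add0r.
by apply/funext => t; have := congr1 (fun f => f (t - t0)) e; rewrite /= subrK.
Qed.

Lemma flow_reflect (a c : R) (x : R -> 'I_4 -> R) :
  (forall t, d1 (a - t) = d1 t) -> (forall t, d2 (a - t) = - d2 t) ->
  (forall u, cos (c - u) = cos u) -> (forall u, sin (c - u) = - sin u) ->
  is_flow x -> is_flow (fun t => reflect_elements c (x (a - t))).
Proof.
move=> e1 e2 ec es hx t.
have d2t : d2 t = - d2 (a - t) by rewrite e2 opprK.
have E := @field_reflect R mu mj d1 d2 eta c (a - t) t (x (a - t)) (esym (e1 t)) d2t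
  (ec _) (es _).
rewrite E.
apply: ord4P => /=.
- exact: drv_refl (hx (a - t) i0).
- exact: drv_refl (hx (a - t) i1).
- by have := drvN (drv_refl (hx (a - t) i2)); rewrite opprK.
- by have := drvB (drv_cst c t) (drv_refl (hx (a - t) i3)); rewrite sub0r opprK.
Qed.

Hypotheses (d1T : periodic d1 T) (d2T : periodic d2 T).
Hypotheses (d1E : forall t, d1 (- t) = d1 t) (d2O : forall t, d2 (- t) = - d2 t).

Lemma cos_nat_pi2 (k : nat) (u : R) : cos (k%:R * (2 * pi) - u) = cos u.
Proof.
have -> : k%:R * (2 * pi) - u = - u + pi *+ 2 *+ k.
  by rewrite -(mulr_natl pi 2) -(mulr_natl (2 * pi) k) addrC.
by rewrite (periodicn (@cosD2pi R)) cosN.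
Qed.

Lemma sin_nat_pi2 (k : nat) (u : R) : sin (k%:R * (2 * pi) - u) = - sin u.
Proof.
have -> : k%:R * (2 * pi) - u = - u + pi *+ 2 *+ k.
  by rewrite -(mulr_natl pi 2) -(mulr_natl (2 * pi) k) addrC.
by rewrite (periodicn (@sinD2pi R)) sinN.
Qed.

(* Two reflections, about [0] and about [T / 2], compose to the translation
   by [T]. *)
Lemma flow_periodic (x : R -> 'I_4 -> R) (k : nat) : is_flow x ->
  x 0 i2 = 0 -> x 0 i3 = 0 -> x (T / 2) i2 = 0 -> x (T / 2) i3 = k%:R * pi ->
  forall t, x (t + T) = mk4 (x t i0) (x t i1) (x t i2) (k%:R * (2 * pi) + x t i3).
Proof.
move=> hx x02 x03 h2 h3 t.
have m4 (s : 'I_4 -> R) : s = mk4 (s i0) (s i1) (s i2) (s i3).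
  by apply/funext; apply: ord4P.
have r0x : (fun t => reflect_elements 0 (x (0 - t))) = x.
  apply: (@flow_unique _ _ 0) => //.
    apply: flow_reflect => // u; rewrite sub0r ?d1E ?d2O ?cosN ?sinN //.
  rewrite subrr [RHS]m4 /reflect_elements x02 x03 oppr0 ?addr0.
  by [].
have rTx : (fun t => reflect_elements (k%:R * (2 * pi)) (x (T - t))) = x.
  apply: (@flow_unique _ _ (T / 2)) => //.
    apply: flow_reflect => // u; rewrite ?cos_nat_pi2 ?sin_nat_pi2//.
      by rewrite addrC d1T d1E.
    by rewrite addrC d2T d2O.
  have -> : T - T / 2 = T / 2 by lra.
  rewrite [RHS]m4 /reflect_elements h2 h3 oppr0; congr mk4; ring.
have e1 : x (- t) = reflect_elements 0 (x t).
  have := congr1 (fun f => f (- t)) r0x; rewrite /= => <-.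
  by rewrite sub0r opprK.
have := congr1 (fun f => f (t + T)) rTx; rewrite /= => <-.
have -> : T - (t + T) = - t by ring.
by rewrite e1 /reflect_elements; congr mk4; rewrite /mk4 /= ?opprK; ring.
Qed.

End ElementFlow.

(** * Averaging *)

Section Averaging.
Variables (R : realType) (mu mj : R) (d1 d2 v1 v2 : R -> R) (r0 B : R).
Hypotheses (mu0 : 0 < mu) (mj0 : 0 < mj) (r00 : 0 < r0).
Hypothesis rhoB : forall t, r0 <= rho d1 d2 t <= B.
Hypothesis d1B : forall t, `|d1 t| <= B.
Hypothesis d2B : forall t, `|d2 t| <= B.
Hypothesis v1B : forall t, `|v1 t| <= B.
Hypothesis v2B : forall t, `|v2 t| <= B.
Hypothesis d1D : forall t, drv d1 t (v1 t).
Hypothesis d2D : forall t, drv d2 t (v2 t).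

Local Notation rho := (rho d1 d2).
Local Notation oradius := (oradius mu).

(* Coefficients of the linearised tidal force: the symmetric matrix with
   trace [cc] and with traceless part given by [gam1] and [gam2]. *)
Definition cc (t : R) : R := mj * (rho t ^+ 3)^-1.
Definition gam1 (t : R) : R := mj * (d1 t ^+ 2 - d2 t ^+ 2) * (rho t ^+ 5)^-1.
Definition gam2 (t : R) : R := 2 * mj * (d1 t * d2 t) * (rho t ^+ 5)^-1.

Definition lin1 (c g h C S : R) : R := c / 2 * C + 3 / 2 * (g * C + h * S).
Definition lin2 (c g h C S : R) : R := c / 2 * S + 3 / 2 * (h * C - g * S).

Let rho_neq0 t : rho t != 0.
Proof. by rewrite gt_eqF// (rho_gt0 r00 rhoB). Qed.

(** At distance eta ^ 2 times a radius of at most 32 / mu, the remainder in [tidal_taylor] is of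
    order eta ^ 4, and the force is rescaled by eta ^ 2. *)
Lemma force_linear (eta t H k1 k2 th : R) : 0 < eta -> eta ^+ 2 * (32 / mu) <= r0 / 4 ->
  bounded_elements H k1 k2 ->
  let K := mj * (20 * (32 / mu) ^+ 2 / r0 ^+ 4) in
  `|force1 mu mj d1 d2 eta t H k1 k2 th -
    oradius H k1 k2 th * lin1 (cc t) (gam1 t) (gam2 t) (cos th) (sin th)| <= K * eta ^+ 2 /\
  `|force2 mu mj d1 d2 eta t H k1 k2 th -
    oradius H k1 k2 th * lin2 (cc t) (gam1 t) (gam2 t) (cos th) (sin th)| <= K * eta ^+ 2.
Proof.
move=> eta0 eta_small hb K.
have /andP[p0 p1] := radius_bounds mu0 th hb.
have /andP[rr _] := rhoB t.
have rp := rho_gt0 r00 rhoB t.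
have rs := rho_sqr d1 d2 t.
have en : eta != 0 by rewrite gt_eqF.
pose s := eta ^+ 2 * oradius H k1 k2 th.
have s0 : 0 <= s by rewrite mulr_ge0 ?sqr_ge0 ?ltW.
have s1 : s <= r0 / 4 by apply: le_trans eta_small; rewrite ler_wpM2l ?sqr_ge0.
have s4 : 4 * s <= rho t by lra.
have xy : (s * cos th) ^+ 2 + (s * sin th) ^+ 2 = s ^+ 2.
  by transitivity (s ^+ 2 * (cos th ^+ 2 + sin th ^+ 2)); [ring|rewrite cos2Dsin2 mulr1].
have yx : (s * sin th) ^+ 2 + (s * cos th) ^+ 2 = s ^+ 2 by rewrite addrC.
have rs' : rho t ^+ 2 = d2 t ^+ 2 + d1 t ^+ 2 by rewrite addrC.
have t1 := tidal_taylor rp rs s0 s4 xy.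
have t2 := tidal_taylor rp rs' s0 s4 yx.
have bound u : `|u| <= 20 * s ^+ 2 / rho t ^+ 4 -> `|mj * (u / eta ^+ 2)| <= K * eta ^+ 2.
  move=> hu; rewrite normrM (gtr0_norm mj0) /K -mulrA ler_wpM2l ?(ltW mj0)//.
  rewrite normrM normfV (ger0_norm (sqr_ge0 eta)) ler_pdivrMr ?exprn_gt0//.
  apply: le_trans hu _.
  have -> : 20 * (32 / mu) ^+ 2 / r0 ^+ 4 * eta ^+ 2 * eta ^+ 2 =
    20 * (eta ^+ 2 * (32 / mu)) ^+ 2 / r0 ^+ 4 by field; rewrite !gt_eqF.
  apply: ler_pM.
  - by rewrite mulr_ge0 ?sqr_ge0.
  - by rewrite invr_ge0 exprn_ge0 ?ltW.
  - rewrite ler_wpM2l// lerXn2r ?nnegrE//; first by rewrite mulr_ge0 ?sqr_ge0// divr_ge0// ltW.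
    by rewrite ler_wpM2l ?sqr_ge0.
  - by rewrite lef_pV2 ?posrE ?exprn_gt0// lerXn2r ?nnegrE// ltW.
split.
- apply: le_trans (bound _ t1); rewrite le_eqVlt -normrN.
  apply/orP; left; apply/eqP; congr (`|_|).
  rewrite /force1 /tide1 -/s.
  set u := (s * cos th - d1 t) / _.
  (* The added summand is zero by the definition of [rho]; with it the splitting into trace and
     traceless part is a plain rational identity. *)
  transitivity (mj * ((u + d1 t / rho t ^+ 3 - (s * cos th / rho t ^+ 3 - 3 * d1 t *
    (d1 t * (s * cos th) + d2 t * (s * sin th)) / rho t ^+ 5)) / eta ^+ 2)
    + 3 / 2 * mj * oradius H k1 k2 th * cos th * (rho t ^+ 2 - (d1 t ^+ 2 + d2 t ^+ 2)) / rho t ^+ 5).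
    by rewrite /lin1 /cc /gam1 /gam2 /s; field; rewrite en rho_neq0.
  by rewrite rs subrr; ring.
- apply: le_trans (bound _ t2); rewrite le_eqVlt -normrN.
  apply/orP; left; apply/eqP; congr (`|_|).
  rewrite /force2 /tide2 -/s [(s * cos th - d1 t) ^+ 2 + _]addrC.
  set u := (s * sin th - d2 t) / _.
  transitivity (mj * ((u + d2 t / rho t ^+ 3 - (s * sin th / rho t ^+ 3 - 3 * d2 t *
    (d2 t * (s * sin th) + d1 t * (s * cos th)) / rho t ^+ 5)) / eta ^+ 2)
    + 3 / 2 * mj * oradius H k1 k2 th * sin th * (rho t ^+ 2 - (d1 t ^+ 2 + d2 t ^+ 2)) / rho t ^+ 5).
    by rewrite /lin2 /cc /gam1 /gam2 /s; field; rewrite en rho_neq0.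
  by rewrite rs subrr; ring.
Qed.

(** All parameters and variables in one record, so that estimates uniform in all of them concern
    functions on a single type. [c_H0] and [c_kap] are initial values of the angular momentum and of
    the eccentricity vector; the later fields are current values. *)
Record config := Config {
  c_eta : R; c_t : R; c_H0 : R; c_kap : R; c_H : R; c_k1 : R; c_k2 : R; c_th : R }.

Definition admissible (i : config) : Prop :=
  [/\ 0 < c_eta i <= 1, c_eta i ^+ 2 * (32 / mu) <= r0 / 4,
      bounded_elements (c_H i) (c_k1 i) (c_k2 i) &
      1 <= c_H0 i <= 2 /\ `|c_kap i| <= 8^-1].

Local Notation bounded A := (@bounded_on R config A).
Local Notation F1 i := (force1 mu mj d1 d2 (c_eta i) (c_t i) (c_H i) (c_k1 i) (c_k2 i) (c_th i)).
Local Notation F2 i := (force2 mu mj d1 d2 (c_eta i) (c_t i) (c_H i) (c_k1 i) (c_k2 i) (c_th i)).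
Local Notation Rad i := (oradius (c_H i) (c_k1 i) (c_k2 i) (c_th i)).

Lemma bounded_const (A : config -> Prop) (c : R) : bounded A (fun=> c).
Proof. by exists `|c|. Qed.

Let bc := bounded_const admissible.

Lemma bounded_time (f : R -> R) (K : R) (A : config -> Prop) :
  (forall t, `|f t| <= K) -> bounded A (fun i => f (c_t i)).
Proof. by move=> h; exists K. Qed.

Let inv_rho n : bounded admissible (fun i => (rho (c_t i) ^+ n)^-1).
Proof.
apply: (bounded_onV (c := r0 ^+ n)); first by rewrite exprn_gt0.
move=> i _; have /andP[h _] := rhoB (c_t i).
by rewrite lerXn2r ?nnegrE// ltW// (rho_gt0 r00 rhoB).
Qed.

Ltac bounded_tac :=
  repeat first [assumption | exact: bc | exact: inv_rho | apply: bounded_onD | apply: bounded_onM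
    | apply: bounded_onN | apply: bounded_onX].

Let bd1 : bounded admissible (fun i => d1 (c_t i)) := bounded_time admissible d1B.
Let bd2 : bounded admissible (fun i => d2 (c_t i)) := bounded_time admissible d2B.
Let bv1 : bounded admissible (fun i => v1 (c_t i)) := bounded_time admissible v1B.
Let bv2 : bounded admissible (fun i => v2 (c_t i)) := bounded_time admissible v2B.

Let bcc : bounded admissible (fun i => cc (c_t i)).
Proof. by rewrite /cc; bounded_tac. Qed.
Let bg1 : bounded admissible (fun i => gam1 (c_t i)).
Proof. by rewrite /gam1; bounded_tac. Qed.
Let bg2 : bounded admissible (fun i => gam2 (c_t i)).
Proof. by rewrite /gam2; bounded_tac. Qed.
Let bC : bounded admissible (fun i => cos (c_th i)).
Proof. by exists 1 => i _; exact: abs_cos_le1. Qed.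
Let bS : bounded admissible (fun i => sin (c_th i)).
Proof. by exists 1 => i _; exact: abs_sin_le1. Qed.
Let bH : bounded admissible (fun i => c_H i).
Proof. by exists 4 => i [_ _ [/andP[h1 h2] _ _] _]; rewrite ger0_norm//; lra. Qed.
Let bH0 : bounded admissible (fun i => c_H0 i).
Proof. by exists 2 => i [_ _ _ [/andP[h1 h2] _]]; rewrite ger0_norm//; lra. Qed.
Let bk1 : bounded admissible (fun i => c_k1 i).
Proof. by exists 4^-1 => i [_ _ [_ h _] _]. Qed.
Let bk2 : bounded admissible (fun i => c_k2 i).
Proof. by exists 4^-1 => i [_ _ [_ _ h] _]. Qed.
Let bkap : bounded admissible (fun i => c_kap i).
Proof. by exists 8^-1 => i [_ _ _ [_ h]]. Qed.
Let beta : bounded admissible (fun i => c_eta i).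
Proof. by exists 1 => i [/andP[h1 h2] _ _ _]; rewrite ger0_norm// ltW. Qed.
Let bHV : bounded admissible (fun i => (c_H i)^-1).
Proof. by apply: (bounded_onV (c := 2^-1)) => // i [_ _ [/andP[h1 h2] _ _] _]. Qed.
Let bHV3 : bounded admissible (fun i => (c_H i ^+ 3)^-1).
Proof.
apply: (bounded_onV (c := 2^-1 ^+ 3)); first by rewrite exprn_gt0.
by move=> i [_ _ [/andP[h1 h2] _ _] _]; rewrite lerXn2r ?nnegrE//; lra.
Qed.
Let bH0V : bounded admissible (fun i => (c_H0 i)^-1).
Proof. by apply: (bounded_onV (c := 1)) => // i [_ _ _ [/andP[h1 h2] _]]. Qed.
Let bH0V3 : bounded admissible (fun i => (c_H0 i ^+ 3)^-1).
Proof.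
apply: (bounded_onV (c := 1)); first by [].
by move=> i [_ _ _ [/andP[h1 h2] _]]; rewrite exprn_ege1.
Qed.
Let bR : bounded admissible (fun i => Rad i).
Proof.
exists (32 / mu) => i [_ _ hb _]; have /andP[p0 p1] := radius_bounds mu0 (c_th i) hb.
by rewrite ger0_norm// ltW.
Qed.

Local Notation L1 i := (lin1 (cc (c_t i)) (gam1 (c_t i)) (gam2 (c_t i)) (cos (c_th i)) (sin (c_th i))).
Local Notation L2 i := (lin2 (cc (c_t i)) (gam1 (c_t i)) (gam2 (c_t i)) (cos (c_th i)) (sin (c_th i))).

Let bL1 : bounded admissible (fun i => L1 i).
Proof. by rewrite /lin1; bounded_tac. Qed.
Let bL2 : bounded admissible (fun i => L2 i).
Proof. by rewrite /lin2; bounded_tac. Qed.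

(** The mean rate to be detected is proportional to [c_kap], hence the error must be of second order
    in it. *)
Let err (i : config) : R := c_kap i ^+ 2 + c_eta i ^+ 2.
Let err_ge0 i : 0 <= err i. Proof. by rewrite addr_ge0 ?sqr_ge0. Qed.
Local Notation close f g := (close_on admissible err f g).
Let berr : bounded admissible err. Proof. by rewrite /err; bounded_tac. Qed.

Let closeF1 : close (fun i => F1 i) (fun i => Rad i * L1 i).
Proof.
exists (mj * (20 * (32 / mu) ^+ 2 / r0 ^+ 4)) => i [/andP[e0 _] es hb _].
have [h _] := force_linear (c_t i) (c_th i) e0 es hb.
apply: le_trans h _; rewrite ler_wpM2l; last by rewrite lerDr sqr_ge0.
  by [].
by rewrite !mulr_ge0 ?invr_ge0 ?exprn_ge0 ?(ltW mj0) ?divr_ge0 ?(ltW mu0) ?(ltW r00).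
Qed.
Let closeF2 : close (fun i => F2 i) (fun i => Rad i * L2 i).
Proof.
exists (mj * (20 * (32 / mu) ^+ 2 / r0 ^+ 4)) => i [/andP[e0 _] es hb _].
have [_ h] := force_linear (c_t i) (c_th i) e0 es hb.
apply: le_trans h _; rewrite ler_wpM2l; last by rewrite lerDr sqr_ge0.
  by [].
by rewrite !mulr_ge0 ?invr_ge0 ?exprn_ge0 ?(ltW mj0) ?divr_ge0 ?(ltW mu0) ?(ltW r00).
Qed.

Let bF1 : bounded admissible (fun i => F1 i).
Proof. by apply: bounded_on_close closeF1 _ => //; bounded_tac. Qed.
Let bF2 : bounded admissible (fun i => F2 i).
Proof. by apply: bounded_on_close closeF2 _ => //; bounded_tac. Qed.

Lemma rates_bounded : exists2 K : R, 0 <= K & forall eta t H k1 k2 th,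
  0 < eta <= 1 -> eta ^+ 2 * (32 / mu) <= r0 / 4 -> bounded_elements H k1 k2 ->
  [/\ `|rateH mu mj d1 d2 eta t H k1 k2 th| <= K,
      `|rate1 mu mj d1 d2 eta t H k1 k2 th| <= K &
      `|rate2 mu mj d1 d2 eta t H k1 k2 th| <= K].
Proof.
have [K0 h0] : bounded admissible (fun i =>
    rateH mu mj d1 d2 (c_eta i) (c_t i) (c_H i) (c_k1 i) (c_k2 i) (c_th i)).
  by rewrite /rateH; bounded_tac.
have [K1 h1] : bounded admissible (fun i =>
    rate1 mu mj d1 d2 (c_eta i) (c_t i) (c_H i) (c_k1 i) (c_k2 i) (c_th i)).
  by rewrite /rate1 /rateH; bounded_tac.
have [K2 h2] : bounded admissible (fun i =>
    rate2 mu mj d1 d2 (c_eta i) (c_t i) (c_H i) (c_k1 i) (c_k2 i) (c_th i)).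
  by rewrite /rate2 /rateH; bounded_tac.
exists (`|K0| + `|K1| + `|K2|) => [|eta t H k1 k2 th he hs hb]; first by rewrite !addr_ge0.
(* The rates do not involve the initial values; 1 and 0 are arbitrary admissible ones. *)
have adm : admissible (Config eta t 1 0 H k1 k2 th).
  by split => //=; split; [apply/andP; split; lra|rewrite normr0].
have := h0 _ adm; have := h1 _ adm; have := h2 _ adm.
move=> /= g2 g1 g0; have := ler_norm K0; have := ler_norm K1; have := ler_norm K2.
have := normr_ge0 K0; have := normr_ge0 K1; have := normr_ge0 K2.
by move=> *; split; lra.
Qed.


(* [corrector] removes the oscillating part of the rate of [k2]: to first
   order in [kap] its derivative in the longitude is that rate minus its mean
   [kap * (3 / 4 * c + 15 / 4 * g)]. *)
Definition corrector (c g h kap C S : R) : R :=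
  h * (3 * C - C ^+ 3) - g * (S ^+ 3 + 3 / 2 * S) - c / 2 * S +
  kap * (- (3 * h * S ^+ 2 * C ^+ 2) - 3 / 2 * g * (S * C) * (C ^+ 2 - S ^+ 2)
         + 3 / 4 * c * (S * C) + 9 / 4 * g * (S * C) + 9 / 4 * h * S ^+ 2).

Definition corrector_th0 (c g h C S : R) : R :=
  S * (C * lin2 c g h C S - S * lin1 c g h C S) - lin1 c g h C S.
(** The part of first order in [kap]. The longitude advances at a rate proportional to 1 + 2 kap C,
    so 2 C times [corrector_th0] is subtracted from the first-order part of the rate of [k2]; the
    last bracket is the mean over the longitude. *)
Definition corrector_th1 (c g h C S : R) : R :=
  - 4 * C * S * (C * lin2 c g h C S - S * lin1 c g h C S) + 3 * C * lin1 c g h C S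
  - (3 / 4 * c + 15 / 4 * g).
Definition corrector_th (c g h kap C S : R) : R :=
  corrector_th0 c g h C S + kap * corrector_th1 c g h C S.

(** As [corrector] is linear in c, g, h, their motion contributes [corrector] at their derivatives.
    The longitude contributes a trigonometric identity modulo sin ^ 2 = 1 - cos ^ 2. *)
Lemma corrector_drv (c g h c' g' h' th : R -> R) (kap th' t : R) :
  drv c t (c' t) -> drv g t (g' t) -> drv h t (h' t) -> drv th t th' ->
  drv (fun s => corrector (c s) (g s) (h s) kap (cos (th s)) (sin (th s))) t
    (corrector (c' t) (g' t) (h' t) kap (cos (th t)) (sin (th t)) +
     corrector_th (c t) (g t) (h t) kap (cos (th t)) (sin (th t)) * th').
Proof.
move=> hc hg hh hth.
have hC := drv_cos hth. have hS := drv_sin hth.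
have kst (x : R) := drv_cst x t.
apply: drv_eq.
  apply: drvD.
    apply: drvB; last exact: drvM (drvM hc (kst _)) hS.
    apply: drvB; first exact: drvM hh (drvB (drvM (kst _) hC) (drvX 3 hC)).
    exact: drvM hg (drvD (drvX 3 hS) (drvM (kst _) hS)).
  apply: drvM (kst _) _.
  apply: drvD; last exact: drvM (drvM (kst _) hh) (drvX 2 hS).
  apply: drvD; last exact: drvM (drvM (kst _) hg) (drvM hS hC).
  apply: drvD; last exact: drvM (drvM (kst _) hc) (drvM hS hC).
  apply: drvB.
    exact: drvN (drvM (drvM (drvM (kst _) hh) (drvX 2 hS)) (drvX 2 hC)).
  exact: drvM (drvM (drvM (kst _) hg) (drvM hS hC)) (drvB (drvX 2 hC) (drvX 2 hS)).
have S2 : sin (th t) ^+ 2 = 1 - cos (th t) ^+ 2.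
  by rewrite -(cos2Dsin2 (th t)); ring.
rewrite /corrector_th /corrector_th0 /corrector_th1 /lin1 /lin2 /corrector /=.
move: (cos (th t)) (sin (th t)) S2 => C S S2.
by field: S2.
Qed.

(** The exponent 1 brings the inverse to the form of [inv_rho], which the bounding tactic
    recognises. *)
Definition rho' (t : R) : R := (d1 t * v1 t + d2 t * v2 t) * (rho t ^+ 1)^-1.
Definition cc' (t : R) : R := - (3 * mj) * rho' t * (rho t ^+ 4)^-1.
Definition gam1' (t : R) : R := 2 * mj * (d1 t * v1 t - d2 t * v2 t) * (rho t ^+ 5)^-1
  - 5 * mj * (d1 t ^+ 2 - d2 t ^+ 2) * rho' t * (rho t ^+ 6)^-1.
Definition gam2' (t : R) : R := 2 * mj * (v1 t * d2 t + d1 t * v2 t) * (rho t ^+ 5)^-1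
  - 10 * mj * (d1 t * d2 t) * rho' t * (rho t ^+ 6)^-1.

Lemma rho_drv t : drv rho t (rho' t).
Proof.
have p : 0 < d1 t ^+ 2 + d2 t ^+ 2 by rewrite -rho_sqr exprn_gt0// (rho_gt0 r00 rhoB).
apply: drv_eq.
  exact: (@drv_sqrt _ (fun t => d1 t ^+ 2 + d2 t ^+ 2) t _ p
    (drvD (drvX 2 (d1D t)) (drvX 2 (d2D t)))).
by rewrite -/(rho t) /rho' /=; field; rewrite rho_neq0.
Qed.

Lemma cc_drv t : drv cc t (cc' t).
Proof.
have rn : rho t ^+ 3 != 0 by rewrite expf_neq0.
apply: drv_eq.
  exact: drvM (drv_cst mj t) (@drvV _ (fun t => rho t ^+ 3) t _ rn (drvX 3 (rho_drv t))).
by rewrite /cc' /=; field; rewrite rho_neq0.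
Qed.

Lemma gam1_drv t : drv gam1 t (gam1' t).
Proof.
have rn : rho t ^+ 5 != 0 by rewrite expf_neq0.
apply: drv_eq.
  exact: drvM (drvM (drv_cst mj t) (drvB (drvX 2 (d1D t)) (drvX 2 (d2D t))))
    (@drvV _ (fun t => rho t ^+ 5) t _ rn (drvX 5 (rho_drv t))).
by rewrite /gam1' /=; field; rewrite rho_neq0.
Qed.

Lemma gam2_drv t : drv gam2 t (gam2' t).
Proof.
have rn : rho t ^+ 5 != 0 by rewrite expf_neq0.
apply: drv_eq.
  exact: drvM (drvM (drv_cst (2 * mj) t) (drvM (d1D t) (d2D t)))
    (@drvV _ (fun t => rho t ^+ 5) t _ rn (drvX 5 (rho_drv t))).
by rewrite /gam2' /=; field; rewrite rho_neq0.
Qed.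

Let brho' : bounded admissible (fun i => rho' (c_t i)).
Proof. by rewrite /rho'; bounded_tac. Qed.

Definition near_circular (K : R) (i : config) : Prop :=
  admissible i /\ [/\ `|c_H i - c_H0 i| <= K * c_eta i ^+ 2,
    `|c_k1 i - c_kap i| <= K * c_eta i ^+ 2 & `|c_k2 i| <= K * c_eta i ^+ 2].

(** Along nearly circular orbits every ingredient may be replaced by its value at the initial
    elements, expanded to first order in [c_kap]. The orders zero and one then cancel by the choice
    of [corrector], up to the mean. Here [inv_n] is the inverse mean motion in units of eta ^ 3. *)
Lemma averaging_error (K : R) : exists2 K' : R, 0 <= K' & forall i, near_circular K i ->
  let inv_n := c_H0 i ^+ 3 * (mu ^+ 2)^-1 in
  `|rate2 mu mj d1 d2 (c_eta i) (c_t i) (c_H i) (c_k1 i) (c_k2 i) (c_th i)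
    - c_eta i ^+ 3 * (inv_n ^+ 2 * corrector (cc' (c_t i)) (gam1' (c_t i)) (gam2' (c_t i))
        (c_kap i) (cos (c_th i)) (sin (c_th i)))
    - inv_n ^+ 2 * corrector_th (cc (c_t i)) (gam1 (c_t i)) (gam2 (c_t i))
        (c_kap i) (cos (c_th i)) (sin (c_th i))
      * rateth mu (c_H i) (c_k1 i) (c_k2 i) (c_th i)
    - c_kap i * inv_n * (15 / 4 * gam1 (c_t i) + 3 / 4 * cc (c_t i))|
  <= K' * (c_kap i ^+ 2 + c_eta i ^+ 2).
Proof.
pose A := near_circular K.
have K0 i : A i -> 0 <= K.
  move=> [[/andP[e0 _] _ _ _] [h _ _]]; have := le_trans (normr_ge0 _) h.
  by rewrite pmulr_lge0// exprn_gt0.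
have lift f : bounded admissible f -> bounded A f.
  by move=> [M hM]; exists M => i [ai _]; exact: hM.
have e_le i : 0 <= c_eta i ^+ 2 <= err i.
  by rewrite sqr_ge0 /err lerDr sqr_ge0.
have cH : close_on A err (fun i => c_H i) (fun i => c_H0 i).
  exists K => i ai; have [_ [h _ _]] := ai; apply: le_trans h _.
  by rewrite ler_wpM2l ?(K0 i)//; have /andP[] := e_le i.
have ck1 : close_on A err (fun i => c_k1 i) (fun i => c_kap i).
  exists K => i ai; have [_ [_ h _]] := ai; apply: le_trans h _.
  by rewrite ler_wpM2l ?(K0 i)//; have /andP[] := e_le i.
have ck2 : close_on A err (fun i => c_k2 i) (fun=> 0).
  exists K => i ai; have [_ [_ _ h]] := ai; rewrite subr0; apply: le_trans h _.
  by rewrite ler_wpM2l ?(K0 i)//; have /andP[] := e_le i.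
have rfl f : close_on A err f f by exact: close_on_refl.
have bA (f : config -> R) : bounded admissible f -> bounded A f by exact: lift.
pose G0 i := 1 + c_kap i * cos (c_th i).
have kc i : admissible i -> `|c_kap i * cos (c_th i)| <= 8^-1.
  move=> [_ _ _ [_ h]]; rewrite normrM -[leRHS]mulr1.
  by apply: ler_pM => //; exact: abs_cos_le1.
have G0_ge i : admissible i -> 2^-1 <= G0 i.
  by move=> /kc; rewrite ler_norml /G0 => /andP[h1 h2]; lra.
have cG : close_on A err
    (fun i => 1 + (c_k1 i * cos (c_th i) + c_k2 i * sin (c_th i))) G0.
  have -> : G0 = (fun i => 1 + (c_kap i * cos (c_th i) + 0 * sin (c_th i))).
    by apply/funext => i; rewrite mul0r addr0.
  apply: close_onD => //; apply: close_onD.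
    by apply: close_onM => //; apply: bA; bounded_tac.
  by apply: close_onM => //; apply: bA; bounded_tac.
have bG0V : bounded admissible (fun i => (G0 i)^-1).
  by apply: (bounded_onV (c := 2^-1)).
have bG0 : bounded admissible G0 by rewrite /G0; bounded_tac.
have bG : bounded admissible (fun i => 1 + (c_k1 i * cos (c_th i) + c_k2 i * sin (c_th i))).
  by bounded_tac.
(* The radius on the initial ellipse, to first order in its eccentricity. *)
pose R0 i := c_H0 i ^+ 2 * (mu^-1 * (1 - c_kap i * cos (c_th i))).
have bR0 : bounded admissible R0 by rewrite /R0; bounded_tac.
have bGV : bounded admissible
    (fun i => (mu * (1 + (c_k1 i * cos (c_th i) + c_k2 i * sin (c_th i))))^-1).
  apply: (bounded_onV (c := mu * 2^-1)); first by rewrite divr_gt0.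
  move=> i [_ _ hb _]; rewrite ler_wpM2l ?(ltW mu0)//.
  by have /andP[] := denom_bounds (c_th i) hb.
have cR : close_on A err (fun i => Rad i) R0.
  apply: close_onM; [| |by apply: bA; bounded_tac|by apply: bA; bounded_tac].
    by apply: close_onM => //; apply: bA; bounded_tac.
  apply: (@close_on_trans _ _ _ _ _ (fun i => (mu * G0 i)^-1)).
    apply: (close_onV (c := mu * 2^-1)); first by rewrite divr_gt0.
      move=> i [ai _]; split; rewrite ler_wpM2l ?(ltW mu0)//; last exact: G0_ge.
      by have [_ _ hb _] := ai; have /andP[] := denom_bounds (c_th i) hb.
    by apply: close_onM => //; apply: bA; bounded_tac.
  have bh : bounded A (fun i => mu^-1 * (cos (c_th i) ^+ 2 * (G0 i)^-1)).
    by apply: bA; bounded_tac.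
  apply: (close_on_small err_ge0 bh) => i [ai _].
  have g0 := G0_ge i ai.
  have -> : (mu * G0 i)^-1 - mu^-1 * (1 - c_kap i * cos (c_th i)) =
      mu^-1 * (cos (c_th i) ^+ 2 * (G0 i)^-1) * c_kap i ^+ 2.
    by move: g0; rewrite /G0 => g0; field; rewrite !gt_eqF//; lra.
  rewrite normrM ler_wpM2l// ger0_norm ?sqr_ge0//.
  by rewrite /err lerDl sqr_ge0.
have cL (L : config -> R) (F : config -> R) : close (fun i => F i) (fun i => Rad i * L i) ->
    bounded admissible L -> close_on A err (fun i => F i) (fun i => R0 i * L i).
  move=> [M hM] bL; apply: (@close_on_trans _ _ _ _ _ (fun i => Rad i * L i)).
    by exists M => i [ai _]; exact: hM.
  by apply: close_onM => //; apply: bA.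
have cF1 := cL _ _ closeF1 bL1.
have cF2 := cL _ _ closeF2 bL2.
have cT : close_on A err
    (fun i => rateH mu mj d1 d2 (c_eta i) (c_t i) (c_H i) (c_k1 i) (c_k2 i) (c_th i))
    (fun i => R0 i * (cos (c_th i) * (R0 i * L2 i) - sin (c_th i) * (R0 i * L1 i))).
  apply: close_onM => //; try by apply: bA; bounded_tac.
  by apply: close_onB; apply: close_onM => //; apply: bA; bounded_tac.
have cHV : close_on A err (fun i => (c_H i)^-1) (fun i => (c_H0 i)^-1).
  apply: (close_onV (c := 2^-1)) => // i [[_ _ [/andP[h1 h2] _ _] [/andP[h3 h4] _]] _].
  by split; lra.
have bT : bounded admissible
    (fun i => rateH mu mj d1 d2 (c_eta i) (c_t i) (c_H i) (c_k1 i) (c_k2 i) (c_th i)).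
  by rewrite /rateH; bounded_tac.
have c2 : close_on A err
    (fun i => rate2 mu mj d1 d2 (c_eta i) (c_t i) (c_H i) (c_k1 i) (c_k2 i) (c_th i))
    (fun i => (0 + sin (c_th i)) *
       (R0 i * (cos (c_th i) * (R0 i * L2 i) - sin (c_th i) * (R0 i * L1 i))) * (c_H0 i)^-1
       - c_H0 i * (R0 i * L1 i) * mu^-1).
  apply: close_onB.
    apply: close_onM => //; try by apply: bA; bounded_tac.
    apply: close_onM => //; try by apply: bA; bounded_tac.
    exact: close_onD.
  apply: close_onM => //; try by apply: bA; bounded_tac.
  by apply: close_onM => //; apply: bA; bounded_tac.
have cth : close_on A err (fun i => rateth mu (c_H i) (c_k1 i) (c_k2 i) (c_th i))
    (fun i => mu ^+ 2 * (G0 i * G0 i) * (c_H0 i ^+ 3)^-1).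
  rewrite /rateth; apply: close_onM; try by apply: bA; bounded_tac.
    apply: close_onM => //; try by apply: bA; bounded_tac.
    under [X in close_on A err X]funext do rewrite expr2.
    by apply: close_onM => //; apply: bA; bounded_tac.
  apply: (close_onV (c := 2^-1 ^+ 3)); first by rewrite exprn_gt0.
    move=> i [[_ _ [/andP[h1 h2] _ _] [/andP[h3 h4] _]] _].
    by split; rewrite lerXn2r ?nnegrE//; lra.
  under [X in close_on A err X]funext do rewrite !exprS expr0 mulr1.
  under [X in close_on A err _ X]funext do rewrite !exprS expr0 mulr1.
  apply: close_onM => //; try by apply: bA; bounded_tac.
  by apply: close_onM => //; apply: bA; bounded_tac.
pose inv_n i := c_H0 i ^+ 3 * (mu ^+ 2)^-1.
have binv : bounded admissible inv_n by rewrite /inv_n; bounded_tac.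
pose Vt i := inv_n i ^+ 2 * corrector (cc' (c_t i)) (gam1' (c_t i)) (gam2' (c_t i))
        (c_kap i) (cos (c_th i)) (sin (c_th i)).
have bVt : bounded admissible Vt.
  by rewrite /Vt /corrector /cc' /gam1' /gam2'; bounded_tac.
have cVt : close_on A err (fun i => c_eta i ^+ 3 * Vt i) (fun=> 0).
  have bh : bounded A (fun i => c_eta i * Vt i) by apply: bA; bounded_tac.
  apply: (close_on_small err_ge0 bh) => i _; rewrite subr0.
  have -> : c_eta i ^+ 3 * Vt i = c_eta i * Vt i * c_eta i ^+ 2 by ring.
  rewrite normrM ler_wpM2l// ger0_norm ?sqr_ge0//.
  by have /andP[] := e_le i.
pose Vth i := inv_n i ^+ 2 * corrector_th (cc (c_t i)) (gam1 (c_t i)) (gam2 (c_t i))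
        (c_kap i) (cos (c_th i)) (sin (c_th i)).
have bth0 : bounded admissible (fun i => corrector_th0 (cc (c_t i)) (gam1 (c_t i)) (gam2 (c_t i))
   (cos (c_th i)) (sin (c_th i))).
  by rewrite /corrector_th0; bounded_tac.
have bth1 : bounded admissible (fun i => corrector_th1 (cc (c_t i)) (gam1 (c_t i)) (gam2 (c_t i))
   (cos (c_th i)) (sin (c_th i))).
  by rewrite /corrector_th1; bounded_tac.
have bVth : bounded admissible Vth.
  by rewrite /Vth /corrector_th; bounded_tac.
pose main i := c_kap i * inv_n i * (15 / 4 * gam1 (c_t i) + 3 / 4 * cc (c_t i)).
have bthr : bounded admissible (fun i => rateth mu (c_H i) (c_k1 i) (c_k2 i) (c_th i)).
  by rewrite /rateth; bounded_tac.
have cE := close_onB (close_onB (close_onB c2 cVt)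
  (close_onM (rfl Vth) cth (bA _ bVth) (bA _ bthr))) (rfl main).
pose w i := cos (c_th i) * L2 i - sin (c_th i) * L1 i.
pose f1 i := corrector_th1 (cc (c_t i)) (gam1 (c_t i)) (gam2 (c_t i)) (cos (c_th i)) (sin (c_th i)).
(* The bounded quotient by [c_kap] ^ 2 of what remains after these replacements. *)
pose rest i := inv_n i * (cos (c_th i) ^+ 2 * sin (c_th i) * w i
   - 2 * cos (c_th i) * f1 i - cos (c_th i) ^+ 2 * (Vth i * (mu ^+ 2 * (c_H0 i ^+ 3)^-1) ^+ 2)).
have brest : bounded A rest.
  by apply: bA; rewrite /rest /w /f1; bounded_tac.
have := close_on_trans cE (close_on_small err_ge0 brest (_ : forall i, A i -> `|_ - (fun=> 0) i| <= _)).
case=> [i [ai _]|K' hK'].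
  have [_ _ _ [/andP[h3 h4] _]] := ai.
  rewrite subr0.
  set E := (X in `|X|).
  have -> : E = rest i * c_kap i ^+ 2.
    rewrite /E /rest /main /w /f1 /Vth /R0 /inv_n /G0 /corrector_th /corrector_th0 /corrector_th1.
    move: (L1 i) (L2 i) (cos _) (sin _) => l1 l2 C S.
    by field; rewrite !gt_eqF//; lra.
  rewrite normrM ler_wpM2l// ger0_norm ?sqr_ge0//.
  by rewrite /err lerDl sqr_ge0.
exists `|K'| => // i ai /=.
have := hK' i ai; rewrite subr0 => h; apply: le_trans h _.
by rewrite ler_wpM2r// ler_norm.
Qed.

Lemma corrector_bounded : exists2 K : R, 0 <= K & forall t kap th H0,
  1 <= H0 <= 2 -> `|kap| <= 8^-1 ->
  `|(H0 ^+ 3 * (mu ^+ 2)^-1) ^+ 2 *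
    corrector (cc t) (gam1 t) (gam2 t) kap (cos th) (sin th)| <= K.
Proof.
pose A (i : config) := 1 <= c_H0 i <= 2 /\ `|c_kap i| <= 8^-1.
have inv n : bounded_on A (fun i => (rho (c_t i) ^+ n)^-1).
  apply: (bounded_onV (c := r0 ^+ n)); first by rewrite exprn_gt0.
  move=> i _; have /andP[h _] := rhoB (c_t i).
  by rewrite lerXn2r ?nnegrE// ltW// (rho_gt0 r00 rhoB).
have b0 : bounded_on A (fun i => c_H0 i).
  by exists 2 => i [/andP[h1 h2] _]; rewrite ger0_norm//; lra.
have b1 : bounded_on A (fun i => c_kap i) by exists 8^-1 => i [_ h].
have b2 : bounded_on A (fun i => cos (c_th i)) by exists 1 => i _; exact: abs_cos_le1.
have b3 : bounded_on A (fun i => sin (c_th i)) by exists 1 => i _; exact: abs_sin_le1.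
have b4 : bounded_on A (fun i => d1 (c_t i)) by exact: bounded_time.
have b5 : bounded_on A (fun i => d2 (c_t i)) by exact: bounded_time.
have bcst (c : R) : bounded_on A (fun=> c) by exact: bounded_const.
have [K hK] : bounded_on A (fun i => (c_H0 i ^+ 3 * (mu ^+ 2)^-1) ^+ 2 *
    corrector (cc (c_t i)) (gam1 (c_t i)) (gam2 (c_t i)) (c_kap i) (cos (c_th i)) (sin (c_th i))).
  rewrite /corrector /cc /gam1 /gam2.
  by repeat first [assumption | exact: bcst | exact: inv | apply: bounded_onD
    | apply: bounded_onM | apply: bounded_onN | apply: bounded_onX].
exists `|K| => // t kap th H0 h1 h2.
by apply: le_trans (ler_norm K); exact: (hK (Config 0 t H0 kap 0 0 0 th)).
Qed.

End Averaging.

(** * Periodic orbits in the plane *)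

Section PlanarOrbits.
Variables (R : realType) (mu mj : R) (d1 d2 v1 v2 Gam : R -> R) (T r0 B : R).
Hypotheses (mu0 : 0 < mu) (mj0 : 0 < mj) (r00 : 0 < r0) (T0 : 0 < T).
Hypothesis rhoB : forall t, r0 <= rho d1 d2 t <= B.
Hypothesis d1B : forall t, `|d1 t| <= B.
Hypothesis d2B : forall t, `|d2 t| <= B.
Hypothesis v1B : forall t, `|v1 t| <= B.
Hypothesis v2B : forall t, `|v2 t| <= B.
Hypothesis d1D : forall t, drv d1 t (v1 t).
Hypothesis d2D : forall t, drv d2 t (v2 t).
Hypothesis GamD : forall t, drv Gam t ((d1 t ^+ 2 - d2 t ^+ 2) / rho d1 d2 t ^+ 5).
Hypotheses (Gam0 : Gam 0 = 0) (GamT : Gam (T / 2) = 0).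

Local Notation flow eta := (is_flow mu mj d1 d2 eta).

(** The clamped rates are bounded in every state, so the drift is estimated without a continuation
    argument. The order eta ^ 3 is weakened to eta ^ 2, which is all that [near_circular]
    records. *)
Lemma flow_drift : exists2 K : R, 0 <= K & forall (eta : R) x,
  0 < eta <= 1 -> eta ^+ 2 * (32 / mu) <= r0 / 4 -> flow eta x ->
  forall t : R, 0 <= t <= T -> [/\ `|x t i0 - x 0 i0| <= K * eta ^+ 2,
    `|x t i1 - x 0 i1| <= K * eta ^+ 2 & `|x t i2 - x 0 i2| <= K * eta ^+ 2].
Proof.
have [K K0 hK] := rates_bounded mu0 mj0 r00 rhoB d1B d2B.
exists (K * T) => [|eta x e1 es hx t /andP[t0 tT]]; first by rewrite mulr_ge0// ltW.
have /andP[e0 e1'] := e1.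
have e3 : eta ^+ 3 * K * t <= K * T * eta ^+ 2.
  have h1 : eta ^+ 3 <= eta ^+ 2 by rewrite exprS ler_piMl ?sqr_ge0.
  have h2 : eta ^+ 3 * K <= eta ^+ 2 * K by rewrite ler_wpM2r.
  apply: (@le_trans _ _ (eta ^+ 2 * K * t)); first by rewrite ler_wpM2r.
  have -> : K * T * eta ^+ 2 = eta ^+ 2 * K * T by ring.
  by rewrite ler_wpM2l// mulr_ge0 ?sqr_ge0.
have p3 : 0 <= eta ^+ 3 by rewrite exprn_ge0 ?ltW.
have bd s := hK eta s _ _ _ (x s i3) e1 es (clamp_bounded (x s i0) (x s i1) (x s i2)).
have step i : (forall s, `|field mu mj d1 d2 eta s (x s) i| <= eta ^+ 3 * K) ->
    `|x t i - x 0 i| <= K * T * eta ^+ 2.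
  move=> h; apply: le_trans e3; rewrite -[t in leRHS]subr0.
  by apply: (drv_absle t0 (fun s _ => hx s i)) => s _.
split; apply: step => s; rewrite /field /= normrM (ger0_norm p3) ler_wpM2l//;
  by have [] := bd s.
Qed.

Lemma unclamped_field (eta t : R) (s : 'I_4 -> R) : bounded_elements (s i0) (s i1) (s i2) ->
  field mu mj d1 d2 eta t s = mk4
    (eta ^+ 3 * rateH mu mj d1 d2 eta t (s i0) (s i1) (s i2) (s i3))
    (eta ^+ 3 * rate1 mu mj d1 d2 eta t (s i0) (s i1) (s i2) (s i3))
    (eta ^+ 3 * rate2 mu mj d1 d2 eta t (s i0) (s i1) (s i2) (s i3))
    ((eta ^+ 3)^-1 * rateth mu (s i0) (s i1) (s i2) (s i3)).
Proof.
move=> [h0 h1 h2].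
by rewrite /field /clampH /clampK !clamp_id// -ler_norml.
Qed.

Lemma flow_motion (eta : R) x : 0 < eta -> flow eta x ->
  (forall t, bounded_elements (x t i0) (x t i1) (x t i2)) ->
  let X t := eta ^+ 2 * oradius mu (x t i0) (x t i1) (x t i2) (x t i3) * cos (x t i3) in
  let Y t := eta ^+ 2 * oradius mu (x t i0) (x t i1) (x t i2) (x t i3) * sin (x t i3) in
  exists U V : R -> R, forall t,
  [/\ drv X t (U t), drv Y t (V t),
      drv U t (- (mu / Num.sqrt (X t ^+ 2 + Y t ^+ 2) ^+ 3) * X t + tide1 mj d1 d2 t (X t) (Y t)) &
      drv V t (- (mu / Num.sqrt (X t ^+ 2 + Y t ^+ 2) ^+ 3) * Y t + tide2 mj d1 d2 t (X t) (Y t))].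
Proof.
move=> eta0 hx hb X Y.
exists (fun s => - (mu / (eta * x s i0)) * (x s i2 + sin (x s i3))),
       (fun s => mu / (eta * x s i0) * (x s i1 + cos (x s i3))) => t.
have cl := unclamped_field eta t (hb t).
apply: (@osculating_motion R mu mj d1 d2 eta (x ^~ i0) (x ^~ i1) (x ^~ i2) (x ^~ i3) t) => //.
- by have [/andP[h _] _ _] := hb t; lra.
- by have /andP[h _] := denom_bounds (x t i3) (hb t); lra.
- by have := hx t i0; rewrite cl.
- by have := hx t i1; rewrite cl.
- by have := hx t i2; rewrite cl.
- by have := hx t i3; rewrite cl.
Qed.


(** For eta ^ 2 below [m] the drift is at most 1 / 32, which keeps the elements inside the clamping
    intervals when they start with H0 in [1, 2] and eccentricity at most 1 / 16. *)
Lemma flow_stays_circular : exists K m : R, [/\ 0 <= K, 0 < m &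
  forall (eta H0 kap : R) x, 0 < eta <= 1 -> eta ^+ 2 * (32 / mu) <= r0 / 4 -> eta ^+ 2 <= m ->
  1 <= H0 <= 2 -> `|kap| <= 16^-1 -> flow eta x -> x 0 = mk4 H0 kap 0 0 ->
  forall t, 0 <= t <= T ->
    near_circular mu r0 K (Config eta t H0 kap (x t i0) (x t i1) (x t i2) (x t i3)) /\
    [/\ `|x t i0 - H0| <= 32^-1, `|x t i1| <= 3 / 32 & `|x t i2| <= 32^-1]].
Proof.
have [K K0 hK] := flow_drift.
exists K, (32 * (K + 1))^-1; split => //; first by rewrite invr_gt0; lra.
move=> eta H0 kap x e1 es em hH hk hx x0 t ht.
have [g0 g1 g2] := hK eta x e1 es hx t ht.
rewrite x0 /mk4 /= subr0 in g0 g1 g2.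
have Ke : K * eta ^+ 2 <= 32^-1.
  have : K * eta ^+ 2 <= K * (32 * (K + 1))^-1 by rewrite ler_wpM2l.
  move/le_trans; apply; rewrite ler_pdivrMr; last by lra.
  by lra.
have l0 : `|x t i0 - H0| <= 32^-1 by exact: le_trans Ke.
have l1 : `|x t i1| <= 3 / 32.
  rewrite -(subrK kap (x t i1)); apply: le_trans (ler_normD _ _) _.
  by have := le_trans g1 Ke; lra.
have l2 : `|x t i2| <= 32^-1 by exact: le_trans Ke.
split => //; split; last by split.
split => //=; last by split => //; lra.
split; [|lra|lra].
by move: l0; rewrite ler_norml => /andP[? ?]; apply/andP; split; lra.
Qed.

(** The mean motion is proportional to H ^ -3, hence about eight times larger for H0 = 1 than for H0
    = 2. A factor 2 survives the drift and the eccentricity, and leaves room for a multiple of pi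
    between the two bounds. *)
Lemma longitude_bounds : exists2 m : R, 0 < m &
  forall (eta H0 kap : R) x, 0 < eta <= 1 -> eta ^+ 2 * (32 / mu) <= r0 / 4 -> eta ^+ 2 <= m ->
  `|kap| <= 16^-1 -> flow eta x -> x 0 = mk4 H0 kap 0 0 ->
  (H0 = 1 -> (eta ^+ 3)^-1 * mu ^+ 2 * T / 4 <= x (T / 2) i3) /\
  (H0 = 2 -> x (T / 2) i3 <= (eta ^+ 3)^-1 * mu ^+ 2 * T / 8).
Proof.
have [K [m [K0 m0 hm]]] := flow_stays_circular.
exists m => // eta H0 kap x e1 es em hk hx x0.
have T2 : 0 <= T / 2 by rewrite divr_ge0// ltW.
have e3 : 0 < (eta ^+ 3)^-1 by rewrite invr_gt0 exprn_gt0//; have /andP[] := e1.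
pose a : R := (eta ^+ 3)^-1 * mu ^+ 2.
have a0 : 0 < a by rewrite mulr_gt0// exprn_gt0.
have inT t : 0 <= t <= T / 2 -> 0 <= t <= T.
  by move=> /andP[h1 h2]; apply/andP; split => //; lra.
have x03 : x 0 i3 = 0 by rewrite x0.
have en : eta != 0 by rewrite gt_eqF//; have /andP[] := e1.
have lin (c t : R) : drv (fun s => s * c) t c.
  by apply: drv_eq; [exact: drvM (drv_id t) (drv_cst c t)|rewrite mul1r mulr0 addr0].
have hth : 1 <= H0 <= 2 -> forall t, 0 <= t <= T / 2 ->
    drv (x ^~ i3) t (a * (1 + (x t i1 * cos (x t i3) + x t i2 * sin (x t i3))) ^+ 2 / x t i0 ^+ 3)
    /\ [/\ 7 / 8 <= 1 + (x t i1 * cos (x t i3) + x t i2 * sin (x t i3)) <= 9 / 8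
         & `|x t i0 - H0| <= 32^-1].
  move=> hH t ht; have [[[_ _ hb _] _] [l0 l1 l2]] := hm _ _ _ _ e1 es em hH hk hx x0 t (inT t ht).
  split.
    have := hx t i3; rewrite unclamped_field// /mk4 /=.
    by move/drv_eq; apply; rewrite /rateth /a; ring.
  split => //; have := kcos_le (x t i1) (x t i2) (x t i3).
  by rewrite ler_norml => /andP[h1 h2]; apply/andP; split; lra.
split=> H0E.
  have hH : 1 <= H0 <= 2 by rewrite H0E; apply/andP; split; lra.
  have key : T / 2 * (a / 2) - 0 * (a / 2) <= x (T / 2) i3 - x 0 i3; last first.
    move: key; rewrite mul0r x03 !subr0; apply: le_trans.
    by rewrite le_eqVlt; apply/orP; left; apply/eqP; rewrite /a; field.
  apply: (drv_le T2 (fun t _ => lin (a / 2) t) (fun t ht => proj1 (hth hH t ht))).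
  move=> t ht; have [_ [/andP[w1 w2] h]] := hth hH t ht.
  rewrite -mulrA ler_wpM2l ?(ltW a0)//.
  move: h; rewrite H0E ler_norml => /andP[h1 h2].
  have y1 : 31 / 32 <= x t i0 by lra.
  have y2 : x t i0 <= 33 / 32 by lra.
  rewrite ler_pdivlMr; last by rewrite exprn_gt0//; lra.
  have : x t i0 ^+ 3 <= (33 / 32) ^+ 3 by rewrite lerXn2r ?nnegrE//; lra.
  have : (7 / 8) ^+ 2 <= (1 + (x t i1 * cos (x t i3) + x t i2 * sin (x t i3))) ^+ 2.
    by rewrite lerXn2r ?nnegrE//; lra.
  by lra.
have hH : 1 <= H0 <= 2 by rewrite H0E; apply/andP; split; lra.
have key : x (T / 2) i3 - x 0 i3 <= T / 2 * (a / 4) - 0 * (a / 4); last first.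
  move: key; rewrite mul0r x03 !subr0 => /le_trans; apply.
  by rewrite le_eqVlt; apply/orP; left; apply/eqP; rewrite /a; field.
apply: (drv_le T2 (fun t ht => proj1 (hth hH t ht)) (fun t _ => lin (a / 4) t)).
move=> t ht; have [_ [/andP[w1 w2] h]] := hth hH t ht.
rewrite -mulrA ler_wpM2l ?(ltW a0)//.
move: h; rewrite H0E ler_norml => /andP[h1 h2].
have y1 : 63 / 32 <= x t i0 by lra.
rewrite ler_pdivrMr; last by rewrite exprn_gt0//; lra.
have : (63 / 32) ^+ 3 <= x t i0 ^+ 3 by rewrite lerXn2r ?nnegrE//; lra.
have : (1 + (x t i1 * cos (x t i3) + x t i2 * sin (x t i3))) ^+ 2 <= (9 / 8) ^+ 2.
  by rewrite lerXn2r ?nnegrE//; lra.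
by lra.
Qed.

(** The corrected component [W] grows at rate at least eta ^ 3 q del / 2 over the time T / 2. The
    quadrupole correction vanishes at both ends, and each end value of the corrector costs at most a
    quarter of the growth. *)
Lemma eccentricity_sign : exists del m : R, [/\ 0 < del <= 16^-1, 0 < m &
  forall (eta H0 s : R) x, 0 < eta <= 1 -> eta ^+ 2 * (32 / mu) <= r0 / 4 -> eta ^+ 2 <= m ->
  1 <= H0 <= 2 -> s = 1 \/ s = - 1 -> flow eta x -> x 0 = mk4 H0 (s * del) 0 0 ->
  0 < s * x (T / 2) i2].
Proof.
have [K [m [K0 m0 hm]]] := flow_stays_circular.
have [K' K'0 hK'] := averaging_error mu0 mj0 r00 rhoB d1B d2B v1B v2B K.
have [Vb Vb0 hVb] := corrector_bounded mu mj r00 rhoB d1B d2B.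
have B0 : 0 < B by have /andP[h1 h2] := rhoB 0; exact: lt_le_trans (lt_le_trans r00 h1) h2.
(* A lower bound of the definite part of the mean, from H0 >= 1 and rho <= B. *)
pose q := 3 / 4 * (mj / B ^+ 3) / mu ^+ 2.
have q0 : 0 < q.
  by apply: divr_gt0; [apply: mulr_gt0 => //; apply: divr_gt0|]; rewrite ?exprn_gt0.
(* The error quadratic in [del] takes at most a quarter of the mean q del. *)
pose del : R := Num.min 16^-1 (q / (4 * (K' + 1))).
have del0 : 0 < del.
  by rewrite lt_min invr_gt0 ltr0n divr_gt0//; lra.
have del1 : del <= 16^-1 by rewrite ge_min lexx.
have del2 : K' * del <= q / 4.
  have : del <= q / (4 * (K' + 1)) by rewrite ge_min lexx orbT.
  rewrite ler_pdivlMr; last by lra.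
  by have := ltW del0; nra.
have K1 : 0 < K' + 1 by lra.
have V1 : 0 < Vb + 1 by lra.
(* Now [del] is fixed. The second bound gives another quarter of q del to the error in eta ^ 2; the
   third one controls the end values of the corrector. *)
pose m' := Num.min m (Num.min (q * del / (4 * (K' + 1))) (q * del * T / (16 * (Vb + 1)))).
exists del, m'; split; first by rewrite del0.
  by rewrite !lt_min m0 !(divr_gt0, mulr_gt0).
move=> eta H0 s x e1 es em hH hs hx x0.
have /andP[e0 eta_le1] := e1.
have em1 : eta ^+ 2 <= m by apply: le_trans em _; rewrite ge_min lexx.
have em2 : K' * eta ^+ 2 <= q * del / 4.
  have : eta ^+ 2 <= q * del / (4 * (K' + 1)).
    by apply: le_trans em _; rewrite !ge_min lexx orbT.
  rewrite ler_pdivlMr; last by lra.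
  by have := sqr_ge0 eta; nra.
have em3 : Vb * eta ^+ 2 <= q * del * T / 16.
  have : eta ^+ 2 <= q * del * T / (16 * (Vb + 1)).
    by apply: le_trans em _; rewrite !ge_min lexx !orbT.
  rewrite ler_pdivlMr; last by lra.
  by have := sqr_ge0 eta; nra.
have s2 : s * s = 1 by case: hs => ->; ring.
have sn (u : R) : `|s * u| = `|u|.
  by case: hs => ->; rewrite ?mul1r// mulN1r normrN.
have hk : `|s * del| <= 16^-1 by rewrite sn ger0_norm// ltW.
have circ := hm _ _ _ _ e1 es em1 hH hk hx x0.
have T2 : 0 <= T / 2 by rewrite divr_ge0// ltW.
have inT t : 0 <= t <= T / 2 -> 0 <= t <= T.
  by move=> /andP[h1 h2]; apply/andP; split => //; lra.
pose inv_n := H0 ^+ 3 * (mu ^+ 2)^-1.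
have n1 : (mu ^+ 2)^-1 <= inv_n.
  rewrite /inv_n ler_peMl ?invr_ge0 ?sqr_ge0// exprn_ege1//.
  by have /andP[] := hH.
pose V t := corrector (cc mj d1 d2 t) (gam1 mj d1 d2 t) (gam2 mj d1 d2 t) (s * del)
  (cos (x t i3)) (sin (x t i3)).
(* Since the longitude moves at rate eta ^ -3, the factor eta ^ 6 lets the corrector act at the
   order eta ^ 3 of the rate of [k2]. The sign s treats both sides of the rectangle together. *)
pose W t := s * (x t i2 - eta ^+ 6 * (inv_n ^+ 2 * V t)
   - eta ^+ 3 * (s * del) * inv_n * (15 / 4) * mj * Gam t).
pose V' t := corrector (cc' mj d1 d2 v1 v2 t) (gam1' mj d1 d2 v1 v2 t) (gam2' mj d1 d2 v1 v2 t)
   (s * del) (cos (x t i3)) (sin (x t i3)).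
pose Vth t := corrector_th (cc mj d1 d2 t) (gam1 mj d1 d2 t) (gam2 mj d1 d2 t) (s * del)
  (cos (x t i3)) (sin (x t i3)).
pose D t := rate2 mu mj d1 d2 eta t (x t i0) (x t i1) (x t i2) (x t i3)
  - eta ^+ 3 * (inv_n ^+ 2 * V' t)
  - inv_n ^+ 2 * Vth t * rateth mu (x t i0) (x t i1) (x t i2) (x t i3)
  - s * del * inv_n * (15 / 4 * gam1 mj d1 d2 t).
have hW t : 0 <= t <= T / 2 -> drv W t (eta ^+ 3 * (s * D t)).
  move=> ht; have [[[_ _ hb _] _] _] := circ t (inT t ht).
  have f2 := hx t i2; have f3 := hx t i3.
  rewrite unclamped_field// /mk4 /= in f2 f3.
  have hV : drv V t _ := corrector_drv (s * del) (cc_drv mj r00 rhoB d1D d2D t)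
    (gam1_drv mj r00 rhoB d1D d2D t) (gam2_drv mj r00 rhoB d1D d2D t) f3.
  apply: drv_eq.
    exact: drvM (drv_cst s t) (drvB (drvB f2 (drvM (drv_cst (eta ^+ 6) t)
      (drvM (drv_cst (inv_n ^+ 2) t) hV)))
      (drvM (drv_cst (eta ^+ 3 * (s * del) * inv_n * (15 / 4) * mj) t) (GamD t))).
  rewrite /= -/(Vth t) -/(V' t) /D /gam1.
  by field; rewrite !gt_eqF// (rho_gt0 r00 rhoB).
have low t : 0 <= t <= T / 2 -> eta ^+ 3 * (q * del / 2) <= eta ^+ 3 * (s * D t).
  move=> ht; have [nc _] := circ t (inT t ht).
  rewrite ler_wpM2l ?exprn_ge0 ?(ltW e0)//.
  have := hK' _ nc; rewrite /= -/inv_n -/(V' t) -/(Vth t) => h.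
  have {h} : `|s * (D t - s * del * inv_n * (3 / 4 * cc mj d1 d2 t))| <=
      K' * ((s * del) ^+ 2 + eta ^+ 2).
    rewrite sn; apply: le_trans h; rewrite le_eqVlt; apply/orP; left; apply/eqP.
    by congr (`|_|); rewrite /D; ring.
  have -> : (s * del) ^+ 2 = del ^+ 2 by rewrite exprMn expr2 s2 mul1r.
  rewrite ler_norml => /andP[h _].
  have c1 : mj / B ^+ 3 <= cc mj d1 d2 t.
    rewrite /cc ler_wpM2l ?(ltW mj0)// lef_pV2 ?posrE ?exprn_gt0 ?(rho_gt0 r00 rhoB)//.
    have /andP[_ h2] := rhoB t.
    by rewrite lerXn2r ?nnegrE// ltW// (rho_gt0 r00 rhoB).
  have c2 : q <= inv_n * (3 / 4 * cc mj d1 d2 t).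
    rewrite /q [_ / mu ^+ 2]mulrC; apply: ler_pM => //.
    - by rewrite invr_ge0 sqr_ge0.
    - by rewrite mulr_ge0// divr_ge0 ?exprn_ge0 ?(ltW mj0) ?(ltW B0).
    - by rewrite ler_wpM2l.
  have c3 : q * del <= inv_n * (3 / 4 * cc mj d1 d2 t) * del by rewrite ler_wpM2r ?(ltW del0).
  have c4 : K' * del ^+ 2 <= q / 4 * del by rewrite expr2 mulrA ler_wpM2r ?(ltW del0).
  have c5 : s * (s * del * inv_n * (3 / 4 * cc mj d1 d2 t)) =
     inv_n * (3 / 4 * cc mj d1 d2 t) * del.
    by transitivity (s * s * (inv_n * (3 / 4 * cc mj d1 d2 t) * del)); [ring|rewrite s2 mul1r].
  move: h c3 c4 em2; rewrite mulrBr c5 mulrDr; lra.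
have lin (c t : R) : drv (fun s => s * c) t c.
  by apply: drv_eq; [exact: drvM (drv_id t) (drv_cst c t)|rewrite mul1r mulr0 addr0].
have := drv_le T2 (fun t _ => lin (eta ^+ 3 * (q * del / 2)) t) hW low.
have hV8 : `|s * del| <= 8^-1 by lra.
have b0 := hVb 0 (s * del) (x 0 i3) H0 hH hV8.
have b1 := hVb (T / 2) (s * del) (x (T / 2) i3) H0 hH hV8.
rewrite -/inv_n -/(V _) in b0 b1.
have x02 : x 0 i2 = 0 by rewrite x0.
rewrite /W Gam0 GamT x02 !mulr0 mul0r !subr0 sub0r.
set v0 := inv_n ^+ 2 * V 0 in b0 *; set v1' := inv_n ^+ 2 * V (T / 2) in b1 *.
move=> h.
have b0' : `|s * v0| <= Vb by rewrite sn.
have b1' : `|s * v1'| <= Vb by rewrite sn.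
move: b0' b1'; rewrite !ler_norml => /andP[b01 b02] /andP[b11 b12].
have e3 : 0 < eta ^+ 3 by rewrite exprn_gt0.
have e6 : eta ^+ 6 = eta ^+ 3 * eta ^+ 3 by ring.
have e32 : eta ^+ 3 * Vb <= q * del * T / 16.
  apply: le_trans em3; rewrite mulrC ler_wpM2l// [eta ^+ 3]exprS ler_piMl ?sqr_ge0//.
have p1 : eta ^+ 6 * (s * v0) <= eta ^+ 3 * (q * del * T / 16).
  rewrite e6 -mulrA ler_wpM2l ?(ltW e3)//.
  by apply: le_trans e32; rewrite ler_wpM2l ?(ltW e3).
have p2 : - (eta ^+ 3 * (q * del * T / 16)) <= eta ^+ 6 * (s * v1').
  have h1 : eta ^+ 3 * - (s * v1') <= eta ^+ 3 * Vb by rewrite ler_wpM2l ?(ltW e3)// lerNl.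
  have h2 : - (q * del * T / 16) <= eta ^+ 3 * (s * v1') by move: h1 e32; rewrite mulrN; lra.
  have := ler_wpM2l (ltW e3) h2.
  by rewrite mulrN e6 -[_ * _ * (s * v1')]mulrA.
have p3 : 0 < eta ^+ 3 * (q * del * T) by apply: mulr_gt0 => //; apply: mulr_gt0 => //; exact: mulr_gt0.
have -> : s * x (T / 2) i2 = s * (x (T / 2) i2 - eta ^+ 6 * v1') + eta ^+ 6 * (s * v1') by ring.
have e5 : s * - (eta ^+ 6 * v0) = - (eta ^+ 6 * (s * v0)) by ring.
move: h p1 p2 p3; rewrite e5; lra.
Qed.


(** The constant depends on eta, which is enough: [poincare_miranda] is applied at fixed eta. E + 1
    is used as a bound of the square root of E. *)
Lemma flow_lipschitz (eta t : R) : eta ^+ 2 * (32 / mu) <= r0 / 4 ->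
  exists K : R, forall x y H0 kap H1 kap1, flow eta x -> flow eta y ->
    x 0 = mk4 H0 kap 0 0 -> y 0 = mk4 H1 kap1 0 0 ->
    forall i, `|x t i - y t i| <= K * (`|H0 - H1| + `|kap - kap1|).
Proof.
move=> es; have [K hK] := flow_dependence mj mu0 r00 rhoB d1B d2B es.
pose E := expR (K * `|t|); have E0 : 0 < E by exact: expR_gt0.
exists (E + 1) => x y H0 kap H1 kap1 hx hy x0 y0 i.
have := hK x y hx hy t.
rewrite x0 y0 [leRHS]big_ord_recl big_ord_recl big_ord_recl big_ord_recl big_ord0 /mk4 /=.
rewrite (bigD1 i)//= !subrr expr0n !mul0r !addr0 -/E => h.
have h1 : 0 <= \sum_(j < 4 | j != i) (x t j - y t j) ^+ 2.
  by apply: sumr_ge0 => j _; exact: sqr_ge0.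
have s0 : 0 <= `|H0 - H1| + `|kap - kap1| by rewrite addr_ge0.
rewrite -ler_sqr ?nnegrE//; last by rewrite mulr_ge0// addr_ge0// ltW.
rewrite real_normK ?num_real//.
have h2 : (H0 - H1) ^+ 2 + (kap - kap1) ^+ 2 <= (`|H0 - H1| + `|kap - kap1|) ^+ 2.
  rewrite -(real_normK (num_real (H0 - H1))) -(real_normK (num_real (kap - kap1))).
  by have := mulr_ge0 (normr_ge0 (H0 - H1)) (normr_ge0 (kap - kap1)); nra.
have h3 := ler_wpM2l (ltW E0) h2.
have h4 := sqr_ge0 (`|H0 - H1| + `|kap - kap1|).
have h5 : E * (`|H0 - H1| + `|kap - kap1|) ^+ 2 <=
    (E + 1) ^+ 2 * (`|H0 - H1| + `|kap - kap1|) ^+ 2.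
  by rewrite ler_wpM2r//; have := sqr_ge0 E; nra.
rewrite exprMn; lra.
Qed.

Lemma radius_lower_bound (H k1 k2 th : R) : bounded_elements H k1 k2 ->
  (6 * mu)^-1 <= oradius mu H k1 k2 th.
Proof.
move=> hb; have /andP[h1 h2] := denom_bounds th hb; case: hb => /andP[h3 h4] _ _.
have g0 : 0 < mu * (1 + (k1 * cos th + k2 * sin th)) by apply: mulr_gt0 => //; lra.
have m6 : 0 < 6 * mu by rewrite mulr_gt0.
rewrite /oradius ler_pdivlMr// ler_pdivrMl//.
have : 4^-1 <= H ^+ 2.
  by have : 0 <= (H - 2^-1) * (H + 2^-1); [apply: mulr_ge0; lra|nra].
have := ler_wpM2l (ltW mu0) h2.
have := ler_wpM2l (ltW mu0) (_ : 4^-1 <= H ^+ 2).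
by move=> + h5 h6; move=> /(_ h6); lra.
Qed.

End PlanarOrbits.

(** * Existence of the planar periodic orbits *)

Section PeriodicOrbits.
Variables (R : realType) (mu mj : R) (d1 d2 v1 v2 Gam : R -> R) (T r0 B : R).
Hypotheses (mu0 : 0 < mu) (mj0 : 0 < mj) (r00 : 0 < r0) (T0 : 0 < T).
Hypothesis rhoB : forall t, r0 <= rho d1 d2 t <= B.
Hypothesis d1B : forall t, `|d1 t| <= B.
Hypothesis d2B : forall t, `|d2 t| <= B.
Hypothesis v1B : forall t, `|v1 t| <= B.
Hypothesis v2B : forall t, `|v2 t| <= B.
Hypothesis d1D : forall t, drv d1 t (v1 t).
Hypothesis d2D : forall t, drv d2 t (v2 t).
Hypotheses (d1T : periodic d1 T) (d2T : periodic d2 T).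
Hypotheses (d1E : forall t, d1 (- t) = d1 t) (d2O : forall t, d2 (- t) = - d2 t).
Hypothesis GamD : forall t, drv Gam t ((d1 t ^+ 2 - d2 t ^+ 2) / rho d1 d2 t ^+ 5).
Hypotheses (Gam0 : Gam 0 = 0) (GamT : Gam (T / 2) = 0).

Let d1C : continuous d1. Proof. by move=> t; exact: drv_cont (d1D t). Qed.
Let d2C : continuous d2. Proof. by move=> t; exact: drv_cont (d2D t). Qed.

Theorem planar_periodic_orbits : exists2 eta1 : R, 0 < eta1 & forall eta : R, 0 < eta <= eta1 ->
  exists X Y U V : R -> R, [/\ periodic X T, periodic Y T,
    eta ^+ 2 * (32 / mu) <= r0 / 4 & forall t,
    [/\ drv X t (U t), drv Y t (V t),
      drv U t (- (mu / Num.sqrt (X t ^+ 2 + Y t ^+ 2) ^+ 3) * X t + tide1 mj d1 d2 t (X t) (Y t)),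
      drv V t (- (mu / Num.sqrt (X t ^+ 2 + Y t ^+ 2) ^+ 3) * Y t + tide2 mj d1 d2 t (X t) (Y t)) &
      (eta ^+ 2 / (6 * mu)) ^+ 2 <= X t ^+ 2 + Y t ^+ 2 <= (eta ^+ 2 * (32 / mu)) ^+ 2]].
Proof.
have [del [m1 [/andP[del0 del1] m10 hsign]]] :=
  eccentricity_sign mu0 mj0 r00 T0 rhoB d1B d2B v1B v2B d1D d2D GamD Gam0 GamT.
have [m2 m20 hlong] := longitude_bounds mu0 mj0 r00 T0 rhoB d1B d2B.
have [K [m3 [_ m30 hcirc]]] := flow_stays_circular mu0 mj0 r00 T0 rhoB d1B d2B.
have pi0 : 0 < pi :> R by exact: pi_gt0.
(* The bound [m4] keeps the orbit within a quarter of the least distance of the primaries; [m5]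
   makes [L] larger than pi. *)
pose m4 : R := mu * r0 / 128. have m40 : 0 < m4 by rewrite divr_gt0// mulr_gt0.
pose m5 : R := mu ^+ 2 * T / (16 * pi).
have m50 : 0 < m5 by apply: divr_gt0; apply: mulr_gt0 => //; rewrite exprn_gt0.
exists (Num.min 1 (Num.min m1 (Num.min m2 (Num.min m3 (Num.min m4 m5))))).
  by rewrite !lt_min ltr01 m10 m20 m30 m40 m50.
move=> eta /andP[eta0]; rewrite !le_min.
move=> /andP[eta1 /andP[l1 /andP[l2 /andP[l3 /andP[l4 l5]]]]].
have sq : eta ^+ 2 <= eta by rewrite expr2 ler_piMl // ltW.
have e1 : 0 < eta <= 1 by rewrite eta0.
have es : eta ^+ 2 * (32 / mu) <= r0 / 4.
  rewrite mulrA ler_pdivrMr//.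
  by have := le_trans sq l4; rewrite /m4; lra.
have em1 := le_trans sq l1. have em2 := le_trans sq l2. have em3 := le_trans sq l3.
have [F hF] := choice (fun p : R * R =>
  flow_exists mj mu0 r00 rhoB d1B d2B d1C d2C es (mk4 p.1 p.2 0 0)).
pose L : R := (eta ^+ 3)^-1 * mu ^+ 2 * T / 8.
have e3 : 0 < eta ^+ 3 by rewrite exprn_gt0.
have Lpi : pi < L.
  have h1 : eta ^+ 3 <= m5.
    by apply: le_trans l5; rewrite exprS ler_piMr ?(ltW eta0)// exprn_ile1// ltW.
  have h2 : eta ^+ 3 * (16 * pi) <= mu ^+ 2 * T by move: h1; rewrite /m5 ler_pdivlMr// mulr_gt0.
  rewrite /L -mulrA -mulrA mulrC ltr_pdivlMr//.
  by have := mulr_gt0 e3 pi0; lra.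
(* The least multiple of pi above L; it is at most L + pi, hence below 2 L. It counts the half
   revolutions in half a period and grows as eta decreases. *)
pose k := (Num.truncn (L / pi)).+1.
have k1 : L < k%:R * pi by rewrite -ltr_pdivrMr// truncnS_gt.
have k2 : k%:R * pi <= L + pi.
  have L0 : 0 <= L / pi by rewrite divr_ge0// ltW// (lt_trans pi0).
  have /andP[h _] := truncn_itv L0.
  by rewrite -natr1 mulrDl mul1r lerD2r -ler_pdivlMr.
have small kap : - del <= kap <= del -> `|kap| <= 16^-1.
  by rewrite -ler_norml => h; exact: le_trans del1.
have [Kl hKl] := flow_lipschitz mj mu0 r00 rhoB d1B d2B (T / 2) es.
(* The sign of the first function is reversed because the longitude decreases with H0, while the
   theorem wants negative values on the left side. *)
have [|||||H0 [kap [hH hkap]]] := @poincare_miranda R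
  (fun H0 kap => k%:R * pi - F (H0, kap) (T / 2) i3)
  (fun H0 kap => F (H0, kap) (T / 2) i2) 1 2 (- del) del Kl.
- by lra.
- by lra.
- move=> x y x' y' _ _ _ _.
  have [a1 a2] := hF (x, y); have [b1 b2] := hF (x', y').
  have h := hKl _ _ _ _ _ _ a2 b2 a1 b1.
  split; last exact: h.
  have -> : k%:R * pi - F (x, y) (T / 2) i3 - (k%:R * pi - F (x', y') (T / 2) i3) =
    - (F (x, y) (T / 2) i3 - F (x', y') (T / 2) i3) by ring.
  by rewrite normrN; exact: h.
- move=> kap hkap; have sk := small kap hkap.
  have [a1 a2] := hF (1, kap); have [b1 b2] := hF (2, kap).
  have [h1 _] := hlong eta 1 kap _ e1 es em2 sk a2 a1.
  have [_ h2] := hlong eta 2 kap _ e1 es em2 sk b2 b1.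
  have {}h1 := h1 erefl; have {}h2 := h2 erefl.
  have LE : (eta ^+ 3)^-1 * mu ^+ 2 * T / 4 = 2 * L by rewrite /L; field; rewrite gt_eqF.
  rewrite LE in h1; rewrite -/L in h2.
  by split; lra.
- move=> H0 hH.
  have [a1 a2] := hF (H0, - del); have [b1 b2] := hF (H0, del).
  split.
    have := hsign eta H0 (- 1) _ e1 es em1 hH (or_intror erefl) a2.
    by rewrite mulN1r => /(_ a1); rewrite mulN1r oppr_gt0.
  have := hsign eta H0 1 _ e1 es em1 hH (or_introl erefl) b2.
  by rewrite mul1r => /(_ b1); rewrite mul1r.
move=> /eqP; rewrite subr_eq0 => /eqP hth hk2.
have [x0 hx] := hF (H0, kap); move: (F (H0, kap)) x0 hx hth hk2 => x x0 hx hth hk2.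
have per := flow_periodic mu0 r00 rhoB d1B d2B es d1T d2T d1E d2O hx
  (congr1 (@^~ i2) x0) (congr1 (@^~ i3) x0) hk2 (esym hth).
(* The drift estimate covers one period and periodicity of the elements covers the rest, so the
   clamps never act and the true equation is solved. *)
have hb t : bounded_elements (x t i0) (x t i1) (x t i2).
  have [|s hs [<- <- <-]] := @periodic_translate R _ (fun t => (x t i0, x t i1, x t i2)) T t T0.
    by move=> s; rewrite per.
  by have [[[_ _ h _] _] _] := hcirc eta H0 kap x e1 es em3 hH (small _ hkap) hx x0 s hs.
have [U [V hUV]] := flow_motion mu0 eta0 hx hb.
pose X t := eta ^+ 2 * oradius mu (x t i0) (x t i1) (x t i2) (x t i3) * cos (x t i3).
pose Y t := eta ^+ 2 * oradius mu (x t i0) (x t i1) (x t i2) (x t i3) * sin (x t i3).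
have ck u : cos (k%:R * (2 * pi) + u) = cos u by rewrite -[u in LHS]opprK cos_nat_pi2 cosN.
have sk u : sin (k%:R * (2 * pi) + u) = sin u.
  by rewrite -[u in LHS]opprK sin_nat_pi2 sinN opprK.
exists X, Y, U, V; split; [| |exact: es|].
- by move=> t; rewrite /X per /mk4 /= /oradius ck sk.
- by move=> t; rewrite /Y per /mk4 /= /oradius ck sk.
move=> t; have [h1 h2 h3 h4] := hUV t; split => //.
have XY : X t ^+ 2 + Y t ^+ 2 = (eta ^+ 2 * oradius mu (x t i0) (x t i1) (x t i2) (x t i3)) ^+ 2.
  rewrite -[RHS]mulr1 -(cos2Dsin2 (x t i3)) /X /Y; ring.
have /andP[p0 p1] := radius_bounds mu0 (x t i3) (hb t).
have p2 := radius_lower_bound mu0 (x t i3) (hb t).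
have q0 : 0 <= eta ^+ 2 by exact: sqr_ge0.
have c1 : 0 <= (6 * mu)^-1 by rewrite invr_ge0 mulr_ge0// ltW.
have c2 : 0 <= eta ^+ 2 * oradius mu (x t i0) (x t i1) (x t i2) (x t i3).
  by rewrite mulr_ge0// ltW.
rewrite XY; apply/andP; split; apply: lerXn2r; rewrite ?nnegrE//.
- by rewrite mulr_ge0.
- by rewrite ler_wpM2l.
- by rewrite mulr_ge0// (le_trans (ltW p0)).
- by rewrite ler_wpM2l.
Qed.

End PeriodicOrbits.

(** * Reduction to the plane *)

Section VectorDerivatives.
Variables (R : realType) (d : nat).
Implicit Types (f : R -> 'rV[R]_d) (u v w : 'rV[R]_d).

Lemma coord_drv f t (k : 'I_d) : derivable f t 1 ->
  drv (fun s => f s 0 k) t (derive1 f t 0 k).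
Proof.
move=> h; have hk := (derivable_mxP f t 1).1 h.
by split; [exact: hk|rewrite derive1E derive_mx// mxE].
Qed.

Lemma is_derive_coord f t (a : 'rV[R]_d) : (forall k, drv (fun s => f s 0 k) t (a 0 k)) ->
  is_derive t 1 f a.
Proof.
move=> h; have df : derivable f t 1.
  by apply/derivable_mxP => i k; rewrite (ord1 i); have [] := h k.
split => //; rewrite derive_mx//; apply/rowP => k; rewrite mxE.
by have [_ ->] := h k.
Qed.

Lemma edotC u v : edot u v = edot v u.
Proof. by apply: eq_bigr => k _; rewrite mulrC. Qed.

Lemma edotDl u v w : edot (u + v) w = edot u w + edot v w.
Proof. by rewrite -big_split; apply: eq_bigr => k _; rewrite mxE mulrDl. Qed.

Lemma edotZl (a : R) u v : edot (a *: u) v = a * edot u v.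
Proof. by rewrite /edot mulr_sumr; apply: eq_bigr => k _; rewrite mxE mulrA. Qed.

Lemma edot_ge0 u : 0 <= edot u u.
Proof. by apply: sumr_ge0 => k _; rewrite -expr2 sqr_ge0. Qed.

Lemma edot_eq0 u : (edot u u == 0) = (u == 0).
Proof.
apply/eqP/eqP => [h|->]; last by rewrite /edot big1// => k _; rewrite mxE mul0r.
apply/rowP => k; rewrite mxE; apply/eqP.
have /eqP := h; rewrite psumr_eq0; last by move=> j _; rewrite -expr2 sqr_ge0.
by move=> /allP /(_ k (mem_index_enum k)); rewrite -expr2 sqrf_eq0.
Qed.

Lemma edot_gt0 u : u != 0 -> 0 < edot u u.
Proof. by move=> h; rewrite lt_neqAle edot_ge0 andbT eq_sym edot_eq0. Qed.

Lemma edot_combination u v (a b : R) : edot u u = 1 -> edot v v = 1 -> edot u v = 0 ->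
  edot (a *: u + b *: v) (a *: u + b *: v) = a ^+ 2 + b ^+ 2.
Proof.
move=> uu vv uv; rewrite edotDl !edotZl ![edot _ (_ + _)]edotC !edotDl !edotZl.
by rewrite [edot v u]edotC uu vv uv; ring.
Qed.

Lemma edot_drv f (f' : R -> 'rV[R]_d) u t : (forall k, drv (fun s => f s 0 k) t (f' t 0 k)) ->
  drv (fun s => edot u (f s)) t (edot u (f' t)).
Proof.
move=> h; apply: drv_sum => k; apply: drv_eq; first exact: drvM (drv_cst (u 0 k) t) (h k).
by rewrite mul0r add0r.
Qed.

End VectorDerivatives.

(** * Planarity of the relative motion, and an apse as origin of time *)

Section PlanarReduction.
Variables (R : realType) (d : nat) (M T : R) (D D' : R -> 'rV[R]_d).
Hypotheses (M0 : 0 < M) (T0 : 0 < T).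
Hypothesis DD : forall t k, drv (fun s => D s 0 k) t (D' t 0 k).
Hypothesis D'D : forall t k, drv (fun s => D' s 0 k) t (- (M / enorm (D t) ^+ 3) * D t 0 k).
Hypothesis DT : periodic D T.
Hypothesis Dn0 : forall t, D t != 0.

Let N t : R := edot (D t) (D t).
Let N' t : R := 2 * edot (D t) (D' t).
Let N'' t : R := 2 * edot (D' t) (D' t) - 2 * M / enorm (D t).

Let N_gt0 t : 0 < N t. Proof. exact: edot_gt0. Qed.

Let enorm_gt0 t : 0 < enorm (D t). Proof. by rewrite sqrtr_gt0; exact: N_gt0. Qed.

Let enorm_sqr t : enorm (D t) ^+ 2 = N t.
Proof. by rewrite sqr_sqrtr// ltW// N_gt0. Qed.

Let ND t : drv N t (N' t).
Proof.
apply: drv_eq; first by apply: drv_sum => k; exact: drvM (DD t k) (DD t k).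
by rewrite /N' /edot mulr_sumr; apply: eq_bigr => k _ /=; ring.
Qed.

Let N'D t : drv N' t (N'' t).
Proof.
apply: drv_eq.
  apply: drvM (drv_cst 2 t) _; apply: drv_sum => k; exact: drvM (DD t k) (D'D t k).
rewrite mul0r add0r big_split /= mulrDr; congr (_ + _).
transitivity (2 * (- (M / enorm (D t) ^+ 3) * N t)).
  by congr (_ * _); rewrite /N /edot mulr_sumr; apply: eq_bigr => k _; ring.
by rewrite -enorm_sqr; field; rewrite gt_eqF.
Qed.

(** At a minimum of the squared distance [N] the position is orthogonal to the velocity. If the
    velocity vanished there, [N''] would be negative, against minimality. *)
Lemma apsis : exists t0, [/\ edot (D t0) (D' t0) = 0 & D' t0 != 0].
Proof.
have NT : periodic N T by move=> t; rewrite /N DT.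
have NC : continuous N by move=> t; exact: drv_cont (ND t).
have [t0 ht0] := periodic_min T0 NT NC.
have N'0 : N' t0 = 0.
  have := @derive1_at_min R N (t0 - 1) (t0 + 1) t0 _ _ _ _.
  have le : t0 - 1 <= t0 + 1 by lra.
  have der t : t \in `]t0 - 1, t0 + 1[%R -> derivable N t 1 by move=> _; have [] := ND t.
  have mid : t0 \in `]t0 - 1, t0 + 1[%R by rewrite in_itv/=; apply/andP; split; lra.
  move=> /(_ le der mid (fun t _ => ht0 t)) h.
  exact: drv_unique (ND t0) h.
exists t0; split; first by move: N'0; rewrite /N'; lra.
apply/eqP => D'0.
(* With zero velocity [N''] equals - 2 c at t0, so by continuity it stays below - c nearby;
   integrating twice makes [N] drop below its minimum. *)
pose c := M / enorm (D t0).
have c0 : 0 < c by rewrite divr_gt0.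
have N''0 : N'' t0 < - c.
  rewrite /N'' D'0 (_ : edot 0 0 = 0); last by apply/eqP; rewrite edot_eq0.
  by rewrite mulr0 sub0r /c -mulrA; move: c0; rewrite /c; lra.
have N''C : {for t0, continuous N''}.
  have h1 := drv_sum (index_enum 'I_d) (fun k => drvM (D'D t0 k) (D'D t0 k)).
  have h2 := @drv_sqrt _ N t0 _ (N_gt0 t0) (ND t0).
  have en : (fun t => Num.sqrt (N t)) t0 != 0 by rewrite gt_eqF// sqrtr_gt0.
  exact: drv_cont (drvB (drvM (drv_cst 2 t0) h1) (drvM (drv_cst (2 * M) t0)
    (@drvV _ (fun t => Num.sqrt (N t)) t0 _ en h2))).
have [del del0 hdel] : exists2 del : R, 0 < del & forall t, `|t - t0| < del -> N'' t < - c.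
  have nb : nbhs t0 [set t | N'' t < - c] by exact: (@cvgr_lt _ _ _ _ N'' (N'' t0) N''C).
  have /nbhs_ballP[del /= d0 h] := nb; exists del => // t ht; apply: h.
  by rewrite /ball /= distrC.
pose s := t0 + del / 2.
have ts : t0 <= s by rewrite /s; lra.
have near t : t0 <= t <= s -> `|t - t0| < del.
  by rewrite /s => /andP[h1 h2]; rewrite ger0_norm; lra.
have lin (a t : R) : drv (fun s => (s - t0) * a) t a.
  apply: drv_eq; first exact: drvM (drvB (drv_id t) (drv_cst t0 t)) (drv_cst a t).
  by rewrite mulr0 addr0 subr0 mul1r.
have N'le t : t0 <= t <= s -> N' t <= (t - t0) * - c.
  move=> /andP[h1 h2].
  have := drv_le h1 (fun r _ => N'D r) (fun r _ => lin (- c) r).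
  rewrite N'0 subr0 subrr mul0r subr0; apply => r /andP[r1 r2].
  by apply/ltW/hdel/near; rewrite r1 (le_trans r2).
have quad t : drv (fun s => (s - t0) ^+ 2 * (- c / 2)) t ((t - t0) * - c).
  apply: drv_eq.
    exact: drvM (drvX 2 (drvB (drv_id t) (drv_cst t0 t))) (drv_cst (- c / 2) t).
  by rewrite /=; field.
have := drv_le ts (fun r _ => ND r) (fun r _ => quad r) N'le.
have := ht0 s; rewrite subrr expr0n mul0r subr0 => h1 h2.
have : 0 < (s - t0) ^+ 2 * c by rewrite mulr_gt0// exprn_gt0// /s; lra.
by lra.
Qed.

(** Position and velocity at the apse, normalised, are the axes. Each coordinate of the part of [D]
    outside their span solves w'' = - c w with zero initial data and bounded c, so it vanishes by
    Gronwall. *)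
Lemma kepler_planar : exists (t0 : R) (u v : 'rV[R]_d) (d1 d2 v1 v2 : R -> R),
  [/\ edot u u = 1, edot v v = 1, edot u v = 0 &
      forall t, D t = d1 (t - t0) *: u + d2 (t - t0) *: v] /\
  [/\ forall t, 0 < d1 t ^+ 2 + d2 t ^+ 2,
      (forall t, drv d1 t (v1 t)) /\ (forall t, drv d2 t (v2 t)),
      (forall t, drv v1 t (- M * (d1 t / rho d1 d2 t ^+ 3))) /\
      (forall t, drv v2 t (- M * (d2 t / rho d1 d2 t ^+ 3))),
      periodic d1 T /\ periodic d2 T &
      [/\ d2 0 = 0, v1 0 = 0 & v2 0 != 0]].
Proof.
have [t0 [orth D'n0]] := apsis.
pose a := enorm (D t0). pose b := enorm (D' t0).
have a0 : 0 < a by exact: enorm_gt0.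
have b0 : 0 < b by rewrite sqrtr_gt0 edot_gt0.
have b2 : b ^+ 2 = edot (D' t0) (D' t0) by rewrite sqr_sqrtr// edot_ge0.
have a2 : a ^+ 2 = edot (D t0) (D t0) by exact: enorm_sqr.
pose u := a^-1 *: D t0. pose v := b^-1 *: D' t0.
have uu : edot u u = 1.
  by rewrite /u edotZl edotC edotZl -a2; field; rewrite gt_eqF.
have vv : edot v v = 1.
  by rewrite /v edotZl edotC edotZl -b2; field; rewrite gt_eqF.
have uv : edot u v = 0.
  by rewrite /u edotZl edotC /v edotZl edotC orth !mulr0.
pose d1 t := edot u (D (t + t0)). pose d2 t := edot v (D (t + t0)).
pose v1 t := edot u (D' (t + t0)). pose v2 t := edot v (D' (t + t0)).
have d1D t : drv d1 t (v1 t).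
  by apply: (drv_shift (f := fun s => edot u (D s))); apply: edot_drv.
have d2D t : drv d2 t (v2 t).
  by apply: (drv_shift (f := fun s => edot v (D s))); apply: edot_drv.
have acc w t : drv (fun s => edot w (D' s)) t (- (M / enorm (D t) ^+ 3) * edot w (D t)).
  apply: drv_eq.
    apply: (@edot_drv _ _ D' (fun t => - (M / enorm (D t) ^+ 3) *: D t)) => k.
    by rewrite mxE; exact: D'D.
  by rewrite edotC edotZl edotC.
have v1D' t : drv v1 t (- (M / enorm (D (t + t0)) ^+ 3) * d1 t).
  exact: (drv_shift (f := fun s => edot u (D' s))).
have v2D' t : drv v2 t (- (M / enorm (D (t + t0)) ^+ 3) * d2 t).
  exact: (drv_shift (f := fun s => edot v (D' s))).
have D0 : D t0 = a *: u by rewrite /u scalerA divff ?scale1r// gt_eqF.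
have D'0 : D' t0 = b *: v by rewrite /v scalerA divff ?scale1r// gt_eqF.
have d10 : d1 0 = a by rewrite /d1 add0r D0 edotC edotZl uu mulr1.
have d20 : d2 0 = 0 by rewrite /d2 add0r D0 edotC edotZl uv mulr0.
have v10 : v1 0 = 0 by rewrite /v1 add0r D'0 edotC edotZl edotC uv mulr0.
have v20 : v2 0 = b by rewrite /v2 add0r D'0 edotC edotZl vv mulr1.
have [t1 ht1] : exists t1, forall t, N t1 <= N t.
  apply: (periodic_min T0); first by move=> t; rewrite /N DT.
  by move=> t; exact: drv_cont (ND t).
have plane t : D (t + t0) = d1 t *: u + d2 t *: v.
  apply/rowP => k; rewrite mxE [(d1 t *: u) 0 k]mxE [(d2 t *: v) 0 k]mxE.
  pose w s := D (s + t0) 0 k - (d1 s * u 0 k + d2 s * v 0 k).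
  pose w' s := D' (s + t0) 0 k - (v1 s * u 0 k + v2 s * v 0 k).
  pose c s := M / enorm (D (s + t0)) ^+ 3.
  have cst_mul f f' x s : drv f s f' -> drv (fun r => f r * x) s (f' * x).
    by move=> h; apply: drv_eq; [exact: drvM h (drv_cst x s)|rewrite mulr0 addr0].
  have wD s : drv w s (w' s).
    apply: drvB; first exact: (drv_shift (f := fun r => D r 0 k)).
    by apply: drvD; apply: cst_mul.
  have w'D s : drv w' s (- c s * w s).
    apply: drv_eq.
      apply: drvB; first exact: (drv_shift (f := fun r => D' r 0 k) (D'D _ k)).
      by apply: drvD; apply: cst_mul; [exact: v1D'|exact: v2D'].
    by rewrite /w /c; ring.
  pose C := M / Num.sqrt (N t1) ^+ 3.
  have cC s : 0 <= c s <= C.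
    have n1 : 0 < Num.sqrt (N t1) by rewrite sqrtr_gt0.
    have en := enorm_gt0 (s + t0).
    rewrite /c divr_ge0 ?exprn_ge0 ?(ltW M0) ?(ltW en)//=.
    rewrite /C ler_wpM2l ?(ltW M0)// lef_pV2 ?posrE ?exprn_gt0//.
    by rewrite lerXn2r ?nnegrE ?(ltW n1) ?(ltW en)//; exact: (ler_wsqrtr (ht1 (s + t0))).
  have gr := @gronwall _ (fun s => w s ^+ 2 + w' s ^+ 2) (fun s => 2 * (w s * w' s) * (1 - c s))
    (1 + C).
  have {gr} : w t ^+ 2 + w' t ^+ 2 <= (w 0 ^+ 2 + w' 0 ^+ 2) * expR ((1 + C) * `|t|).
    apply: gr => s.
      apply: drv_eq; first exact: drvD (drvX 2 (wD s)) (drvX 2 (w'D s)).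
      by rewrite /=; ring.
    rewrite normrM; have /andP[c1 c2] := cC s.
    rewrite mulrC; apply: ler_pM => //.
      by rewrite ler_norml; apply/andP; split; lra.
    have h1 := sqr_ge0 (w s - w' s). have h2 := sqr_ge0 (w s + w' s).
    by rewrite ler_norml; apply/andP; split; lra.
  have -> : w 0 = 0.
    by rewrite /w add0r d10 d20 D0 mxE mul0r addr0 subrr.
  have -> : w' 0 = 0.
    by rewrite /w' add0r v10 v20 D'0 mxE mul0r add0r subrr.
  rewrite expr0n addr0 mul0r => h.
  have h1 := sqr_ge0 (w t). have h2 := sqr_ge0 (w' t).
  have /eqP : w t ^+ 2 = 0 by lra.
  by rewrite sqrf_eq0 /w subr_eq0 => /eqP.
have nrm t : enorm (D (t + t0)) = rho d1 d2 t.
  by rewrite /enorm plane edot_combination.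
exists t0, u, v, d1, d2, v1, v2; split; first by split => // t; rewrite -plane subrK.
split.
- move=> t; rewrite -(edot_combination (d1 t) (d2 t) uu vv uv) -plane; exact: N_gt0.
- by split.
- by split=> t; [apply: drv_eq (v1D' t) _|apply: drv_eq (v2D' t) _]; rewrite nrm; ring.
- by split=> t; rewrite /d1 /d2 addrAC DT.
- by split => //; rewrite v20 gt_eqF.
Qed.

End PlanarReduction.

(** * Return to the original coordinates *)

Section OrbitsNearPrimary.
Variable R : realType.

Lemma coord_is_derive (d : nat) (f : R -> 'rV[R]_d) (t : R) (a : 'rV[R]_d) (k : 'I_d) :
  is_derive t 1 f a -> drv (fun s => f s 0 k) t (a 0 k).
Proof.
move=> [df <-]; rewrite -derive1E; exact: coord_drv.
Qed.

Lemma other_index (i : 'I_2) : exists j : 'I_2, [/\ j != i, forall k, k != i -> k = j &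
  forall (V : zmodType) (F : 'I_2 -> V), \sum_(k < 2) F k = F i + F j].
Proof.
exists (rev_ord i); case: i => [[|[|n]] h] //=.
- split => //.
  + by move=> [[|[|n]] h'] //= _; exact: val_inj.
  + move=> V F; rewrite big_ord_recl big_ord1.
    by congr (F _ + F _); exact: val_inj.
- split => //.
  + by move=> [[|[|n]] h'] //= _; exact: val_inj.
  + move=> V F; rewrite big_ord_recl big_ord1 addrC.
    by congr (F _ + F _); exact: val_inj.
Qed.

Lemma enormN (d : nat) (u : 'rV[R]_d) : enorm (- u) = enorm u.
Proof. by rewrite /enorm -scaleN1r edotZl edotC edotZl; congr Num.sqrt; ring. Qed.

(** The two-sided bound on the distance has three uses: it excludes collisions, gives convergence to
    the primary, and separates orbits of different scales. *)
Lemma periodic_orbits_near_primary (d : nat) (m : 'I_2 -> R) (e : R) (X : 'I_2 -> R -> 'rV[R]_d)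
    (i : 'I_2) : (forall k, 0 < m k) -> keplerian_motion m e X ->
  exists2 eta1 : R, 0 < eta1 & forall eta : R, 0 < eta <= eta1 ->
  exists q : R -> 'rV[R]_d, generalized_periodic_solution m X i q /\
    forall t, eta ^+ 2 / (6 * m i) <= enorm (q t - X i t) <= eta ^+ 2 * (32 / m i).
Proof.
move=> m0 [hne hacc [T T0 hT] _].
have [j [ji honly hsum]] := other_index i.
have ij : i != j by rewrite eq_sym.
pose D t := X j t - X i t.
pose D' t := derive1 (X j) t - derive1 (X i) t.
pose M := m i + m j.
have M0 : 0 < M by rewrite addr_gt0.
have derX k l (t : R) : k != l -> derivable (X k) t 1.
  by move=> kl; have [h _] := hacc k l t kl; exact: nbhs_singleton h.
have symD t : X i t - X j t = - D t by rewrite /D opprB.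
have DD t k : drv (fun s => D s 0 k) t (D' t 0 k).
  rewrite /D' !mxE.
  have h := drvB (coord_drv k (derX j i t ji)) (coord_drv k (derX i j t ij)).
  by apply: drv_ext h => s; rewrite /D !mxE.
have D'D t k : drv (fun s => D' s 0 k) t (- (M / enorm (D t) ^+ 3) * D t 0 k).
  have [_ aj] := hacc j i t ji; have [_ ai] := hacc i j t ij.
  have h := drvB (coord_is_derive k aj) (coord_is_derive k ai).
  apply: (@drv_ext _ (fun s => derive1 (X j) s 0 k - derive1 (X i) s 0 k)).
    by move=> s; rewrite /D' !mxE.
  apply: drv_eq h _; rewrite /gravity symD enormN -/(D t) scalerN !mxE.
  by rewrite /M; ring.
have DT : periodic D T by move=> t; rewrite /D !hT.
have Dn0 t : D t != 0 by rewrite subr_eq0 hne.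
have [t0 [u [v [d1 [d2 [v1 [v2 [[uu vv uv hD]]]]]]]]] := kepler_planar M0 T0 DD D'D DT Dn0.
move=> [dn0 [d1D d2D] [v1D v2D] [d1T d2T] [d20 v10 v20]].
have [r0 [B [r00 hB]]] := kepler_bounds T0 dn0 d1D d2D v1D v2D d1T d2T.
have rhoB t : r0 <= rho d1 d2 t <= B by have [] := hB t.
have d1B t : `|d1 t| <= B by have [] := hB t.
have d2B t : `|d2 t| <= B by have [] := hB t.
have v1B t : `|v1 t| <= B by have [] := hB t.
have v2B t : `|v2 t| <= B by have [] := hB t.
have refl := kepler_reflection M0 T0 dn0 d1D d2D v1D v2D d1T d2T d20 v10.
have d1E t : d1 (- t) = d1 t by have [] := refl t.
have d2O t : d2 (- t) = - d2 t by have [] := refl t.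
have [Gam [GamD Gam0 GamT]] :=
  kepler_quadrupole_primitive M0 T0 dn0 d1D d2D v1D v2D d1T d2T d20 v10 v20.
have [eta1 eta10 horb] := planar_periodic_orbits (m0 i) (m0 j) r00 T0 rhoB d1B d2B v1B v2B
  d1D d2D d1T d2T d1E d2O GamD Gam0 GamT.
exists eta1 => // eta heta; have /andP[eta0 _] := heta.
have [Xp [Yp [U [V [XT YT small hXY]]]]] := horb eta heta.
pose z t := Xp (t - t0) *: u + Yp (t - t0) *: v.
pose q t := X i t + z t.
pose q1 t := derive1 (X i) t + (U (t - t0) *: u + V (t - t0) *: v).
have qz t : q t - X i t = z t by rewrite /q addrC addKr.
have qzD t : q t - X j t = z t - D t by rewrite /D opprB addrA -[q t]/(X i t + z t) [z t + _]addrC.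
have zz t : edot (z t) (z t) = Xp (t - t0) ^+ 2 + Yp (t - t0) ^+ 2 by exact: edot_combination.
have zDE t : z t - D t = (Xp (t - t0) - d1 (t - t0)) *: u + (Yp (t - t0) - d2 (t - t0)) *: v.
  by rewrite hD /z !scalerBl opprD addrACA.
have lin (f f' : R -> R) (w : 'rV[R]_d) t k : (forall s, drv f s (f' s)) ->
    drv (fun s => (f (s - t0) *: w) 0 k) t (f' (t - t0) * w 0 k).
  move=> hf; apply: (drv_ext (f := fun s => f (s - t0) * w 0 k)).
    by move=> s; rewrite mxE.
  apply: drv_eq; first exact: drvM (drv_shift (hf (t + - t0))) (drv_cst (w 0 k) t).
  by rewrite mulr0 addr0.
have XD t : drv Xp t (U t) by have [] := hXY t.
have YD t : drv Yp t (V t) by have [] := hXY t.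
have qD (t : R) : is_derive t 1 q (q1 t).
  apply: is_derive_coord => k.
  apply: (drv_ext (f := fun s => X i s 0 k + ((Xp (s - t0) *: u) 0 k + (Yp (s - t0) *: v) 0 k))).
    by move=> s; rewrite !mxE.
  apply: drv_eq.
    exact: drvD (coord_drv k (derX i j t ij)) (drvD (lin Xp U u t k XD) (lin Yp V v t k YD)).
  by rewrite !mxE.
have q1E : derive1 q = q1.
  by apply/funext => t; rewrite derive1E; have [_ ->] := qD t.
have enz t : enorm (z t) = Num.sqrt (Xp (t - t0) ^+ 2 + Yp (t - t0) ^+ 2).
  by rewrite /enorm zz.
have acc (t : R) : is_derive t 1 (derive1 q) (\sum_(k < 2) gravity (m k) (X k t) (q t)).
  rewrite q1E hsum; apply: is_derive_coord => k.
  have [_ ai] := hacc i j t ij.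
  have UD s : drv U s (- (m i / Num.sqrt (Xp s ^+ 2 + Yp s ^+ 2) ^+ 3) * Xp s
      + tide1 (m j) d1 d2 s (Xp s) (Yp s)) by have [] := hXY s.
  have VD s : drv V s (- (m i / Num.sqrt (Xp s ^+ 2 + Yp s ^+ 2) ^+ 3) * Yp s
      + tide2 (m j) d1 d2 s (Xp s) (Yp s)) by have [] := hXY s.
  apply: (drv_ext (f := fun s => derive1 (X i) s 0 k + ((U (s - t0) *: u) 0 k + (V (s - t0) *: v) 0 k))).
    by move=> s; rewrite !mxE.
  apply: drv_eq.
    exact: drvD (coord_is_derive k ai) (drvD (lin U _ u t k UD) (lin V _ v t k VD)).
  rewrite /gravity symD qz qzD enormN enz.
  have -> : enorm (z t - D t) = Num.sqrt ((Xp (t - t0) - d1 (t - t0)) ^+ 2 +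
      (Yp (t - t0) - d2 (t - t0)) ^+ 2).
    by rewrite /enorm zDE edot_combination.
  have -> : enorm (D t) = rho d1 d2 (t - t0) by rewrite /enorm hD edot_combination.
  rewrite zDE hD /z /tide1 /tide2 scalerN.
  rewrite !mxE; ring.
have lo : 0 < eta ^+ 2 / (6 * m i) by rewrite divr_gt0 ?exprn_gt0 ?mulr_gt0.
have bounds t : eta ^+ 2 / (6 * m i) <= enorm (q t - X i t) <= eta ^+ 2 * (32 / m i).
  have [_ _ _ _ /andP[h1 h2]] := hXY (t - t0).
  have p2 : 0 <= eta ^+ 2 * (32 / m i) by rewrite mulr_ge0 ?sqr_ge0// divr_ge0 ?ltW.
  rewrite qz enz; apply/andP; split.
    by rewrite -[leLHS](ger0_norm (ltW lo)) -sqrtr_sqr ler_wsqrtr.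
  by rewrite -[leRHS](ger0_norm p2) -sqrtr_sqr ler_wsqrtr.
have Z0 : collisions (X i) q = set0.
  apply/seteqP; split => t //; rewrite /collisions /= => h.
  have /andP[h1 _] := bounds t; move: h1; rewrite h subrr /enorm.
  have -> : edot (0 : 'rV[R]_d) 0 = 0 by apply/eqP; rewrite edot_eq0.
  by rewrite sqrtr0 leNgt lo.
exists q; split=> //; split; last first.
  exists T => // t; rewrite /q /z hT.
  have -> : t + T - t0 = (t - t0) + T by ring.
  by rewrite XT YT.
split; rewrite ?Z0 //.
- move=> t; apply/differentiable_continuous/derivable1_diffP.
  by have [] := qD t.
- move=> k t ki; rewrite (honly k ki); apply/eqP => h.
  have zD : z t = D t by apply/eqP; rewrite -subr_eq0 -qzD h subrr.
  have /andP[_ h2] := bounds t; rewrite qz zD in h2.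
  (* Meeting the other primary would need a distance of at least r0 from [X i], while the orbit
     stays within r0 / 4. *)
  have : enorm (D t) = rho d1 d2 (t - t0) by rewrite /enorm hD edot_combination.
  have /andP[r1 _] := rhoB (t - t0).
  by move=> hr; move: h2; rewrite hr; lra.
- by apply/seteqP; split => // t /isolatedS.
- move=> t _; split; last exact: acc.
  have dq s : derivable q s 1 by have [] := qD s.
  exact: (@nearW _ (nbhs t) _ _ dq).
Qed.

End OrbitsNearPrimary.

Theorem corollary1p2 (R : realType) (d : nat) (m : 'I_2 -> R) (e : R)
    (X : 'I_2 -> R -> 'rV[R]_d) :
  (2 <= d)%N ->
  (forall i : 'I_2, 0 < m i) ->
  0 <= e < 1 ->
  keplerian_motion m e X ->
  forall i : 'I_2, infinitely_many_accumulating m X i.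
Proof.
move=> _ m0 _ hX i; have mi := m0 i.
have [eta1 eta10 horb] := periodic_orbits_near_primary i m0 hX.
(* The orbit of scale eta lies between the radii eta ^ 2 / (6 m) and 32 eta ^ 2 / m, whose ratio is
   192. The ratio 16 divides eta ^ 2 by 256, so successive annuli are disjoint and the orbits
   distinct. *)
pose eta (n : nat) : R := geometric eta1 16^-1 n.
have eta0 n : 0 < eta n by rewrite /eta /= mulr_gt0// exprn_gt0.
have eta_le n : 0 < eta n <= eta1.
  by rewrite eta0 /eta /= ler_piMr ?(ltW eta10)// exprn_ile1//; lra.
have eta_lt k n : eta (k + n).+1 <= eta k / 16.
  have -> : eta (k + n).+1 = eta k / 16 * 16^-1 ^+ n.
    by rewrite /eta /= exprS exprD; ring.
  by rewrite ler_piMr ?divr_ge0 ?(ltW (eta0 k))// exprn_ile1//; lra.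
have [q hq] := choice (fun n => horb (eta n) (eta_le n)).
exists q; split.
- suff lt n k : (n < k)%N -> q n <> q k.
    by move=> n k e'; case: (ltngtP n k) => // h; [case: (lt n k h)|case: (lt k n h)].
  move=> nk e'.
  have [_ /(_ 0)/andP[h1 _]] := hq n; have [_ /(_ 0)/andP[_ h2]] := hq k.
  rewrite e' in h1; have h3 := le_trans h1 h2.
  have hk : eta k <= eta n / 16 by have := eta_lt n (k - n.+1)%N; rewrite -addSn subnKC.
  have hk2 : eta k ^+ 2 <= (eta n / 16) ^+ 2.
    by apply: lerXn2r; rewrite ?nnegrE// ?divr_ge0// ltW.
  move: h3; rewrite mulrA ler_pdivlMr// invfM mulrA divfK ?gt_eqF//.
  by have := exprn_gt0 2 (eta0 n); move: hk2; rewrite expr_div_n; lra.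
- by move=> n; have [] := hq n.
have lim0 : (fun n => eta n ^+ 2 * (32 / m i)) @ \oo --> (0 : R).
  have h : eta @ \oo --> (0 : R).
    by apply: cvg_geometric; rewrite ger0_norm// invf_lt1//; lra.
  have -> : (0 : R) = 0 * 0 * (32 / m i) by rewrite !mul0r.
  by apply: cvgM; [exact: cvgM|exact: cvg_cst].
apply: (@squeeze_cvge _ _ _ _ (fun=> 0%E) _ (fun n => (eta n ^+ 2 * (32 / m i))%:E)).
(* The supremum is at least the nonnegative distance at time 0, and at most the outer radius. *)
- apply: nearW => n; have [_ hn] := hq n; apply/andP; split.
    apply: ereal_sup_ge; exists (enorm (q n 0 - X i 0))%:E; first by exists 0.
    by rewrite lee_fin sqrtr_ge0.
  by apply: ge_ereal_sup => _ [t _ <-]; rewrite lee_fin; have /andP[] := hn t.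
- exact: cvg_cst.
- by apply: cvg_EFin => //; apply: nearW.
Qed.
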